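(* Let $1\le p<\infty$ and $\alpha,\beta>0$ with $\alpha+\beta<1$. There is a constant $C>0$ such that, if $f=J_\alpha g$ (with the integral defining $J_\alpha g(x)$ absolutely convergent for a.e. $x$), then $$\iint_{X\times X}\frac{|f(x)-f(y)|^p}{d(x,y)^{N+(\alpha+\beta)p}}\,dm(y)\,dm(x)\le C\iint_{X\times X}\frac{|g(x)-g(z)|^p}{d(x,z)^{N+\beta p}}\,dm(z)\,dm(x).$$ In particular, $J_\alpha$ is a continuous linear operator from $B^\beta_{p,p}$ to $B^{\alpha+\beta}_{p,p}$.
   Context: Setting: $(X,d,m)$ is a metric space with a Borel measure $m$ such that $m(X)=\infty$ and, for some $N>0$ (Ahlfors $N$-regularity), $c^{-1}r^N\le m(B(x,r))\le c\,r^N$ for all $x\in X$, $r>0$, with $c$ independent of $x,r$. Approximation of the identity: fix a non-negative decreasing $C^\infty$ function $h:[0,\infty)\to\mathbb{R}$ with $h\equiv1$ on $[0,1/2]$ and $h\equiv0$ on $[2,\infty)$. For $t>0$ let $T_tf(x)=t^{-N}\int_X h(d(x,y)/t)f(y)\,dm(y)$, $\varphi(x,t)=1/T_t1(x)$, $\psi(x,t)=1/T_t\left(\frac{1}{T_t1}\right)(x)$, and $$s(x,y,t)=\frac{\varphi(x,t)\varphi(y,t)}{t^{2N}}\int_X h\left(\tfrac{d(x,z)}{t}\right)h\left(\tfrac{d(y,z)}{t}\right)\psi(z,t)\,dm(z).$$ Bessel potential: for $\alpha>0$, $k_\alpha(x,y)=\alpha\int_0^\infty\frac{t^\alpha}{(1+t^\alpha)^2}s(x,y,t)\frac{dt}{t}$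 and $J_\alpha g(x)=\int_X g(z)k_\alpha(x,z)\,dm(z)$. Besov spaces: for $1\le p<\infty$, $t>0$ and $f$ locally integrable, $E_pf(t)=\left(\int_X\frac{1}{m(B(x,t))}\int_{B(x,t)}|f(x)-f(y)|^p\,dm(y)\,dm(x)\right)^{1/p}$. For $\alpha>0$, $B^\alpha_{p,p}$ is the space of functions with finite norm $\|f\|_{B^\alpha_{p,p}}=\|f\|_p+\left(\int_0^\infty t^{-\alpha p}E_pf(t)^p\frac{dt}{t}\right)^{1/p}$; an equivalent norm is $\|f\|_p+\left(\iint\frac{|f(x)-f(y)|^p}{d(x,y)^{\alpha p}m(B(x,d(x,y)))}\,dm(y)\,dm(x)\right)^{1/p}$. *)

(* Defs.v *)
From HB Require Import structures.
From mathcomp Require Import all_boot all_order all_algebra.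
From mathcomp Require Import all_classical all_reals all_analysis.
Set Implicit Arguments.
Unset Strict Implicit.
Unset Printing Implicit Defensive.
Import Order.TTheory GRing.Theory Num.Theory.
Import numFieldNormedType.Exports.
Local Open Scope classical_set_scope.
Local Open Scope ring_scope.

(* A metric space carrying its Borel sigma-algebra.  The point required by
   [measurableType] costs nothing here: a space of infinite measure is
   nonempty. *)
HB.mixin Record Metric_Measurable_isBorel (d : measure_display)
    (R : numDomainType) M & Metric R M & Measurable d M := {
  borel_measurableE : @measurable d M = <<s @open M >>
}.

#[short(type="borelMetricType")]
HB.structure Definition BorelMetric (d : measure_display)
    (R : numDomainType) :=
  { M of Metric R M & Measurable d M & Metric_Measurable_isBorel d R M }.

Section ahlfors_besov.
Context {d : measure_display} {R : realType} {X : borelMetricType d R}.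
Implicit Types (m : {measure set X -> \bar R}) (N p a t : R) (h : R -> R).
Implicit Types (f g : X -> R) (x y z : X).

Definition ahlfors_regular m N : Prop :=
  exists2 c : R, 0 < c & forall x (r : R), 0 < r ->
    ((c^-1 * r `^ N)%:E <= m (ball x r) <= (c * r `^ N)%:E)%E.

(* Only the values of h on [0, +oo[ matter.  Smoothness is only required on
   ]0, +oo[, because h is constant near 0 in [0, +oo[, so that its one-sided
   derivatives of all orders at 0 exist. *)
Definition cutoff h : Prop :=
  [/\ forall u, 0 <= u -> 0 <= h u,
      forall u v, 0 <= u -> u <= v -> h v <= h u,
      forall n u, 0 < u -> derivable (derive1n n h) u 1,
      forall u, 0 <= u -> u <= 2^-1 -> h u = 1 &
      forall u, 2 <= u -> h u = 0].

Definition approx_id m N h t f x : R :=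
  t `^ (- N) * \int[m]_y (h (mdist x y / t) * f y).

Definition approx_phi m N h x t : R := (approx_id m N h t (cst 1) x)^-1.

Definition approx_psi m N h x t : R :=
  (approx_id m N h t (fun y => approx_phi m N h y t) x)^-1.

Definition approx_kernel m N h x y t : R :=
  approx_phi m N h x t * approx_phi m N h y t / t `^ (2 * N) *
  \int[m]_z (h (mdist x z / t) * h (mdist y z / t) * approx_psi m N h z t).

(* Extended-real valued: the kernel may be infinite on the diagonal. *)
Definition bessel_kernel m N h a x y : \bar R :=
  (a%:E * \int[lebesgue_measure]_(t in `]0%R, +oo[)
    (t `^ a / (1 + t `^ a) ^+ 2 * approx_kernel m N h x y t / t)%:E)%E.

Definition bessel_convergent m N h a g x : Prop :=
  m.-integrable [set: X] (fun z => (g z)%:E * bessel_kernel m N h a x z)%E.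

(* Meaningful at the points x such that [bessel_convergent m N h a g x]. *)
Definition bessel_potential m N h a g x : R :=
  fine (\int[m]_z ((g z)%:E * bessel_kernel m N h a x z))%E.

Definition loc_integrable m f : Prop :=
  measurable_fun [set: X] f /\
  forall x (r : R), 0 < r -> m.-integrable (ball x r) (EFin \o f).

Definition besov_modulus m p f t : \bar R :=
  ((\int[m]_x ((m (ball x t))^-1 *
      \int[m]_(y in ball x t) (`|f x - f y| `^ p)%:E)) `^ p^-1)%E.

Definition besov_norm m a p f : \bar R :=
  ('N[m]_p%:E[EFin \o f] +
   (\int[lebesgue_measure]_(t in `]0%R, +oo[)
      ((t `^ (- (a * p)) / t)%:E * besov_modulus m p f t `^ p)) `^ p^-1)%E.

Definition besov m a p : set (X -> R) :=
  [set f | loc_integrable m f /\ (besov_norm m a p f < +oo)%E].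

(* A continuous linear operator between two spaces A and B of functions
   identified when they agree almost everywhere, normed by nA and nB. *)
Definition continuous_linear_operator m (A B : set (X -> R))
    (nA nB : (X -> R) -> \bar R) (T : (X -> R) -> X -> R) : Prop :=
  [/\ forall g, A g -> B (T g),
      forall g1 g2, A g1 -> A g2 ->
        ae_eq m setT g1 g2 -> ae_eq m setT (T g1) (T g2),
      forall (k : R) g1 g2, A g1 -> A g2 ->
        ae_eq m setT (T (fun x => k * g1 x + g2 x))
                     (fun x => k * T g1 x + T g2 x) &
      forall g0, A g0 -> forall e : R, 0 < e -> exists2 r : R, 0 < r &
        forall g, A g -> (nA (g \- g0)%R < r%:E)%E ->
          (nB (T g \- T g0)%R < e%:E)%E].

End ahlfors_besov.

(* Main.v *)
(* The kernel s is nonnegative, symmetric, of integral one in each variable,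
   bounded by a multiple of t^-N and supported in d(x, y) < 4 t; since the cutoff
   is Lipschitz, s(x, z, t) - s(y, z, t) = O(t^-N d(x, y) / t) for d(x, y) <= t.
   As k_alpha(x, .) and k_alpha(y, .) have the same integral, f(x) - f(y) is the
   integral of (g(z) - g(x)) (k_alpha(x, z) - k_alpha(y, z)) in z. Splitting the
   t-integral that defines k_alpha at t = d(x, y) bounds it by weighted averages
   over t of |g(x) - g(z)| and |g(y) - g(z)| on balls of radius 5 t, plus
   d(x, y)^alpha |g(x) - g(y)|. Splitting in t rather than in z avoids pointwise
   bounds on k_alpha, whose form depends on the sign of N - alpha. Jensen's
   inequality for these averages, Tonelli's theorem and integrals of powers of
   the distance then give the inequality.
   By Tonelli's theorem the two expressions of the Besov norm are comparable,
   and Jensen's inequality bounds J_alpha on L^p. The distance is measurable on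
   X * X because Ahlfors regularity makes X separable. *)
Require Import Defs.
From HB Require Import structures.
From mathcomp Require Import all_boot all_order all_algebra.
From mathcomp Require Import all_classical all_reals all_analysis measurable_realfun.
From mathcomp Require Import ring lra.
Set Implicit Arguments.
Unset Strict Implicit.
Unset Printing Implicit Defensive.
Import Order.TTheory GRing.Theory Num.Theory.
Import numFieldNormedType.Exports.
Local Open Scope classical_set_scope.
Local Open Scope ring_scope.

(** * Integration *)

(** The estimate is a count of powers of t and of r = d(x, y). Jensen's inequality is applied
    jointly in (z, t), to weights depending only on r and t, multiplied by the indicator of a ball
    of radius 5 t. With delta = 1 - alpha - beta, their masses are of order r^alpha for t < r and
    r^(- delta) for t >= r. After division by r^(N + (alpha + beta) p), y occurs only through r and
    can be integrated out before t. Both ranges then leave t^(- E - 1) with E = N + beta p, and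
    integrating this over t > d(x, z) / 5 restores d(x, z)^(- E). The condition alpha + beta < 1
    enters twice, as delta > 0: the weight for t >= r must be integrable at infinity, and d(x, y)^(-
    N + delta) must be integrable in y near x. The kernel may be infinite on a null set, and the
    potential makes sense only almost everywhere. So the algebra is done with a real-valued version
    of the kernel, at points of convergence, and the bounds are stated for any f that agrees with
    the potential almost everywhere. *)

Section integral_lemmas.
Context {d : measure_display} {T : measurableType d} {R : realType}.
Variable mu : {measure set T -> \bar R}.

(** The integral of a non-negative function is a supremum over the simple functions below it, and
    those below [f] lie below [g]. Thus iterated integrals can be compared without first proving the
    inner ones measurable. *)
Lemma le_integral_ge0 (D : set T) (f g : T -> \bar R) :
  (forall x, D x -> (0 <= f x)%E) -> (forall x, D x -> (f x <= g x)%E) ->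
  (\int[mu]_(x in D) f x <= \int[mu]_(x in D) g x)%E.
Proof.
move=> f0 fg; rewrite !ge0_integralE//; last first.
  by move=> x Dx; exact: le_trans (f0 _ Dx) (fg _ Dx).
apply: ereal_sup_le => _ [k /= kf <-]; exists k => // x.
exact: le_trans (kf x) (lee_restrict fg x).
Qed.

Lemma ge0_integralZl_le (D : set T) (f g : T -> \bar R) (c : R) :
  measurable D -> measurable_fun D g -> 0 <= c ->
  (forall x, D x -> (0 <= f x)%E) -> (forall x, D x -> (0 <= g x)%E) ->
  (forall x, D x -> (f x <= c%:E * g x)%E) ->
  (\int[mu]_(x in D) f x <= c%:E * \int[mu]_(x in D) g x)%E.
Proof.
move=> mD mg c0 f0 g0 fg.
rewrite -ge0_integralZl//; first exact: le_integral_ge0.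
Qed.

End integral_lemmas.

Lemma measurable_fun_powR {d : measure_display} {T : measurableType d}
    {R : realType} (D : set T) (f : T -> R) (p : R) :
  measurable_fun D f -> measurable_fun D (fun x => f x `^ p).
Proof. by move=> mf; apply: (@measurableT_comp _ _ _ _ _ _ (@powR R ^~ p)). Qed.

Lemma le_poweR {R : realType} (r : R) (x y : \bar R) :
  0 <= r -> (0 <= x)%E -> (x <= y)%E -> (x `^ r <= y `^ r)%E.
Proof.
move=> r0 x0 xy; rewrite gt0_ler_poweR//; rewrite in_itv/= leey andbT//.
exact: le_trans xy.
Qed.

(** * Jensen's inequality for powers and weights of bounded mass *)

Section jensen.
Context {R : realType}.

(* Weighted arithmetic-geometric mean inequality, i.e. the tangent line of
   [u |-> u `^ p] at [l]. *)
Lemma powR_tangent (p l u : R) : 1 <= p -> 0 < l -> 0 <= u ->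
  u <= l * (1 - p^-1) + p^-1 * l `^ (1 - p) * u `^ p.
Proof.
move=> p1 l0; have p0 : 0 < p by lra.
have ip : p^-1 <= 1 by rewrite invf_le1.
have ip0 : 0 < p^-1 by rewrite invr_gt0.
rewrite le_eqVlt => /predU1P[<-|u0].
  rewrite powR0 ?gt_eqF// mulr0 addr0 mulr_ge0//; first exact: ltW.
  by rewrite subr_ge0.
(* With u = l exp(v) the claim, divided by u, reads 1 <= (1 - 1/p) exp(- v) + (1/p) exp((p - 1) v).
   Bounding both exponentials by 1 + x makes the terms in v cancel. *)
pose v := ln (u / l).
have uE : u = l * expR v by rewrite lnK ?posrE ?divr_gt0// mulrCA divff ?mulr1// gt_eqF.
have e1 := expR_ge1Dx ((p - 1) * v).
have e2 := expR_ge1Dx (- v).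
have upE : l `^ (1 - p) * u `^ p = u * expR ((p - 1) * v).
  rewrite {1}uE powRM ?expR_ge0 ?ltW// mulrA -powRD; last first.
    by apply/implyP => _; rewrite gt_eqF.
  rewrite subrK powRr1 ?ltW// -expRM uE -mulrA -expRD; congr (_ * expR _); ring.
have lE : l = u * expR (- v) by rewrite uE -mulrA -expRD subrr expR0 mulr1.
rewrite -(mulrA p^-1) upE {1}lE.
rewrite -mulrA (mulrC p^-1) -mulrA -mulrDr ler_pMr//.
apply: (@le_trans _ _ ((1 - v) * (1 - p^-1) + (1 + (p - 1) * v) * p^-1)).
  by rewrite le_eqVlt; apply/orP; left; apply/eqP; field; rewrite gt_eqF.

by apply: lerD; apply: ler_wpM2r => //; rewrite ?subr_ge0 ?invr_ge0 // ltW.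
Qed.

Context {d : measure_display} {T : measurableType d}.
Variable mu : {measure set T -> \bar R}.

Lemma jensen_powR (p M : R) (w u : T -> R) : 1 <= p -> 0 < M ->
  measurable_fun setT w -> measurable_fun setT u ->
  (forall x, 0 <= w x) -> (forall x, 0 <= u x) ->
  (\int[mu]_x (w x)%:E <= M%:E)%E ->
  ((\int[mu]_x (w x * u x)%:E) `^ p <=
    (M `^ (p - 1))%:E * \int[mu]_x (w x * u x `^ p)%:E)%E.
Proof.
move=> p1 M0 mw mu' w0 u0 wM; have p0 : 0 < p by lra.
have ip : p^-1 <= 1 by rewrite invf_le1.
have mup : measurable_fun setT (fun x => w x * u x `^ p).
  apply: measurable_funM => //.
  exact: measurable_fun_powR.
set I := (\int[mu]_x (w x * u x `^ p)%:E)%E.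
have I0 : (0 <= I)%E.
  by apply: integral_ge0 => x _; rewrite lee_fin mulr_ge0// powR_ge0.
have Mp0 : 0 < M `^ (p - 1) by rewrite powR_gt0.
have : (I < +oo \/ I = +oo)%E.
  by case: (ltP I +oo%E) => [|]; [left|right; apply/eqP; rewrite eq_le leey].
case => [|->]; last by rewrite gt0_muley ?lte_fin// leey.
rewrite -ge0_fin_numE// => /fineK Ii.
have i0 : 0 <= fine I by rewrite fine_ge0.
set i := fine I in Ii i0.
(* The integral [i] may vanish, and then it would give no positive point of tangency; hence some j >
   i, which decreases to [i] at the end. *)
have key j : i < j -> ((\int[mu]_x (w x * u x)%:E) `^ p <= (M `^ (p - 1) * j)%:E)%E.
  move=> ij; have j0 : 0 < j by lra.
  (* Integrate the tangent line at the point suggested by equality. *)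
  pose l := (j / M) `^ p^-1.
  have jM0 : 0 < j / M by rewrite divr_gt0.
  have l0 : 0 < l by rewrite powR_gt0.
  have lp : l `^ p = j / M by rewrite /l -powRrM mulVf ?powRr1 ?ltW// gt_eqF.
  suff h : (\int[mu]_x (w x * u x)%:E <= (l * M)%:E)%E.
    have -> : M `^ (p - 1) * j = (l * M) `^ p.
      rewrite powRM ?ltW// lp -(mulr_powRB1 (ltW M0) p0).
      by rewrite mulrA divfK ?gt_eqF// mulrC.
    rewrite -poweR_EFin le_poweR//; first exact: ltW.
    by apply: integral_ge0 => x _; rewrite lee_fin mulr_ge0.
  have k1 : 0 <= l * (1 - p^-1) by rewrite mulr_ge0 ?subr_ge0// ltW.
  have k2 : 0 <= p^-1 * l `^ (1 - p) by rewrite mulr_ge0 ?powR_ge0 ?invr_ge0// ltW.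
  apply: (@le_trans _ _ (\int[mu]_x ((l * (1 - p^-1))%:E * (w x)%:E +
     (p^-1 * l `^ (1 - p))%:E * (w x * u x `^ p)%:E))%E).
    apply: le_integral_ge0 => x _; first by rewrite lee_fin mulr_ge0.
    rewrite -!EFinM -EFinD lee_fin.
    apply: le_trans (ler_wpM2l (w0 x) (powR_tangent p1 l0 (u0 x))) _.
    by rewrite le_eqVlt; apply/orP; left; apply/eqP; ring.
  rewrite ge0_integralD//; last 4 first.
  - by move=> x _; rewrite -EFinM lee_fin mulr_ge0.
  - by apply/measurable_EFinP; apply: measurable_funM.
  - by move=> x _; rewrite -EFinM lee_fin mulr_ge0// mulr_ge0// powR_ge0.
  - by apply/measurable_EFinP; apply: measurable_funM.
  rewrite !ge0_integralZl//; try exact/measurable_EFinP.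
  2, 3: by move=> x _; rewrite lee_fin ?mulr_ge0 ?powR_ge0.
  rewrite -/I -Ii.
  apply: (@le_trans _ _ ((l * (1 - p^-1))%:E * M%:E + (p^-1 * l `^ (1 - p))%:E * j%:E)%E).
    by rewrite leeD// ?lee_wpmul2l// ?lee_fin// ltW.
  rewrite -!EFinM -EFinD lee_fin.
  have jE : j = M * l `^ p by rewrite lp mulrC divfK ?gt_eqF.
  rewrite {1}jE.
  have lE : l `^ (1 - p) * l `^ p = l.
    rewrite -powRD; last by apply/implyP => _; rewrite gt_eqF.
    by rewrite subrK powRr1// ltW.
  have -> : p^-1 * l `^ (1 - p) * (M * l `^ p) = p^-1 * M * (l `^ (1 - p) * l `^ p) by ring.
  by rewrite lE le_eqVlt; apply/orP; left; apply/eqP; ring.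
rewrite -Ii -EFinM; apply/lee_addgt0Pr => e e0.
rewrite -EFinD; apply: le_trans (key (i + e / M `^ (p - 1)) _) _.
  by rewrite ltrDl divr_gt0.
by rewrite lee_fin mulrDr (mulrCA _ e) divff ?mulr1// gt_eqF.
Qed.

End jensen.

(** * Integrals of powers on half-lines and near 0 *)

Section power_integrals.
Context {R : realType}.
Notation mu := (@lebesgue_measure R).
Implicit Types a e t : R.

Lemma continuous_powR e t : 0 < t -> {for t, continuous (@powR R ^~ e)}.
Proof.
move=> t0; apply: differentiable_continuous; apply/derivable1_diffP.
by apply: derivable_powR; rewrite in_itv/= t0.
Qed.

Lemma powR_pinfty0 e : 0 < e -> t `^ (- e) @[t --> +oo] --> (0:R).
Proof.
move=> e0; apply/cvgrPdist_le => /= eps eps0; near=> t.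
have t0 : 0 < t by near: t; exact: nbhs_pinfty_gt.
rewrite sub0r normrN ger0_norm ?powR_ge0// powRN.
rewrite -[eps]invrK lef_pV2 ?posrE ?invr_gt0 ?powR_gt0//.
have -> : eps^-1 = ((eps^-1) `^ e^-1) `^ e.
  by rewrite -powRrM mulVf ?gt_eqF// powRr1// invr_ge0 ltW.
apply: ge0_ler_powR; rewrite ?nnegrE ?powR_ge0 ?(ltW e0) ?(ltW t0)//.
Unshelve. all: by end_near. Qed.

Lemma is_derive_powR_div e t : e != 0 -> 0 < t ->
  is_derive t 1 (fun u => u `^ e / e) (t `^ (e - 1)).
Proof.
move=> e0 t0; have h := is_derive1_powR e t0.
have -> : (fun u => u `^ e / e) = e^-1 \*: (@powR R ^~ e).
  by apply/funext => u /=; rewrite mulrC.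
apply: is_derive_eq.
by rewrite /GRing.scale/= mulrA mulVf// mul1r.
Qed.

Lemma integral_powR_pinfty a e : 0 < a -> 0 < e ->
  (\int[mu]_(t in `]a, +oo[) (t `^ (- e - 1))%:E = (a `^ (- e) / e)%:E)%E.
Proof.
move=> a0 e0; have Ne0 : - e != 0 by rewrite oppr_eq0 gt_eqF.
have pos x : a <= x -> 0 < x by exact: lt_le_trans.
have dF x : a <= x -> is_derive x 1 (fun u => u `^ (- e) / - e) (x `^ (- e - 1)).
  by move=> /pos x0; exact: is_derive_powR_div.
rewrite integral_itv_obnd_cbnd; last first.
  by apply/measurable_EFinP; apply: measurable_fun_powR.
rewrite (@ge0_continuous_FTC2y _ _ (fun u => u `^ (- e) / - e) _ 0).
- by rewrite sub0e -EFinN invrN mulrN opprK.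
- by move=> x _; exact: powR_ge0.
- apply/continuous_within_itvcyP; split.
    by move=> x; rewrite in_itv/= andbT => /ltW/pos; exact: continuous_powR.
  by apply: cvg_at_right_filter; exact: continuous_powR.
- rewrite -[X in _ --> X](mul0r (- e)^-1); apply: cvgMl.
  exact: powR_pinfty0.
- by move=> x /ltW /dF [].
- apply: cvg_at_right_filter.
  suff : {for a, continuous (fun u => u `^ (- e) / - e)} by [].
  apply: differentiable_continuous.
  by apply/derivable1_diffP; case: (dF a (lexx _)).
- by move=> x; rewrite in_itv/= andbT => /ltW /dF h; rewrite derive1E derive_val.
Qed.

Lemma integral_powR_0 a e : 0 < a -> 0 < e ->
  (\int[mu]_(t in `]0%R, a]) (t `^ (e - 1))%:E <= (a `^ e / e)%:E)%E.
Proof.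
move=> a0 e0; have ne0 : e != 0 by rewrite gt_eqF.
(* For e < 1 the integrand blows up at 0, so the fundamental theorem is applied on compact intervals
   exhausting the domain. The shift by two keeps them nondegenerate already at n = 0. *)
pose F n := `[a / n.+2%:R, a]%classic.
have F0 n : 0 < a / n.+2%:R by rewrite divr_gt0.
have -> : `]0%R, a]%classic = \bigcup_n F n.
  apply/seteqP; split => [x/=|x [n _]]; rewrite /F/= !in_itv/=.
    move=> /andP[x0 xa]; have ax0 : 0 <= a / x by rewrite divr_ge0 ?ltW.
    have [n nax] : exists n : nat, a / x <= n%:R.
      by exists (Num.truncn (a / x)).+1; exact/ltW/Num.Theory.truncnS_gt.
    exists n => //; rewrite /F/= in_itv/= xa andbT ler_pdivrMr// mulrC -ler_pdivrMr//.
    by apply: (le_trans nax); rewrite ler_nat leqW// leqW.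
  by move=> /andP[nx ->]; rewrite andbT (lt_le_trans (F0 n)).
have : (\int[mu]_(x in F n) (x `^ (e - 1))%:E)%E @[n --> \oo] -->
    (\int[mu]_(x in \bigcup_n F n) (x `^ (e - 1))%:E)%E.
  apply: ge0_nondecreasing_set_cvg_integral => //.
  - move=> m n mn; apply/subsetPset => x; rewrite /F/= !in_itv/= => /andP[mx ->].
    rewrite andbT (le_trans _ mx)// ler_pM2l// lef_pV2 ?posrE// ler_nat.
    by rewrite !ltnS.
  - by move=> n; exact: measurable_itv.
  - by move=> n; apply/measurable_EFinP; apply: measurable_fun_powR.
  - by move=> n x _; rewrite lee_fin powR_ge0.
move=> /cvg_lim <-//; apply: lime_le.
  apply: ereal_nondecreasing_is_cvgn => m n mn.
  apply: ge0_subset_integral => //; do ?exact: measurable_itv.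
    by apply/measurable_EFinP; apply: measurable_fun_powR.
    by move=> x _; rewrite lee_fin powR_ge0.
  move=> x; rewrite /F/= !in_itv/= => /andP[mx ->].
  rewrite andbT (le_trans _ mx)// ler_pM2l// lef_pV2 ?posrE// ler_nat.
  by rewrite !ltnS.
apply: nearW => n.
have na : a / n.+2%:R < a.
  by rewrite ltr_pdivrMr// ltr_pMr// ltr1n.
have pos x : a / n.+2%:R <= x -> 0 < x by exact: lt_le_trans.
have dG x : a / n.+2%:R <= x -> is_derive x 1 (fun u => u `^ e / e) (x `^ (e - 1)).
  by move=> /pos x0; exact: is_derive_powR_div.
have cG x : a / n.+2%:R <= x -> {for x, continuous (fun u => u `^ e / e)}.
  move=> /dG [h _]; apply: differentiable_continuous.
  exact/derivable1_diffP.
rewrite (@continuous_FTC2 _ _ (fun u => u `^ e / e))//.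
- by rewrite -EFinB lee_fin lerBlDr lerDl divr_ge0 ?powR_ge0// ltW.
- apply/continuous_within_itvP => //; split.
  + by move=> x; rewrite in_itv/= => /andP[/ltW/pos x0 _]; exact: continuous_powR.
  + by apply: cvg_at_right_filter; exact: continuous_powR.
  + by apply: cvg_at_left_filter; exact: continuous_powR.
- split.
  + by move=> x; rewrite in_itv/= => /andP[/ltW/dG[h _] _].
  + by apply: cvg_at_right_filter; exact: cG.
  + by apply: cvg_at_left_filter; apply: cG; exact: ltW.
- by move=> x; rewrite in_itv/= => /andP[/ltW /dG h _]; rewrite derive1E derive_val.
Qed.

End power_integrals.

(** * Ahlfors regular spaces *)

Section borel_metric.
Context {d : measure_display} {R : realType} {X : borelMetricType d R}.
Implicit Types (x y : X) (r : R).

Lemma open_mdist_lt x r : open [set y : X | mdist x y < r].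
Proof.
rewrite openE => y /= xyr; rewrite /interior; apply/nbhs_ballP.
exists (r - mdist x y) => /=; first by rewrite subr_gt0.
move=> z; rewrite ballEmdist/= => yz.
by rewrite (le_lt_trans (metric_triangle x y z))// -ltrBrDl.
Qed.

Lemma measurable_ball_borel x r : measurable (ball x r : set X).
Proof.
rewrite ballEmdist borel_measurableE.
by apply: sub_gen_smallest; exact: open_mdist_lt.
Qed.

Lemma measurable_mdist_center {d' : measure_display} {T : measurableType d'}
    x (u : T -> X) :
  measurable_fun setT u -> measurable_fun setT (fun q => mdist x (u q)).
Proof.
move=> mu; apply: (measurability (@RGenInftyO.G R)) => [|/= _ [_] [r] -> <-].
  exact: RGenInftyO.measurableE.
rewrite setTI (_ : _ @^-1` _ = u @^-1` ball x r).
  by rewrite -[X in measurable X]setTI; apply: mu => //; exact: measurable_ball_borel.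
by rewrite ballEmdist; apply/seteqP; split => q /=; rewrite in_itv.
Qed.

(* Via [mdist x y = inf_n (mdist x (a n) + mdist (a n) y)]. *)
Lemma measurable_fun_mdist_dense {d' : measure_display} {T : measurableType d'}
    (a : nat -> X) (u v : T -> X) :
  (forall x r, 0 < r -> exists n, mdist (a n) x < r) ->
  measurable_fun setT u -> measurable_fun setT v ->
  measurable_fun setT (fun q => mdist (u q) (v q)).
Proof.
move=> da mu mv.
apply: (measurability (@RGenInftyO.G R)) => [|/= _ [_] [r] -> <-].
  exact: RGenInftyO.measurableE.
rewrite setTI (_ : _ @^-1` _ = \bigcup_n
    ((fun q => mdist (a n) (u q) + mdist (a n) (v q)) @^-1` `]-oo, r[)).
  apply: bigcup_measurable => n _; rewrite -[X in measurable X]setTI.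
  by apply: measurable_funD => //; exact: measurable_mdist_center.
apply/seteqP; split => q /=; rewrite in_itv/=.
  move=> uvr; have [n nu] := da (u q) ((r - mdist (u q) (v q)) / 2) ltac:(lra).
  exists n => //=; rewrite in_itv/=.
  have := metric_triangle (a n) (u q) (v q); lra.
move=> [n _ /=]; rewrite in_itv/=; have := metric_triangle (u q) (a n) (v q).
rewrite (metric_sym (u q) (a n)); lra.
Qed.

End borel_metric.

Section ahlfors_regular.
Context {d : measure_display} {R : realType} {X : borelMetricType d R}.
Variables (m : {measure set X -> \bar R}) (N : R).
Hypothesis m_regular : ahlfors_regular m N.

Lemma ahlfors_finite_net (x0 : X) (r e : R) : 0 < e ->
  exists s : seq X, forall y, mdist x0 y < r -> exists2 z, z \in s & mdist z y < e.
Proof.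
(* Otherwise some ball contains arbitrarily many disjoint balls of radius
   [e / 2], whose measure is bounded below. *)
move: m_regular => [c c0 hc] e0; apply: contrapT => /forallNP nocover.
have {}nocover (s : seq X) : exists2 y, mdist x0 y < r &
    forall z, z \in s -> e <= mdist z y.
  have /existsNP[y /not_implyP[xy /forall2NP h]] := nocover s.
  by exists y => // z zs; rewrite leNgt; apply/negP => zy; case: (h z).
have e20 : 0 < e / 2 by rewrite divr_gt0.
pose eps := c^-1 * (e / 2) `^ N.
have eps0 : 0 < eps by rewrite mulr_gt0 ?invr_gt0// powR_gt0.
pose B (s : seq X) := [set w : X | exists2 z, z \in s & mdist z w < e / 2].
have r0 : 0 < r.
  have [y xy _] := nocover [::]; exact: le_lt_trans (mdist_ge0 _ _) xy.
have step n : exists s : seq X, [/\ forall z, z \in s -> mdist x0 z < r,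
    measurable (B s) & ((n%:R * eps)%:E <= m (B s))%E].
  elim: n => [|n [s [sr mB ns]]].
    exists [::]; have -> : B [::] = set0 by apply/seteqP; split => // w [].
    by split => //; rewrite measure0 mul0r.
  have [y xy sy] := nocover s.
  have BE : B (y :: s) = ball y (e / 2) `|` B s.
    rewrite ballEmdist; apply/seteqP; split => w.
      move=> [z]; rewrite inE => /predU1P[->|zs] zw; first by left.
      by right; exists z.
    move=> [yw|[z zs zw]]; first by exists y => //; rewrite inE eqxx.
    by exists z => //; rewrite inE zs orbT.
  exists (y :: s); split.
  - by move=> z; rewrite inE => /predU1P[->//|/sr].
  - by rewrite BE; apply: measurableU => //; exact: measurable_ball_borel.
  - rewrite BE measureU//; last 2 first.
    + exact: measurable_ball_borel.
    + apply/seteqP; split => // w; rewrite ballEmdist => -[/= yw [z zs zw]].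
      have := sy z zs; have := metric_triangle z w y; rewrite (metric_sym w y).
      lra.
    rewrite -natr1 mulrDl mul1r addrC EFinD; apply: leeD => //.
    by have /andP[] := hc y _ e20.
have re0 : 0 < r + e by rewrite addr_gt0.
have [n] : exists n : nat, c * (r + e) `^ N / eps < n%:R.
  by exists (Num.truncn (c * (r + e) `^ N / eps)).+1; exact: Num.Theory.truncnS_gt.
rewrite ltr_pdivrMr// => nK.
have [s [sr mB ns]] := step n.
have : (m (B s) <= m (ball x0 (r + e)))%E.
  apply: le_measure; rewrite ?inE//; first exact: measurable_ball_borel.
  move=> w [z /sr zr zw]; rewrite ballEmdist/=.
  have := metric_triangle x0 z w; lra.
have /andP[_ h1] := hc x0 _ re0.
move=> h2; have := le_trans (le_trans ns h2) h1.
by rewrite lee_fin leNgt nK.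
Qed.

(** Take the union over n and k of finite nets of mesh 1 / (k + 1) in the balls of radius n around
    [point]. Triples (n, k, i) are coded by natural numbers, and [point] is the value at integers
    that code none. *)
Lemma ahlfors_dense :
  exists a : nat -> X, forall x r, 0 < r -> exists n, mdist (a n) x < r.
Proof.
have net (nk : nat * nat) : exists s : seq X, forall y, mdist point y < nk.1%:R ->
    exists2 z, z \in s & mdist z y < nk.2.+1%:R^-1.
  by apply: ahlfors_finite_net; rewrite invr_gt0.
have {net} [s sP] := choice net.
exists (fun j => if unpickle j is Some (n, k, i) then nth point (s (n, k)) i else point).
move=> x r r0.
pose n := (Num.truncn (mdist point x)).+1.
pose k := Num.truncn r^-1.
have [|z zs zx] := sP (n, k) x; first exact: Num.Theory.truncnS_gt.
exists (pickle (n, k, index z (s (n, k)))); rewrite pickleK nth_index//.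
rewrite (lt_trans zx)// -[ltRHS]invrK ltf_pV2 ?posrE ?invr_gt0//.
exact: Num.Theory.truncnS_gt.
Qed.

Lemma measurable_fun_mdist {d' : measure_display} {T : measurableType d'}
    (u v : T -> X) : measurable_fun setT u -> measurable_fun setT v ->
  measurable_fun setT (fun q => mdist (u q) (v q)).
Proof. by have [a] := ahlfors_dense; exact: measurable_fun_mdist_dense. Qed.

Lemma ahlfors_sigma_finite : sigma_finite setT m.
Proof.
have [c c0 hc] := m_regular.
exists (fun n => ball (point : X) n.+1%:R).
  apply/seteqP; split => // x _; exists (Num.truncn (mdist point x)) => //.
  by rewrite ballEmdist/=; exact: Num.Theory.truncnS_gt.
move=> n; split; first exact: measurable_ball_borel.
have n0 : 0 < n.+1%:R :> R by [].
by have /andP[_ /le_lt_trans] := hc point _ n0; apply; rewrite ltry.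
Qed.

End ahlfors_regular.

(** * Measurability and Tonelli's theorem *)

Section measurable_closure.
Context {d : measure_display} {T : measurableType d} {R : realType}.

(** Writing 1 / f as f (f f)^(- 1) reduces to [powR], which gives inverses only on non-negative
    bases. Where f vanishes both sides are 0. *)
Lemma measurable_fun_inv (f : T -> R) :
  measurable_fun setT f -> measurable_fun setT (fun x => (f x)^-1).
Proof.
move=> mf; rewrite (_ : (fun x => _) = fun x => f x * (f x * f x) `^ (-1)).
  by apply: measurable_funM => //; apply: measurable_fun_powR; exact: measurable_funM.
apply/funext => x; rewrite powR_inv1 -?expr2 ?sqr_ge0// expr2.
have [->|fx0] := eqVneq (f x) 0; first by rewrite invr0 mul0r.
by rewrite invfM mulrA divff// mul1r.
Qed.

Lemma measurable_fun_boolR (b : T -> bool) :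
  measurable_fun setT b -> measurable_fun setT (fun x => (b x)%:R : R).
Proof.
move=> mb; have : measurable_fun setT (fun x => if b x then 1 else 0 : R).
  exact: measurable_fun_ifT.
by congr (measurable_fun _ _); apply/funext => x; case: (b x).
Qed.

Lemma measurable_fun_compT {d1 d2 : measure_display} {T1 : measurableType d1}
    {T2 : measurableType d2} (g : T1 -> T2) (u : T -> T1) :
  measurable_fun setT g -> measurable_fun setT u ->
  measurable_fun setT (fun q => g (u q)).
Proof. by move=> mg mu; apply: (measurableT_comp mg mu). Qed.

Lemma measurable_fun_EFin (f : T -> R) :
  measurable_fun setT f -> measurable_fun setT (fun q => (f q)%:E).
Proof. by move=> mf; exact/measurable_EFinP. Qed.

Lemma measurable_fun_pr1 {d1 d2 : measure_display} {T1 : measurableType d1}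
    {T2 : measurableType d2} (u : T -> T1 * T2) :
  measurable_fun setT u -> measurable_fun setT (fun q => (u q).1).
Proof. exact: measurable_fun_compT. Qed.

Lemma measurable_fun_pr2 {d1 d2 : measure_display} {T1 : measurableType d1}
    {T2 : measurableType d2} (u : T -> T1 * T2) :
  measurable_fun setT u -> measurable_fun setT (fun q => (u q).2).
Proof. exact: measurable_fun_compT. Qed.

End measurable_closure.

Section sigma_finite_tonelli.
Context {d1 d2 : measure_display} {T1 : measurableType d1} {T2 : measurableType d2}.
Context {R : realType}.
Variables (m1 : {sigma_finite_measure set T1 -> \bar R}).
Variables (m2 : {sigma_finite_measure set T2 -> \bar R}).

Lemma tonelli_swap (F : T1 -> T2 -> \bar R) :
  measurable_fun setT (fun q : T1 * T2 => F q.1 q.2) ->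
  (forall x y, (0 <= F x y)%E) ->
  (\int[m1]_x \int[m2]_y F x y = \int[m2]_y \int[m1]_x F x y)%E.
Proof.
move=> mF F0.
by apply: (fubini_tonelli (fun q : T1 * T2 => F q.1 q.2)) => // -[].
Qed.

Lemma measurable_fun_integral (F : T1 -> T2 -> \bar R) :
  measurable_fun setT (fun q : T1 * T2 => F q.1 q.2) ->
  (forall x y, (0 <= F x y)%E) ->
  measurable_fun setT (fun x => \int[m2]_y F x y)%E.
Proof.
move=> mF F0.
by apply: (measurable_fun_fubini_tonelli_F (fun q : T1 * T2 => F q.1 q.2)) => // -[].
Qed.

Lemma measurable_fun_Rintegral (F : T1 -> T2 -> R) :
  measurable_fun setT (fun q : T1 * T2 => F q.1 q.2) ->
  (forall x y, 0 <= F x y) ->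
  measurable_fun setT (fun x => \int[m2]_y F x y).
Proof.
move=> mF F0; rewrite /Rintegral.
apply: (measurable_fun_compT (g := fine)) => //.
by apply: measurable_fun_integral => //; exact/measurable_EFinP.
Qed.

End sigma_finite_tonelli.
Arguments tonelli_swap {d1 d2 T1 T2 R m1 m2} F.

(* Restated because the Lebesgue measure is defined on a [g_sigma_algebraType],
   with which the canonical measurable structure of [R] does not unify. *)
Section lebesgue_tonelli.
Context {d : measure_display} {T : measurableType d} {R : realType}.
Variables (m : {sigma_finite_measure set T -> \bar R}).
Notation mu := (@lebesgue_measure R).

Lemma tonelli_lebesgue (F : T -> R -> \bar R) :
  measurable_fun setT (fun q : T * R => F q.1 q.2) ->
  (forall x t, (0 <= F x t)%E) ->
  (\int[m]_x \int[mu]_t F x t = \int[mu]_t \int[m]_x F x t)%E.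
Proof. exact: (@tonelli_swap _ _ _ _ _ m mu F). Qed.

Lemma measurable_fun_integral_lebesgue (F : T -> R -> \bar R) :
  measurable_fun setT (fun q : T * R => F q.1 q.2) ->
  (forall x t, (0 <= F x t)%E) ->
  measurable_fun setT (fun x => \int[mu]_t F x t)%E.
Proof. exact: (@measurable_fun_integral _ _ _ _ _ mu F). Qed.

End lebesgue_tonelli.
Arguments measurable_fun_integral {d1 d2 T1 T2 R m2} F.

(* Redefined in later sections to handle their own functions. *)
Ltac meas_hook := fail.
(** Measurability is proved by descent on the syntax of the function. [mdist] of two varying points
    needs an [ahlfors_regular] hypothesis from the context, because its joint measurability rests on
    separability. *)
Ltac meas_var := match goal with
  | [ H : ahlfors_regular _ _ |- measurable_fun _ (fun q => mdist (@?u q) (@?v q)) ] =>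
    apply: (measurable_fun_mdist H)
  | [ H : ahlfors_regular _ _ |- measurable_fun _ (mdist ?x) ] =>
    apply: (measurable_fun_mdist H (u := fun=> x) (v := fun y => y))
  | [ H : measurable_fun setT _ |- _ ] => apply: (measurable_fun_compT H)
  end.
Ltac meas_step := first [ meas_hook | lazymatch goal with
  | |- measurable_fun _ (fun _ => ?c) => exact: measurable_cst
  | |- measurable_fun _ (fun q => q) => exact: measurable_id
  | |- measurable_fun _ (fun q => @EFin _ (@?f q)) => apply: measurable_fun_EFin
  | |- measurable_fun _ (fun q => @mule _ (@?f q) (@?g q)) => apply: emeasurable_funM
  | |- measurable_fun _ (fun q => @GRing.mul _ (@?f q) (@?g q)) => apply: measurable_funM
  | |- measurable_fun _ (fun q => @GRing.add _ (@?f q) (@GRing.opp _ (@?g q))) =>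
    apply: measurable_funB
  | |- measurable_fun _ (fun q => @GRing.add _ (@?f q) (@?g q)) => apply: measurable_funD
  | |- measurable_fun _ (fun q => @powR _ (@?f q) _) => apply: measurable_fun_powR
  | |- measurable_fun _ (fun q => @GRing.inv _ (@?f q)) => apply: measurable_fun_inv
  | |- measurable_fun _ (fun q => @GRing.natmul _ _ (nat_of_bool (@?b q))) =>
    apply: measurable_fun_boolR
  | |- measurable_fun _ (fun q => @Order.lt _ _ (@?f q) (@?g q)) => apply: measurable_fun_ltr
  | |- measurable_fun _ (fun q => @Order.le _ _ (@?f q) (@?g q)) => apply: measurable_fun_ler
  | |- measurable_fun _ (fun q => @fst _ _ (@?u q)) => apply: measurable_fun_pr1
  | |- measurable_fun _ (fun q => @snd _ _ (@?u q)) => apply: measurable_fun_pr2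
  | |- measurable_fun _ (fun q => @Num.norm _ _ (@?f q)) =>
    apply: (measurable_fun_compT (@normr_measurable _ setT))
  | |- _ => first [ assumption | exact: measurable_id | exact: measurable_fst
    | exact: measurable_snd | meas_var
    | apply: emeasurable_funM | apply: measurable_funM | apply: measurable_funD
    | apply: measurable_fun_powR | apply: measurable_fun_ltr | apply: measurable_fun_ler ]
  end ].
Ltac meas := do ?meas_step.

(** * The approximation of the identity *)

Section approximation_kernel.
Context {d : measure_display} {R : realType} {X : borelMetricType d R}.
Variables (m : {sigma_finite_measure set X -> \bar R}) (N c : R).
Hypothesis m_regular : ahlfors_regular m N.
Hypothesis c_gt0 : 0 < c.
Hypothesis m_ball : forall (x : X) (r : R), 0 < r ->
  ((c^-1 * r `^ N)%:E <= m (ball x r) <= (c * r `^ N)%:E)%E.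

Lemma integral_ball (x : X) (r M : R) : 0 <= M ->
  (\int[m]_y (M * (mdist x y < r)%R%:R)%:E = M%:E * m (ball x r))%E.
Proof.
move=> M0.
under eq_integral do rewrite EFinM.
rewrite ge0_integralZl//; last first.
  by apply/measurable_EFinP; apply: measurable_fun_boolR; meas.
congr (_ * _)%E; rewrite -[ball x r]setIT -integral_indic//; last exact: measurable_ball_borel.
rewrite integral_mkcond; apply: eq_integral => y _.
by rewrite patchE in_setT /indic/= ballEmdist mem_setE.
Qed.

Lemma integral_le_ball (x : X) (r M : R) (F : X -> R) : 0 < r -> 0 <= M ->
  (forall y, 0 <= F y) -> (forall y, F y <= M * (mdist x y < r)%R%:R) ->
  (\int[m]_y (F y)%:E <= (M * c * r `^ N)%:E)%E.
Proof.
move=> r0 M0 F0 FM; apply: (@le_trans _ _ (M%:E * m (ball x r))%E).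
  rewrite -integral_ball//; apply: le_integral_ge0 => y _; first by rewrite lee_fin.
  by rewrite lee_fin.
rewrite -mulrA EFinM lee_wpmul2l ?lee_fin//.
by have /andP[] := m_ball x r0.
Qed.

Lemma integral_ge_ball (x : X) (r M : R) (F : X -> R) : 0 < r -> 0 <= M ->
  (forall y, M * (mdist x y < r)%R%:R <= F y) ->
  ((M * c^-1 * r `^ N)%:E <= \int[m]_y (F y)%:E)%E.
Proof.
move=> r0 M0 FM; apply: (@le_trans _ _ (M%:E * m (ball x r))%E).
  rewrite -mulrA EFinM lee_wpmul2l ?lee_fin//.
  by have /andP[] := m_ball x r0.
rewrite -integral_ball//; apply: le_integral_ge0 => y _; last by rewrite lee_fin.
by rewrite lee_fin mulr_ge0.
Qed.

Section supported.
Variables (x : X) (r M : R) (F : X -> R).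
Hypotheses (r0 : 0 < r) (mF : measurable_fun setT F).
Hypothesis FM : forall y, `|F y| <= M * (mdist x y < r)%R%:R.

Let M0 : 0 <= M.
Proof.
have := FM x; rewrite mdistxx r0 mulr1; exact: le_trans.
Qed.

Lemma integrable_supported : m.-integrable setT (EFin \o F).
Proof.
apply/integrableP; split; first exact/measurable_EFinP.
apply: (@le_lt_trans _ _ (M * c * r `^ N)%:E); last exact: ltry.
by apply: (integral_le_ball (x := x)) => // y; rewrite /= normr_ge0.
Qed.

Lemma EFin_Rintegral_supported : ((\int[m]_y F y)%R%:E = \int[m]_y (F y)%:E)%E.
Proof.
by rewrite /Rintegral fineK//; apply: integrable_fin_num integrable_supported.
Qed.

Lemma Rintegral_supported_le : (`|\int[m]_y F y| <= M * c * r `^ N)%R.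
Proof.
apply: le_trans (le_normr_Rintegral measurableT integrable_supported) _.
rewrite -lee_fin /Rintegral fineK; last first.
  have /integrableP[_ h] := integrable_supported.
  rewrite ge0_fin_numE// integral_ge0// => y _; by rewrite lee_fin.
by apply: (integral_le_ball (x := x)).
Qed.

End supported.

Lemma Rintegral_supported_ge (x : X) (r M r' M' : R) (F : X -> R) :
  0 < r -> 0 < r' -> 0 <= M' -> measurable_fun setT F ->
  (forall y, `|F y| <= M * (mdist x y < r)%R%:R) ->
  (forall y, M' * (mdist x y < r')%R%:R <= F y) ->
  M' * c^-1 * r' `^ N <= \int[m]_y F y.
Proof.
move=> r0 r'0 M'0 mF FM FM'; rewrite -lee_fin (EFin_Rintegral_supported r0 mF FM).
exact: (integral_ge_ball (x := x)).
Qed.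

Variables (h : R -> R) (L : R).
Hypothesis h_ge0 : forall u, 0 <= h u.
Hypothesis h_ni : nonincreasing_fun h.
Hypothesis h_one : forall u, u <= 2^-1 -> h u = 1.
Hypothesis h_zero : forall u, 2 <= u -> h u = 0.
Hypothesis h_lip : forall u v, `|h u - h v| <= L * `|u - v|.

Let h_le1 u : h u <= 1.
Proof.
have [u2|/ltW u2] := leP u 2^-1; first by rewrite h_one.
by rewrite -(h_one (lexx 2^-1)); exact: h_ni.
Qed.

Let L_ge0 : 0 <= L.
Proof.
have := h_lip 1 0; rewrite subr0 normr1 mulr1; exact: le_trans.
Qed.

Let mh : measurable_fun setT h.
Proof. exact: nonincreasing_measurable. Qed.

Let h_supp (x y : X) t : 0 < t -> h (mdist x y / t) <= (mdist x y < 2 * t)%R%:R.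
Proof.
move=> t0; case: ltP => // xy; rewrite h_zero// ler_pdivlMr//.
Qed.

Let h_inner (x y : X) t : 0 < t -> (mdist x y < t / 2)%R%:R <= h (mdist x y / t).
Proof.
move=> t0; case: ltP => // xy; rewrite h_one// ler_pdivrMr//; lra.
Qed.

(** The cutoff at scale t lies between the indicators of the balls of radii t / 2 and 2 t, whose
    measures lie between A^(- 1) t^N and A t^N. *)
Local Notation A := (c * 2 `^ N).

Let A_gt0 : 0 < A. Proof. by rewrite mulr_gt0// powR_gt0. Qed.

Let powN_lo t : 0 < t -> c^-1 * (t / 2) `^ N = A^-1 * t `^ N.
Proof.
move=> t0; rewrite powRM ?ltW ?invr_gt0// invfM.
have -> : 2^-1 `^ N = (2 `^ N)^-1 :> R.
  by rewrite -[in LHS]powR_inv1// -powRrM mulN1r powRN.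
by rewrite mulrAC mulrA mulrAC.
Qed.

Let powN_hi t : 0 < t -> c * (2 * t) `^ N = A * t `^ N.
Proof. by move=> t0; rewrite powRM ?ltW// mulrA. Qed.

(** Source of all size bounds: with w = 1 it controls phi, with w = phi it controls psi, and with w
    a cutoff times psi it controls the overlap integral in s. *)
Lemma Rintegral_cutoff_bounds (x : X) t (w : X -> R) (w0 w1 : R) :
  0 < t -> 0 <= w0 -> measurable_fun setT w ->
  (forall y, w0 <= w y <= w1) ->
  w0 * A^-1 * t `^ N <= \int[m]_y (h (mdist x y / t) * w y) <= w1 * A * t `^ N.
Proof.
move=> t0 w00 mw w01.
have w_ge0 y : 0 <= w y by have /andP[+ _] := w01 y; exact: le_trans.
have w10 : 0 <= w1 by have /andP[+] := w01 x; lra.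
have t20 : 0 < 2 * t by lra.
have t2 : 0 < t / 2 by lra.
have mF : measurable_fun setT (fun y => h (mdist x y / t) * w y) by meas.
have FM y : `|h (mdist x y / t) * w y| <= w1 * (mdist x y < 2 * t)%R%:R.
  rewrite ger0_norm ?mulr_ge0// mulrC ler_pM// ?h_supp//.
  by have /andP[] := w01 y.
apply/andP; split.
  rewrite -mulrA -powN_lo// mulrA.
  apply: (Rintegral_supported_ge t20 t2 w00 mF FM) => y.
  rewrite mulrC ler_pM// ?h_inner//.
  by have /andP[] := w01 y.
rewrite -mulrA -powN_hi// mulrA.
apply: le_trans (ler_norm _) _.
exact: (Rintegral_supported_le t20 mF FM).
Qed.

Let approx_id_bounds (x : X) t (w : X -> R) (w0 w1 : R) :
  0 < t -> 0 <= w0 -> measurable_fun setT w ->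
  (forall y, w0 <= w y <= w1) ->
  w0 * A^-1 <= approx_id m N h t w x <= w1 * A.
Proof.
move=> t0 w00 mw w01.
have tN0 : 0 < t `^ N by rewrite powR_gt0.
have /andP[lo hi] := Rintegral_cutoff_bounds x t0 w00 mw w01.
rewrite /approx_id powRN (mulrC (t `^ N)^-1) ler_pdivlMr// ler_pdivrMr//.
exact/andP.
Qed.

Lemma approx_phi_bounds (x : X) t : 0 < t -> A^-1 <= approx_phi m N h x t <= A.
Proof.
move=> t0.
have /andP[] := @approx_id_bounds x t (cst 1) 1 1 t0 ler01 (measurable_cst _)
  (fun=> introT andP (conj (lexx _) (lexx _))).
rewrite !mul1r => lo hi.
have T0 : 0 < approx_id m N h t (cst 1) x.
  by apply: lt_le_trans lo; rewrite invr_gt0.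
rewrite /approx_phi lef_pV2 ?posrE// hi/=.
by rewrite -[leRHS]invrK lef_pV2 ?posrE ?invr_gt0.
Qed.

(** Stated for every real t, unlike the two-sided bounds: measurability of integrals with parameters
    asks for a sign on the whole product space, including t <= 0. *)
Lemma approx_phi_ge0 (x : X) t : 0 <= approx_phi m N h x t.
Proof.
rewrite invr_ge0 /approx_id mulr_ge0 ?powR_ge0// Rintegral_ge0// => y _.
by rewrite mulr_ge0.
Qed.

Lemma measurable_approx_phi {d' : measure_display} {T : measurableType d'}
    (u : T -> X) (v : T -> R) : measurable_fun setT u -> measurable_fun setT v ->
  measurable_fun setT (fun q => approx_phi m N h (u q) (v q)).
Proof.
move=> mu mv; rewrite /approx_phi /approx_id; meas.
by apply: (@measurable_fun_Rintegral _ _ _ _ _ m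
  (fun q y => h (mdist (u q) y / v q) * (cst 1 : X -> R) y)) => [|q y]; rewrite ?mulr_ge0//; meas.
Qed.

Ltac meas_hook ::= match goal with
  | |- measurable_fun _ (fun q => approx_phi _ _ _ (@?u q) (@?v q)) =>
    apply: measurable_approx_phi
  end.

Lemma approx_psi_bounds (x : X) t : 0 < t ->
  A^-1 ^+ 2 <= approx_psi m N h x t <= A ^+ 2.
Proof.
move=> t0.
have mphi : measurable_fun setT (fun y => approx_phi m N h y t).
  exact: measurable_approx_phi.
have A0 : 0 <= A^-1 by rewrite invr_ge0 ltW.
have /andP[] := @approx_id_bounds x t _ _ _ t0 A0 mphi
  (fun y => approx_phi_bounds y t0).
rewrite -!expr2 => lo hi.
have T0 : 0 < approx_id m N h t (fun y => approx_phi m N h y t) x.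
  by apply: lt_le_trans lo; rewrite exprn_gt0// invr_gt0.
rewrite /approx_psi exprVn lef_pV2 ?posrE ?exprn_gt0// hi/=.
by rewrite -[leRHS]invrK lef_pV2 ?posrE ?invr_gt0 ?exprn_gt0// -exprVn.
Qed.

Lemma approx_psi_ge0 (x : X) t : 0 <= approx_psi m N h x t.
Proof.
rewrite invr_ge0 /approx_id mulr_ge0 ?powR_ge0// Rintegral_ge0// => y _.
by rewrite mulr_ge0// approx_phi_ge0.
Qed.

Lemma measurable_approx_psi {d' : measure_display} {T : measurableType d'}
    (u : T -> X) (v : T -> R) : measurable_fun setT u -> measurable_fun setT v ->
  measurable_fun setT (fun q => approx_psi m N h (u q) (v q)).
Proof.
move=> mu mv; rewrite /approx_psi /approx_id; meas.
apply: (@measurable_fun_Rintegral _ _ _ _ _ m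
  (fun q y => h (mdist (u q) y / v q) * approx_phi m N h y (v q))) => [|q y].
  by meas.
by rewrite mulr_ge0// approx_phi_ge0.
Qed.

Ltac meas_hook ::= match goal with
  | |- measurable_fun _ (fun q => approx_phi _ _ _ (@?u q) (@?v q)) =>
    apply: measurable_approx_phi
  | |- measurable_fun _ (fun q => approx_psi _ _ _ (@?u q) (@?v q)) =>
    apply: measurable_approx_psi
  end.

Local Notation s := (approx_kernel m N h).

Let overlap x y t :=
  \int[m]_z (h (mdist x z / t) * h (mdist y z / t) * approx_psi m N h z t).

Lemma approx_kernel_ge0 x y t : 0 <= s x y t.
Proof.
rewrite /approx_kernel mulr_ge0//; last first.
  by apply: Rintegral_ge0 => z _; rewrite mulr_ge0 ?mulr_ge0// approx_psi_ge0.
by rewrite divr_ge0 ?powR_ge0// mulr_ge0// approx_phi_ge0.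
Qed.

Lemma approx_kernelC x y t : s x y t = s y x t.
Proof.
rewrite /approx_kernel (mulrC (approx_phi _ _ _ x _)); congr (_ * _).
by apply: eq_Rintegral => z _; rewrite (mulrC (h _)).
Qed.

Lemma measurable_approx_kernel {d' : measure_display} {T : measurableType d'}
    (u v : T -> X) (w : T -> R) : measurable_fun setT u ->
  measurable_fun setT v -> measurable_fun setT w ->
  measurable_fun setT (fun q => s (u q) (v q) (w q)).
Proof.
move=> mu mv mw; rewrite /approx_kernel; meas.
apply: (@measurable_fun_Rintegral _ _ _ _ _ m (fun q z =>
  h (mdist (u q) z / w q) * h (mdist (v q) z / w q) * approx_psi m N h z (w q)))
  => [|q z]; last by rewrite mulr_ge0 ?mulr_ge0// approx_psi_ge0.
by meas.
Qed.

Let powR2N t : t `^ (2 * N) = (t `^ N) ^+ 2.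
Proof. by rewrite mulrC powRrM powR_mulrn ?powR_ge0. Qed.

Let weight_bounds y z t : 0 < t ->
  0 <= h (mdist y z / t) * approx_psi m N h z t <= A ^+ 2.
Proof.
move=> t0; rewrite mulr_ge0 ?approx_psi_ge0//=.
rewrite -[leRHS]mul1r ler_pM ?approx_psi_ge0//.
by have /andP[] := approx_psi_bounds z t0.
Qed.

Let overlapE x y t :
  overlap x y t = \int[m]_z (h (mdist x z / t) * (h (mdist y z / t) * approx_psi m N h z t)).
Proof. by apply: eq_Rintegral => z _; rewrite mulrA. Qed.

Let overlap_bounds x y t : 0 < t -> 0 <= overlap x y t <= A ^+ 3 * t `^ N.
Proof.
move=> t0.
have mw : measurable_fun setT (fun z => h (mdist y z / t) * approx_psi m N h z t).
  by meas.
have := Rintegral_cutoff_bounds x t0 (lexx 0) mw (fun z => weight_bounds y z t0).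
by rewrite overlapE !mul0r -exprSr.
Qed.

Lemma approx_kernel_eq0 x y t : 0 < t -> 4 * t <= mdist x y -> s x y t = 0.
Proof.
move=> t0 xy; rewrite /approx_kernel /Rintegral integral0_eq ?mulr0// => z _.
have [xz|xz] := leP (2 * t) (mdist x z).
  by rewrite h_zero ?mul0r// ler_pdivlMr.
rewrite (h_zero (u := mdist y z / t)) ?mulr0 ?mul0r// ler_pdivlMr//.
have := metric_triangle x z y; rewrite (metric_sym z y); lra.
Qed.

(** In A^5, the two factors phi give A^2, psi gives A^2, and the volume of the support of a cutoff
    gives A t^N; the prefactor t^(- 2 N) then leaves t^(- N). *)
Lemma approx_kernel_le x y t : 0 < t ->
  s x y t <= A ^+ 5 * t `^ (- N) * (mdist x y < 4 * t)%R%:R.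
Proof.
move=> t0; case: ltP => xy; last by rewrite approx_kernel_eq0// mulr0.
rewrite mulr1 /approx_kernel -/(overlap x y t) powR2N powRN.
have I0 : 0 < t `^ N by rewrite powR_gt0.
have /andP[ov0 ovA] := overlap_bounds x y t0.
have /andP[_ fx] := approx_phi_bounds x t0.
have /andP[_ fy] := approx_phi_bounds y t0.
have -> : A ^+ 5 / t `^ N = A * A / (t `^ N) ^+ 2 * (A ^+ 3 * t `^ N).
  by field; rewrite gt_eqF.
apply: ler_pM => //.
  by rewrite divr_ge0 ?sqr_ge0// mulr_ge0// approx_phi_ge0.
by rewrite ler_pM2r ?invr_gt0 ?exprn_gt0// ler_pM// approx_phi_ge0.
Qed.

Local Notation B := (c * 3 `^ N).

(** As d(x, y) <= t, both cutoffs vanish outside the ball of radius 3 t about x, of measure at most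
    B t^N. On it their arguments differ by at most d(x, y) / t. *)
Let cutoff_diff x y t (w : X -> R) (M : R) : 0 < t -> mdist x y <= t ->
  measurable_fun setT w -> (forall z, 0 <= w z <= M) ->
  `|\int[m]_z (h (mdist x z / t) * w z) - \int[m]_z (h (mdist y z / t) * w z)|
    <= L * (mdist x y / t) * M * B * t `^ N.
Proof.
move=> t0 xyt mw wM.
have w0 z : 0 <= w z by have /andP[] := wM z.
have M0 : 0 <= M by have /andP[] := wM x; exact: le_trans.
have t30 : 0 < 3 * t by lra.
have bnd u z : mdist x u <= t ->
    `|h (mdist u z / t) * w z| <= M * (mdist x z < 3 * t)%R%:R.
  move=> xu; rewrite ger0_norm ?mulr_ge0// mulrC ler_pM//.
    by have /andP[] := wM z.
  apply: le_trans (h_supp u z t0) _; case: ltP => //= uz.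
  suff -> : mdist x z < 3 * t by [].
  have := metric_triangle x u z; lra.
have mx : measurable_fun setT (fun z => h (mdist x z / t) * w z) by meas.
have my : measurable_fun setT (fun z => h (mdist y z / t) * w z) by meas.
have xx : mdist x x <= t by rewrite mdistxx ltW.
have ix := integrable_supported t30 mx (bnd x ^~ xx).
have iy := integrable_supported t30 my (bnd y ^~ xyt).
rewrite -RintegralB//.
have -> : L * (mdist x y / t) * M * B * t `^ N =
    (L * (mdist x y / t) * M) * c * (3 * t) `^ N.
  by rewrite powRM// ?ltW//; ring.
have md : measurable_fun setT
    (fun z => h (mdist x z / t) * w z - h (mdist y z / t) * w z) by meas.
apply: (Rintegral_supported_le t30 md) => z.
have r0 : 0 <= mdist x y / t by rewrite divr_ge0 ?mdist_ge0// ltW.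
case: ltP => xz.
  rewrite mulr1 -mulrBl normrM (ger0_norm (w0 z)).
  apply: ler_pM => //; last by have /andP[] := wM z.
  apply: le_trans (h_lip _ _) _; rewrite ler_wpM2l// -mulrBl normrM.
  rewrite (ger0_norm (x := t^-1)) ?invr_ge0 ?(ltW t0)// ler_wpM2r ?invr_ge0 ?(ltW t0)//.
  have := metric_triangle x y z; have := metric_triangle y x z.
  rewrite (metric_sym y x) => h1 h2; rewrite ler_norml; lra.
rewrite mulr0 normr_le0 h_zero ?mul0r ?sub0r; last by rewrite ler_pdivlMr//; lra.
rewrite h_zero ?mul0r ?oppr0// ler_pdivlMr//.
have := metric_triangle x y z; lra.
Qed.

Let phi_diff x y t : 0 < t -> mdist x y <= t ->
  `|approx_phi m N h x t - approx_phi m N h y t| <= A ^+ 2 * (L * (mdist x y / t) * B).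
Proof.
move=> t0 xyt.
have mw : measurable_fun setT (cst 1 : X -> R) by [].
have := cutoff_diff t0 xyt mw (fun=> introT andP (conj ler01 (lexx _))).
set V := fun u => \int[m]_z (h (mdist u z / t) * cst 1 z) => dV.
have I0 : 0 < t `^ N by rewrite powR_gt0.
have phiE u : approx_phi m N h u t = t `^ N / V u.
  by rewrite /approx_phi /approx_id powRN invfM invrK.
have V0 u : 0 < V u.
  have /andP[lo _] := @Rintegral_cutoff_bounds u t (cst 1) 1 1 t0 ler01 mw
    (fun=> introT andP (conj (lexx _) (lexx _))).
  by apply: lt_le_trans lo; rewrite mul1r mulr_gt0// invr_gt0.
(* Difference of reciprocals: phi = t^N / V, and [cutoff_diff] bounds the difference of the V's. *)
have -> : approx_phi m N h x t - approx_phi m N h y t =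
    approx_phi m N h x t * approx_phi m N h y t * ((V y - V x) / t `^ N).
  rewrite !phiE; field; by rewrite !gt_eqF.
have /andP[_ fx] := approx_phi_bounds x t0.
have /andP[_ fy] := approx_phi_bounds y t0.
rewrite normrM; apply: ler_pM => //.
  rewrite ger0_norm ?mulr_ge0 ?approx_phi_ge0//.
  by rewrite expr2 ler_pM// approx_phi_ge0.
rewrite normrM (ger0_norm (x := (_ `^ _)^-1)) ?invr_ge0 ?powR_ge0//.
rewrite ler_pdivrMr// distrC; apply: le_trans dV _.
by rewrite mulr1.
Qed.

(** Product rule. The variation of phi comes with A^2 A A^3 = A^6, that of the overlap integral with
    A A A^2 = A^4. The radius 5 t is the support radius 4 t plus d(x, y) <= t. *)
Lemma approx_kernel_lip : exists2 C : R, 0 <= C & forall x y z t,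
  0 < t -> mdist x y <= t ->
  `|s x z t - s y z t| <= C * t `^ (- N) * (mdist x y / t) * (mdist x z < 5 * t)%R%:R.
Proof.
have B0 : 0 <= B by rewrite mulr_ge0 ?powR_ge0// ltW.
have A0 : 0 <= A by exact: ltW.
exists (L * B * (A ^+ 6 + A ^+ 4)).
  by rewrite mulr_ge0 ?addr_ge0 ?exprn_ge0// mulr_ge0.
move=> x y z t t0 xyt.
have I0 : 0 < t `^ N by rewrite powR_gt0.
have r0 : 0 <= mdist x y / t by rewrite divr_ge0 ?mdist_ge0// ltW.
case: ltP => xz; last first.
  rewrite !approx_kernel_eq0 ?subrr ?normr0 ?mulr0//; last lra.
  have := metric_triangle x y z; lra.
rewrite mulr1 /approx_kernel -/(overlap x z t) -/(overlap y z t) powR2N powRN.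
have /andP[ov0 ovA] := overlap_bounds x z t0.
have /andP[_ fy] := approx_phi_bounds y t0.
have /andP[_ fz] := approx_phi_bounds z t0.
have dphi := phi_diff t0 xyt.
have mw : measurable_fun setT (fun u => h (mdist z u / t) * approx_psi m N h u t).
  by meas.
have dov := cutoff_diff t0 xyt mw (fun u => weight_bounds z u t0).
rewrite -!overlapE in dov.
have fz0 := approx_phi_ge0 z t.
have fy0 := approx_phi_ge0 y t.
set I := t `^ N in I0 ovA dov *.
set fx := approx_phi m N h x t in dphi *.
set gy := approx_phi m N h y t in dphi fy fy0 *.
set gz := approx_phi m N h z t in fz fz0 *.
have -> : fx * gz / I ^+ 2 * overlap x z t - gy * gz / I ^+ 2 * overlap y z t =
   ((fx - gy) * (gz * overlap x z t) + gy * gz * (overlap x z t - overlap y z t)) / I ^+ 2.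
  by ring.
rewrite normrM (ger0_norm (x := (I ^+ 2)^-1)) ?invr_ge0 ?sqr_ge0//.
rewrite ler_pdivrMr ?exprn_gt0//.
apply: le_trans (ler_normD _ _) _.
have -> : L * B * (A ^+ 6 + A ^+ 4) / I * (mdist x y / t) * I ^+ 2 =
  (A ^+ 2 * (L * (mdist x y / t) * B)) * (A * (A ^+ 3 * I)) +
  A * A * (L * (mdist x y / t) * A ^+ 2 * B * I).
  by field; rewrite !gt_eqF.
apply: lerD; rewrite normrM.
  apply: ler_pM => //; rewrite ger0_norm ?mulr_ge0//.
  exact: ler_pM.
apply: ler_pM => //; rewrite ger0_norm ?mulr_ge0//.
exact: ler_pM.
Qed.

(** The normalisations phi and psi are made for this. Integrating in y first gives t^N / psi(z),
    which cancels psi(z); the remaining integral in z is t^N / phi(x), which cancels phi(x). *)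
Lemma integral_approx_kernel x t : 0 < t -> (\int[m]_y (s x y t)%:E = 1)%E.
Proof.
move=> t0.
have I0 : 0 < t `^ N by rewrite powR_gt0.
have A0 : 0 <= A by exact: ltW.
pose psi := fun z => approx_psi m N h z t.
pose phi := fun z => approx_phi m N h z t.
have psi0 z : 0 <= psi z by exact: approx_psi_ge0.
have phi0 z : 0 <= phi z by exact: approx_phi_ge0.
(* Bridge between the real-valued integrals of the definitions and the extended ones needed by
   Tonelli's theorem: the integrand is bounded with support in a ball, hence integrable. *)
have EV (u : X) (w : X -> R) (M : R) : 0 <= M -> measurable_fun setT w ->
    (forall z, 0 <= w z <= M) ->
    ((\int[m]_z (h (mdist u z / t) * w z))%R%:E = \int[m]_z (h (mdist u z / t) * w z)%:E)%E.
  move=> M0 mw wM; have t20 : 0 < 2 * t by lra.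
  apply: (EFin_Rintegral_supported (x := u) (r := 2 * t) (M := M)) => //.
    by meas.
  move=> y; have /andP[w0 w1] := wM y.
  by rewrite ger0_norm ?mulr_ge0// mulrC ler_pM// h_supp.
have inner z : (\int[m]_y (phi y * h (mdist y z / t))%:E = (t `^ N / psi z)%:E)%E.
  under eq_integral do rewrite mulrC metric_sym.
  rewrite -(EV z phi A)//; last first.
    move=> y; rewrite phi0/=; by have /andP[] := approx_phi_bounds y t0.
    by rewrite /phi; meas.
  congr EFin; rewrite /psi /approx_psi invrK /approx_id powRN mulrA divff ?mul1r//.
  by rewrite gt_eqF.
have h1 y : ((s x y t)%:E = (phi x / t `^ (2 * N))%:E *
   \int[m]_z (phi y * (h (mdist x z / t) * (h (mdist y z / t) * psi z)))%:E)%E.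
  rewrite /approx_kernel -/(overlap x y t) overlapE.
  have -> : approx_phi m N h x t * approx_phi m N h y t / t `^ (2 * N) =
    phi x / t `^ (2 * N) * phi y by rewrite /phi; ring.
  rewrite -mulrA EFinM; congr (_ * _)%E.
  under [RHS]eq_integral do rewrite EFinM.
  rewrite ge0_integralZl//; last 3 first.
  - by rewrite /psi; meas.
  - by move=> z _; rewrite lee_fin !mulr_ge0.
  - by rewrite lee_fin.
  rewrite EFinM; congr (_ * _)%E; apply: (EV _ _ (A ^+ 2)).
  - by rewrite sqr_ge0.
  - by rewrite /psi; meas.
  - by move=> z; exact: weight_bounds.
under eq_integral do rewrite h1.
pose G y z :=
  (phi y * (h (mdist x z / t) * (h (mdist y z / t) * psi z)))%:E.
have mG : measurable_fun setT (fun q : X * X => G q.1 q.2).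
  by rewrite /G /phi /psi; meas.
have G0 y z : (0 <= G y z)%E by rewrite lee_fin !mulr_ge0.
rewrite ge0_integralZl//; last 3 first.
- exact: (@measurable_fun_integral _ _ _ _ _ m G).
- by move=> y _; apply: integral_ge0 => z _; exact: G0.
- by rewrite lee_fin divr_ge0 ?powR_ge0.
rewrite (@tonelli_swap _ _ _ _ _ m m G)//.
have h2 z : (\int[m]_y (phi y * (h (mdist x z / t) * (h (mdist y z / t) * psi z)))%:E =
   (t `^ N)%:E * (h (mdist x z / t) * cst 1 z)%:E)%E.
  have psip : 0 < psi z.
    have /andP[+ _] := approx_psi_bounds z t0; apply: lt_le_trans.
    by rewrite exprn_gt0// invr_gt0.
  rewrite (eq_integral (fun y => ((h (mdist x z / t) * psi z)%:E *
    (phi y * h (mdist y z / t))%:E)%E)); last first.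
    by move=> y _; rewrite /G -EFinM; congr EFin; ring.
  rewrite ge0_integralZl//; last 3 first.
  - by rewrite /phi; meas.
  - by move=> y _; rewrite lee_fin !mulr_ge0.
  - by rewrite lee_fin mulr_ge0.
  rewrite inner -!EFinM /cst mulr1; congr EFin; field.
  by rewrite gt_eqF.
under eq_integral do rewrite h2.
rewrite ge0_integralZl//; last 3 first.
- by meas.
- by move=> y _; rewrite lee_fin !mulr_ge0.
- by rewrite lee_fin ltW.
rewrite -(EV x (cst 1) 1)//; last first.
  by move=> z; rewrite ler01 lexx.
have phip : 0 < phi x.
  have /andP[+ _] := approx_phi_bounds x t0; apply: lt_le_trans.
  by rewrite invr_gt0.
have -> : \int[m]_z (h (mdist x z / t) * cst 1 z) = t `^ N / phi x.
  rewrite /phi /approx_phi invrK /approx_id powRN mulrA divff ?mul1r//.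
  by rewrite gt_eqF.
rewrite -!EFinM powR2N; congr EFin; field.
by rewrite !gt_eqF.
Qed.

End approximation_kernel.

(** * Extension of the cutoff to the real line, and its Lipschitz constant *)

Section cutoff_extension.
Context {R : realType}.
Variable h : R -> R.
Hypothesis h_cutoff : cutoff h.

(* The values of a cutoff on negative numbers are arbitrary. *)
Definition cutoff_ext (u : R) : R := h (Num.max 0 u).

Lemma cutoff_extE u : 0 <= u -> cutoff_ext u = h u.
Proof. by move=> u0; rewrite /cutoff_ext max_r. Qed.

Lemma cutoff_ext_ge0 u : 0 <= cutoff_ext u.
Proof. by have [+ _ _ _ _] := h_cutoff; apply; rewrite le_max lexx. Qed.

Lemma cutoff_ext_ni : nonincreasing_fun cutoff_ext.
Proof.
move=> u v uv; have [_ + _ _ _] := h_cutoff; apply; first by rewrite le_max lexx.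
by rewrite ge_max !le_max lexx uv orbT.
Qed.

Lemma cutoff_ext_one u : u <= 2^-1 -> cutoff_ext u = 1.
Proof.
move=> u2; have [_ _ _ + _] := h_cutoff; apply; first by rewrite le_max lexx.
by rewrite ge_max u2 andbT.
Qed.

Lemma cutoff_ext_zero u : 2 <= u -> cutoff_ext u = 0.
Proof.
by move=> u2; have [_ _ _ _] := h_cutoff; apply; rewrite le_max u2 orbT.
Qed.

Let derivable_h u : 0 < u -> derivable h u 1.
Proof. by move=> u0; have [_ _ /(_ 0%N u u0)] := h_cutoff. Qed.

Let continuous_h u : 0 < u -> {for u, continuous h}.
Proof.
move=> u0; apply: differentiable_continuous; apply/derivable1_diffP.
exact: derivable_h.
Qed.

Let continuous_dh u : 0 < u -> {for u, continuous (derive1 h)}.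
Proof.
move=> u0; have [_ _ /(_ 1%N u u0) + _ _] := h_cutoff => dh.
by apply: differentiable_continuous; apply/derivable1_diffP.
Qed.

Let pos (u v : R) : u \in `[2^-1, v] -> 0 < u.
Proof. by rewrite in_itv/= => /andP[+ _]; apply: lt_le_trans. Qed.

(** The derivative of [h] is continuous on the compact interval [1/2, 2], hence bounded, and the
    mean value theorem applies there. Elsewhere the function is constant. *)
Lemma cutoff_ext_lipschitz :
  exists L, forall u v, `|cutoff_ext u - cutoff_ext v| <= L * `|u - v|.
Proof.
have half2 : 2^-1 <= 2 :> R by lra.
have cn : {within `[2^-1, 2], continuous (fun u => `|derive1 h u : R|)}.
  apply: continuous_in_subspaceT => u /[!inE] /= /pos u0.
  by apply: continuous_comp; [exact: continuous_dh|exact: norm_continuous].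
have [w _ wmax] := EVT_max half2 cn.
pose L := `|derive1 h w|; exists L.
have lip u v : 2^-1 <= u -> u <= v -> v <= 2 -> `|h u - h v| <= L * `|u - v|.
  move=> u2 uv v2; rewrite distrC (distrC u).
  have inI x : x \in `[u, v] -> x \in `[2^-1, 2].
    by rewrite !in_itv/= => /andP[ux xv]; rewrite (le_trans u2 ux) (le_trans xv v2).
  have inI' x : x \in `]u, v[ -> x \in `[u, v].
    by rewrite !in_itv/= => /andP[/ltW-> /ltW->].
  have [] := @MVT_segment R h (derive1 h) u v uv.
  - move=> x /inI'/inI/pos x0; apply: DeriveDef; first exact: derivable_h.
    by rewrite derive1E.
  - by apply: continuous_in_subspaceT => x /[!inE] /= /inI/pos; exact: continuous_h.
  move=> x /inI x2 ->; rewrite normrM ler_wpM2r//.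
  exact: wmax.
(* Projection onto [1/2, 2]. It is 1-Lipschitz and does not change the value of the extended cutoff,
   so the bound on [1/2, 2] passes to all u and v at once. *)
pose clamp u : R := Num.max 2^-1 (Num.min 2 u).
have clampE u : cutoff_ext u = h (clamp u).
  have half0 : 0 <= 2^-1 :> R by rewrite invr_ge0.
  have [_ _ _ hone hzero] := h_cutoff.
  rewrite /clamp; have [u2|/ltW u2] := leP u 2^-1.
    rewrite cutoff_ext_one//; apply/esym/hone; first by rewrite le_max half0.
    by rewrite ge_max lexx ge_min u2 orbT.
  rewrite max_r; last by rewrite le_min half2 u2.
  have [u2'|/ltW u2'] := leP 2 u; first by rewrite cutoff_ext_zero// hzero.
  by rewrite cutoff_extE//; exact: le_trans half0 u2.
have clamp2 u : 2^-1 <= clamp u <= 2.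
  by rewrite /clamp le_max lexx/= ge_max half2 ge_min lexx.
have clip u v : u <= v -> clamp u <= clamp v /\ clamp v - clamp u <= v - u.
  have cmax (a x y : R) : x <= y ->
      Num.max a x <= Num.max a y /\ Num.max a y - Num.max a x <= y - x.
    by move=> xy; case: (leP a x) => ax; case: (leP a y) => ay; split; lra.
  have cmin (a x y : R) : x <= y ->
      Num.min a x <= Num.min a y /\ Num.min a y - Num.min a x <= y - x.
    by move=> xy; case: (leP a x) => ax; case: (leP a y) => ay; split; lra.
  move=> /(cmin 2)[/(cmax 2^-1)[h1 h2] h3]; split => //.
  exact: le_trans h3.
suff main u v : u <= v -> `|cutoff_ext u - cutoff_ext v| <= L * `|u - v|.
  move=> u v; have [/main//|/ltW /main] := leP u v.
  by rewrite distrC (distrC v).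
move=> uv; have [c1 c2] := clip _ _ uv.
have /andP[u2 _] := clamp2 u; have /andP[_ v2] := clamp2 v.
rewrite !clampE; apply: le_trans (lip _ _ u2 c1 v2) _.
apply: ler_wpM2l; first exact: normr_ge0.
by rewrite distrC (distrC u) !ger0_norm ?subr_ge0.
Qed.

End cutoff_extension.

Section cutoff_ext_kernel.
Context {d : measure_display} {R : realType} {X : borelMetricType d R}.
Variables (m : {measure set X -> \bar R}) (N : R) (h : R -> R).
Implicit Types (f g : X -> R) (x y : X) (t : R).

Let hE x y t : 0 < t -> cutoff_ext h (mdist x y / t) = h (mdist x y / t).
Proof. by move=> t0; rewrite cutoff_extE// divr_ge0 ?mdist_ge0// ltW. Qed.

Lemma approx_id_ext t f : 0 < t ->
  approx_id m N (cutoff_ext h) t f = approx_id m N h t f.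
Proof.
move=> t0; apply/funext => x; rewrite /approx_id; congr (_ * _).
by apply: eq_Rintegral => y _; rewrite hE.
Qed.

Lemma approx_phi_ext x t : 0 < t ->
  approx_phi m N (cutoff_ext h) x t = approx_phi m N h x t.
Proof. by move=> t0; rewrite /approx_phi approx_id_ext. Qed.

Lemma approx_psi_ext x t : 0 < t ->
  approx_psi m N (cutoff_ext h) x t = approx_psi m N h x t.
Proof.
move=> t0; rewrite /approx_psi (approx_id_ext _ t0).
suff -> : (fun y => approx_phi m N (cutoff_ext h) y t) =
    (fun y => approx_phi m N h y t) by [].
by apply/funext => y; exact: approx_phi_ext.
Qed.

Lemma approx_kernel_ext x y t : 0 < t ->
  approx_kernel m N (cutoff_ext h) x y t = approx_kernel m N h x y t.
Proof.
move=> t0.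
apply: (f_equal2 *%R
  (f_equal2 (fun u v => u * v / t `^ (2 * N))
    (approx_phi_ext x t0) (approx_phi_ext y t0))).
by apply: eq_Rintegral => z _; rewrite !(hE _ _ t0) (approx_psi_ext _ t0).
Qed.

(** Only t > 0 occurs in the integral, so the cutoff is evaluated only at the non-negative ratios d
    / t, where it agrees with its extension. *)
Lemma bessel_kernel_ext a :
  bessel_kernel m N (cutoff_ext h) a = bessel_kernel m N h a.
Proof.
apply/funext => x; apply/funext => y; apply: (f_equal (fun u => a%:E * u)%E).
apply: eq_integral => t; rewrite inE/= in_itv/= andbT => t0.
apply: (f_equal (fun u => (t `^ a / (1 + t `^ a) ^+ 2 * u / t)%:E)).
exact: approx_kernel_ext.
Qed.

End cutoff_ext_kernel.

(** * Power integrals of the distance *)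

Ltac meas_integral :=
  match goal with
  | |- measurable_fun _ (fun q => integral _ _ (fun y => @?F q y)) =>
    first [apply: measurable_fun_integral_lebesgue | apply: measurable_fun_integral]
  end.
Ltac meas_hook ::= meas_integral.
Ltac nneg_hook := fail.
Ltac nneg := do ?[ assumption | move=> ? | apply: integral_ge0 | rewrite lee_fin | apply: mulr_ge0
  | apply: mule_ge0 | apply: addr_ge0 | apply: adde_ge0 | nneg_hook
  | match goal with [ H : forall _, is_true (0 <= _)%R |- _ ] => exact: H end
  | exact: powR_ge0 | exact: normr_ge0 | exact: ler0n | exact: mdist_ge0 ].

Ltac side := try solve [ exact: ltW | nneg | meas; nneg | rewrite lee_fin; exact: ltW ].

Lemma powRDpos {R : realType} (u a b : R) : 0 < u -> u `^ a * u `^ b = u `^ (a + b).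
Proof. by move=> u0; rewrite powRD//; apply/implyP => _; rewrite gt_eqF. Qed.

Section indicator_power_integrals.
Context {R : realType}.
Notation mu := (@lebesgue_measure R).
Implicit Types a e : R.

(** The domain is turned into a 0-1 factor so that integrals whose range in t depends on d(x, y)
    become integrals over a full product, ready for Tonelli's theorem. *)
Lemma integral_indicator_tail a e : 0 < a -> 0 < e ->
  (\int[mu]_t ((a < t)%R%:R * t `^ (- e - 1))%:E = (a `^ (- e) / e)%:E)%E.
Proof.
move=> a0 e0; rewrite -integral_powR_pinfty// [RHS]integral_mkcond.
apply: eq_integral => t _; rewrite patchE mem_setE in_itv/= andbT.
by case: ifP => _; rewrite ?mul1r ?mul0r.
Qed.

Lemma integral_indicator_head a e : 0 < a -> 0 < e ->
  (\int[mu]_t ((0 < t)%R%:R * (t <= a)%R%:R * t `^ (e - 1))%:E <= (a `^ e / e)%:E)%E.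
Proof.
move=> a0 e0; apply: le_trans (integral_powR_0 a0 e0).
rewrite [leRHS]integral_mkcond le_eqVlt; apply/orP; left; apply/eqP.
apply: eq_integral => t _; rewrite patchE mem_setE in_itv/=.
by case: (0 < t); case: (t <= a); rewrite ?mulr1 ?mul1r ?mul0r ?mulr0 ?mul0r.
Qed.

End indicator_power_integrals.

Section ahlfors_integrals.
Context {d : measure_display} {R : realType} {X : borelMetricType d R}.
Variables (m : {sigma_finite_measure set X -> \bar R}) (N c : R).
Hypothesis m_regular : ahlfors_regular m N.
Hypothesis c_gt0 : 0 < c.
Hypothesis N_gt0 : 0 < N.
Hypothesis m_ball : forall (x : X) (r : R), 0 < r ->
  ((c^-1 * r `^ N)%:E <= m (ball x r) <= (c * r `^ N)%:E)%E.
Notation mu := (@lebesgue_measure R).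

Let ball_le (x : X) r : 0 < r ->
  (\int[m]_y (mdist x y < r)%R%:R%:E <= (c * r `^ N)%:E)%E.
Proof.
move=> r0; rewrite -[c]mul1r; apply: (integral_le_ball m_regular m_ball (x := x)) => // y.
by rewrite mul1r.
Qed.

(* In the next two lemmas a power of the distance is written as the tail of a
   power integral; exchanging the integrals leaves the measure of balls. *)
Lemma integral_mdist_tail (x : X) t q : 0 < t -> 0 < q ->
  (\int[m]_y ((t < mdist x y)%R%:R * mdist x y `^ (- N - q))%:E <=
   ((N + q) * c / q * t `^ (- q))%:E)%E.
Proof.
move=> t0 q0; have Nq0 : 0 < N + q by rewrite addr_gt0.
pose G y u := ((t < mdist x y)%R%:R * ((mdist x y < u)%R%:R * u `^ (- (N + q) - 1)))%:E.
have mG : measurable_fun setT (fun w : X * R => G w.1 w.2) by rewrite /G; meas.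
have G0 y u : (0 <= G y u)%E by rewrite /G; nneg.
apply: (@le_trans _ _ ((N + q)%:E * \int[m]_y \int[mu]_u G y u)%E).
  apply: ge0_integralZl_le => //; side.
  move=> y _; rewrite /G; have [ty|ty] := ltP t (mdist x y); last first.
    by rewrite mul0r mule_ge0 ?lee_fin ?(ltW Nq0)//; nneg.
  under eq_integral do rewrite mul1r.
  rewrite mul1r integral_indicator_tail//; last exact: lt_trans ty.
  by rewrite -EFinM lee_fin mulrCA divff ?gt_eqF// mulr1 opprD.
rewrite (tonelli_lebesgue m mG)// -mulrA -mulrA EFinM lee_wpmul2l ?lee_fin ?(ltW Nq0)//.
apply: (@le_trans _ _ (c%:E * \int[mu]_u ((t < u)%R%:R * u `^ (- q - 1))%:E)%E).
  apply: ge0_integralZl_le => //; side.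
  move=> u _; have [tu|tu] := ltP t u; last first.
    rewrite mul0r mule0 integral0_eq// => y _; rewrite /G.
    have [ty|] := ltP t (mdist x y); last by rewrite mul0r.
    by rewrite ltNge (le_trans tu (ltW ty))/= mul0r mulr0.
  have u0 : 0 < u by exact: lt_trans tu.
  apply: (@le_trans _ _ ((u `^ (- (N + q) - 1))%:E * \int[m]_y (mdist x y < u)%R%:R%:E)%E).
    apply: ge0_integralZl_le => //; side.
    move=> y _; rewrite -EFinM lee_fin (mulrC (u `^ _)).
    by rewrite ler_piMl ?mulr_ge0 ?powR_ge0// lern1 leq_b1.
  apply: (@le_trans _ _ ((u `^ (- (N + q) - 1))%:E * (c * u `^ N)%:E)%E).
    by rewrite lee_wpmul2l ?lee_fin ?powR_ge0// ball_le.
  rewrite -!EFinM lee_fin mul1r mulrCA powRDpos//.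
  by rewrite (_ : - (N + q) - 1 + N = - q - 1)//; ring.
by rewrite integral_indicator_tail// -EFinM (mulrC (t `^ _)) mulrA.
Qed.

Lemma integral_mdist_head (x : X) t q : 0 < t -> 0 < q ->
  (\int[m]_y ((0 < mdist x y)%R%:R * (mdist x y <= t)%R%:R * mdist x y `^ (- N + q))%:E <=
   ((N * c / q + c * 2 `^ N) * t `^ q)%:E)%E.
Proof.
move=> t0 q0.
(* Only d^(- N) is expanded as an integral over u > d, since the exponent - N + q may have either
   sign. The range u <= t, with d^q <= u^q, yields N c / q; the range u > t, with d^q <= t^q, yields
   c 2^N. *)
pose G y u := ((0 < mdist x y)%R%:R * (mdist x y <= t)%R%:R * mdist x y `^ q *
  ((mdist x y < u)%R%:R * u `^ (- N - 1)))%:E.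
have mG : measurable_fun setT (fun w : X * R => G w.1 w.2) by rewrite /G; meas.
have G0 y u : (0 <= G y u)%E by rewrite /G; nneg.
apply: (@le_trans _ _ (N%:E * \int[m]_y \int[mu]_u G y u)%E).
  apply: ge0_integralZl_le => //; side.
  move=> y _; rewrite /G; have [y0|y0] := ltP 0 (mdist x y); last first.
    by rewrite !mul0r mule_ge0 ?lee_fin ?(ltW N_gt0)//; nneg.
  under eq_integral do rewrite EFinM.
  rewrite ge0_integralZl//; side.
  rewrite integral_indicator_tail// -!EFinM lee_fin mul1r.
  rewrite -powRDpos// le_eqVlt; apply/orP; left; apply/eqP; field.
  by rewrite gt_eqF.
rewrite (tonelli_lebesgue m mG)//.
pose H1 u := ((0 < u)%R%:R * (u <= t)%R%:R * u `^ (q - 1))%:E.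
pose H2 u := ((t < u)%R%:R * u `^ (- N - 1))%:E.
have mH1 : measurable_fun setT H1 by rewrite /H1; meas.
have mH2 : measurable_fun setT H2 by rewrite /H2; meas.
have H10 u : (0 <= H1 u)%E by rewrite /H1; nneg.
have H20 u : (0 <= H2 u)%E by rewrite /H2; nneg.
have k0 : 0 <= c * (2 * t) `^ N * t `^ q by rewrite !mulr_ge0 ?powR_ge0// ltW.
apply: (@le_trans _ _ (N%:E * (c%:E * \int[mu]_u H1 u +
    (c * (2 * t) `^ N * t `^ q)%:E * \int[mu]_u H2 u))%E).
  rewrite lee_wpmul2l ?lee_fin ?(ltW N_gt0)//.
  rewrite -!ge0_integralZl//; [|by rewrite lee_fin ltW].
  rewrite -ge0_integralD//; last 4 first.
  - by move=> u _; rewrite mule_ge0// lee_fin ltW.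
  - by apply: measurable_funeM.
  - by move=> u _; rewrite mule_ge0.
  - by apply: measurable_funeM.
  apply: le_integral_ge0 => u _; first by nneg; exact: G0.
  have [u0|u0] := leP u 0.
    rewrite integral0_eq; last first.
      by move=> y _; rewrite /G (ltNge (mdist x y) u) (le_trans u0 (mdist_ge0 _ _))/= mul0r mulr0.
    by apply: adde_ge0; apply: mule_ge0 => //; rewrite lee_fin ltW.
  have [ut|tu] := leP u t.
    have -> : H2 u = 0%E by rewrite /H2 ltNge ut mul0r.
    rewrite mule0 adde0.
    apply: (@le_trans _ _ ((u `^ q * u `^ (- N - 1))%:E * \int[m]_y (mdist x y < u)%R%:R%:E)%E).
      apply: ge0_integralZl_le => //; side.
      move=> y _; rewrite -EFinM lee_fin.
      have [yu|yu] := ltP (mdist x y) u; last by rewrite mul0r !mulr0.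
      rewrite mul1r mulr1 ler_wpM2r ?powR_ge0//.
      apply: (@le_trans _ _ (mdist x y `^ q)).
        by rewrite ler_piMl ?powR_ge0// -natrM lern1; case: (0 < _); case: (_ <= _).
      by apply: ge0_ler_powR; rewrite ?nnegrE ?mdist_ge0 ?(ltW q0) ?(ltW t0) ?(ltW u0) ?(ltW yu).
    apply: (@le_trans _ _ ((u `^ q * u `^ (- N - 1))%:E * (c * u `^ N)%:E)%E).
      by rewrite lee_wpmul2l ?lee_fin ?mulr_ge0 ?powR_ge0// ball_le.
    rewrite -!EFinM lee_fin u0 ut !mul1r mulrCA !powRDpos//.
    by rewrite (_ : q + (- N - 1) + N = q - 1)//; ring.
  have -> : H1 u = 0%E by rewrite /H1 (leNgt u t) tu mulr0 mul0r.
  rewrite mule0 add0e /H2 tu mul1r.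
  (* The regularity bounds concern open balls: radius 2 t makes room for d <= t. *)
  have t20 : 0 < 2 * t by lra.
  apply: (@le_trans _ _ ((t `^ q * u `^ (- N - 1))%:E * \int[m]_y (mdist x y < 2 * t)%R%:R%:E)%E).
    apply: ge0_integralZl_le => //; side.
    move=> y _; rewrite -EFinM lee_fin.
    have [yt|yt] := leP (mdist x y) t; last first.
      by rewrite mulr0 !mul0r mulr_ge0 ?mulr_ge0 ?powR_ge0.
    rewrite (_ : mdist x y < 2 * t); last lra.
    rewrite !mulr1; apply: ler_pM => //; first by rewrite mulr_ge0 ?powR_ge0.
    - by rewrite mulr_ge0 ?powR_ge0.
    - rewrite -[leRHS]mul1r ler_pM ?powR_ge0 ?lern1 ?leq_b1//.
      by apply: ge0_ler_powR; rewrite ?nnegrE ?mdist_ge0 ?(ltW q0) ?(ltW t0) ?(ltW u0) ?(ltW yu).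
    - by rewrite ler_piMl ?powR_ge0// lern1 leq_b1.
  apply: (@le_trans _ _ ((t `^ q * u `^ (- N - 1))%:E * (c * (2 * t) `^ N)%:E)%E).
    by rewrite lee_wpmul2l ?lee_fin ?mulr_ge0 ?powR_ge0// ball_le.
  by rewrite -!EFinM lee_fin le_eqVlt; apply/orP; left; apply/eqP; ring.
rewrite integral_indicator_tail//.
apply: (@le_trans _ _ (N%:E * (c%:E * (t `^ q / q)%:E +
   (c * (2 * t) `^ N * t `^ q)%:E * (t `^ (- N) / N)%:E))%E).
  rewrite lee_wpmul2l ?lee_fin ?(ltW N_gt0)// leeD2r// lee_wpmul2l ?lee_fin ?(ltW c_gt0)//.
  exact: integral_indicator_head.
rewrite -!EFinM lee_fin le_eqVlt; apply/orP; left; apply/eqP.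
rewrite powRM ?ltW// powRN; field.
by rewrite !gt_eqF ?powR_gt0.
Qed.

End ahlfors_integrals.

(** * Weighted averages *)

Section jensen_iterated.
Context {d1 d2 : measure_display} {T1 : measurableType d1} {T2 : measurableType d2}.
Context {R : realType}.
Variables (m1 : {sigma_finite_measure set T1 -> \bar R}).
Variables (m2 : {sigma_finite_measure set T2 -> \bar R}).

Lemma jensen_powR_iterated (p M : R) (w u : T1 -> T2 -> R) : 1 <= p -> 0 < M ->
  measurable_fun setT (fun q : T1 * T2 => w q.1 q.2) ->
  measurable_fun setT (fun q : T1 * T2 => u q.1 q.2) ->
  (forall x y, 0 <= w x y) -> (forall x y, 0 <= u x y) ->
  (\int[m1]_x \int[m2]_y (w x y)%:E <= M%:E)%E ->
  ((\int[m1]_x \int[m2]_y (w x y * u x y)%:E) `^ p <=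
    (M `^ (p - 1))%:E * \int[m1]_x \int[m2]_y (w x y * u x y `^ p)%:E)%E.
Proof.
move=> p1 M0 mw mu w0 u0.
have E (f : T1 -> T2 -> R) : measurable_fun setT (fun q : T1 * T2 => f q.1 q.2) ->
    (forall x y, 0 <= f x y) ->
    (\int[m1]_x \int[m2]_y (f x y)%:E = \int[m1 \x m2]_q (f q.1 q.2)%:E)%E.
  move=> mf f0; rewrite fubini_tonelli1//.
    exact/measurable_EFinP.
  by move=> q; rewrite lee_fin.
have Ewu : (\int[m1]_x \int[m2]_y (w x y * u x y)%:E =
    \int[m1 \x m2]_q (w q.1 q.2 * u q.1 q.2)%:E)%E.
  by apply: (E (fun x y => w x y * u x y)) => [|x y]; [meas|rewrite mulr_ge0].
have Ewup : (\int[m1]_x \int[m2]_y (w x y * u x y `^ p)%:E =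
    \int[m1 \x m2]_q (w q.1 q.2 * u q.1 q.2 `^ p)%:E)%E.
  apply: (E (fun x y => w x y * u x y `^ p)) => [|x y]; first by meas.
  by rewrite mulr_ge0 ?powR_ge0.
rewrite Ewu Ewup E// => wM.
exact: jensen_powR.
Qed.

End jensen_iterated.

Section jensen_lebesgue.
Context {d : measure_display} {T : measurableType d} {R : realType}.
Variables (m : {sigma_finite_measure set T -> \bar R}).
Notation mu := (@lebesgue_measure R).

Lemma jensen_powR_lebesgue (p M : R) (w u : T -> R -> R) : 1 <= p -> 0 < M ->
  measurable_fun setT (fun q : T * R => w q.1 q.2) ->
  measurable_fun setT (fun q : T * R => u q.1 q.2) ->
  (forall x t, 0 <= w x t) -> (forall x t, 0 <= u x t) ->
  (\int[m]_x \int[mu]_t (w x t)%:E <= M%:E)%E ->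
  ((\int[m]_x \int[mu]_t (w x t * u x t)%:E) `^ p <=
    (M `^ (p - 1))%:E * \int[m]_x \int[mu]_t (w x t * u x t `^ p)%:E)%E.
Proof. exact: (@jensen_powR_iterated _ _ _ _ _ m mu). Qed.

End jensen_lebesgue.

(** The p-th power of the Gagliardo seminorm of order [a], with d^N in place of the measure of the
    ball. For p > 0 the diagonal contributes 0, because the numerator vanishes there. *)
Definition gagliardo {d : measure_display} {R : realType} {X : borelMetricType d R}
    (m : {measure set X -> \bar R}) (N a p : R) (f : X -> R) : \bar R :=
  (\int[m]_x \int[m]_y (`|f x - f y| `^ p / mdist x y `^ (N + a * p))%:E)%E.

Section weighted_averages.
Context {d : measure_display} {R : realType} {X : borelMetricType d R}.
Variables (m : {sigma_finite_measure set X -> \bar R}) (N p b : R).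
Hypothesis m_regular : ahlfors_regular m N.
Hypothesis N_gt0 : 0 < N.
Hypothesis p_ge1 : 1 <= p.
Hypothesis b_gt0 : 0 < b.
Variable g : X -> R.
Hypothesis mg : measurable_fun setT g.
Notation mu := (@lebesgue_measure R).

Let E := N + b * p.
Let p_gt0 : 0 < p. Proof. exact: lt_le_trans p_ge1. Qed.
Let E_gt0 : 0 < E. Proof. by rewrite addr_gt0// mulr_gt0. Qed.

Variables (w : R -> R -> R) (C : R).
Hypothesis C_ge0 : 0 <= C.
Hypothesis mw : measurable_fun setT (fun q : R * R => w q.1 q.2).
Hypothesis w_ge0 : forall r t, 0 <= w r t.
Hypothesis int_w : forall (x : X) t, 0 < t ->
  (\int[m]_y (w (mdist x y) t)%:E <= (C * t `^ (- E - 1))%:E)%E.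

Let measurable_w {d' : measure_display} {T : measurableType d'} (u v : T -> R) :
  measurable_fun setT u -> measurable_fun setT v ->
  measurable_fun setT (fun q => w (u q) (v q)).
Proof.
move=> mu mv; apply: (measurable_fun_compT (u := fun q => (u q, v q)) mw).
exact: measurable_fun_pair.
Qed.

Ltac meas_hook ::= first [meas_integral | apply: measurable_w].

Let U x z := `|g x - g z| `^ p.

(** By [int_w] the integral in y leaves t^(- E - 1) on t > d(x, z) / 5. Its integral in t is (d(x,
    z) / 5)^(- E) / E, whence the factor 5^E / E. *)
Let average_at (x z : X) :
  (\int[mu]_t \int[m]_y (w (mdist x y) t * ((mdist x z < 5 * t)%R%:R * U x z))%:E <=
    (C * 5 `^ E / E)%:E * (U x z / mdist x z `^ E)%:E)%E.
Proof.
have [xz|xz] := eqVneq x z.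
  have U0 : U x z = 0 by rewrite /U xz subrr normr0 powR0// gt_eqF.
  rewrite integral0_eq ?U0 ?mul0r ?mule0// => t _.
  by rewrite integral0_eq// => y _; rewrite !mulr0.
have d0 : 0 < mdist x z by rewrite mdist_gt0.
have d50 : 0 < mdist x z / 5 by rewrite divr_gt0.
apply: (@le_trans _ _ ((C * U x z)%:E *
    \int[mu]_t ((mdist x z / 5 < t)%R%:R * t `^ (- E - 1))%:E)%E).
  apply: ge0_integralZl_le => //.
  - by meas.
  - by rewrite mulr_ge0// powR_ge0.
  - by move=> t _; apply: integral_ge0 => y _; rewrite lee_fin !mulr_ge0 ?powR_ge0.
  - by move=> t _; rewrite lee_fin mulr_ge0 ?powR_ge0.
  move=> t _; rewrite ltr_pdivrMr// (mulrC t).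
  have [xzt|xzt] := ltP (mdist x z) (5 * t); last first.
    by rewrite !mul0r mule0 integral0_eq// => y _; rewrite mulr0.
  have t0 : 0 < t by lra.
  rewrite !mul1r; under eq_integral do rewrite mulrC.
  apply: (@le_trans _ _ ((U x z)%:E * \int[m]_y (w (mdist x y) t)%:E)%E).
    apply: ge0_integralZl_le => //.
    - by meas.
    - exact: powR_ge0.
    - by move=> y _; rewrite lee_fin mulr_ge0// powR_ge0.
    - by move=> y _; rewrite lee_fin.
  apply: le_trans (lee_wpmul2l _ (int_w x t0)) _; first by rewrite lee_fin powR_ge0.
  by rewrite -!EFinM lee_fin mulrCA mulrA.
rewrite integral_indicator_tail// -!EFinM lee_fin.
rewrite powRM ?mdist_ge0 ?invr_ge0//.
have -> : 5^-1 `^ (- E) = 5 `^ E :> R.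
  by rewrite -[in LHS]powR_inv1// -powRrM mulN1r opprK.
by rewrite powRN le_eqVlt; apply/orP; left; apply/eqP; ring.
Qed.

(** Common form of the two ranges of t: only the mass of the weight in y, at fixed t, matters. It is
    applied to [W1] and [W2] below. *)
Lemma weighted_average_le :
  (\int[m]_x \int[m]_y \int[m]_z \int[mu]_t
      (w (mdist x y) t * ((mdist x z < 5 * t)%R%:R * `|g x - g z| `^ p))%:E <=
    (C * 5 `^ E / E)%:E * gagliardo m N b p g)%E.
Proof.
have K0 : 0 <= C * 5 `^ E / E by rewrite divr_ge0 ?mulr_ge0 ?powR_ge0// ltW.
pose F x y z t := (w (mdist x y) t * ((mdist x z < 5 * t)%R%:R * U x z))%:E.
have F0 x y z t : (0 <= F x y z t)%E by rewrite lee_fin !mulr_ge0 ?powR_ge0.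
pose G x z := (U x z / mdist x z `^ E)%:E.
have G0 x z : (0 <= G x z)%E by rewrite lee_fin divr_ge0 ?powR_ge0.
have mG : measurable_fun setT (fun q : X * X => G q.1 q.2) by rewrite /G /U; meas.
rewrite /gagliardo; apply: ge0_integralZl_le => //.
- by apply: (measurable_fun_integral G).
- by move=> x _; do 3 apply: integral_ge0 => ? _; exact: F0.
- by move=> x _; apply: integral_ge0 => y _; exact: G0.
move=> x _.
have -> : (\int[m]_y \int[m]_z \int[mu]_t F x y z t =
    \int[m]_z \int[mu]_t \int[m]_y F x y z t)%E.
  rewrite (tonelli_swap (fun y z => \int[mu]_t F x y z t)%E); last 2 first.
  - by rewrite /F /U; meas; move=> *; exact: F0.
  - by move=> y z; apply: integral_ge0 => t _; exact: F0.
  apply: eq_integral => z _.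
  apply: (tonelli_lebesgue m (F := fun y t => F x y z t)) => //.
  by rewrite /F /U; meas.
apply: ge0_integralZl_le => //.
- by rewrite /U; meas.
- by move=> z _; do 2 apply: integral_ge0 => ? _; exact: F0.
- by move=> z _; exact: G0.
by move=> z _; exact: average_at.
Qed.

End weighted_averages.

(** * Integral operators with a superposed kernel *)

Lemma measurable_fun_integral_signed {d1 d2 : measure_display}
    {T1 : measurableType d1} {T2 : measurableType d2} {R : realType}
    (m2 : {sigma_finite_measure set T2 -> \bar R}) (F : T1 -> T2 -> \bar R) :
  measurable_fun setT (fun q : T1 * T2 => F q.1 q.2) ->
  measurable_fun setT (fun x => \int[m2]_y F x y)%E.
Proof.
move=> mF; under eq_fun do rewrite integralE.
apply: emeasurable_funB.
- apply: (measurable_fun_integral (fun x => (F x)^\+%E)) => [|x y].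
    rewrite (_ : (fun q => _) = (fun q : T1 * T2 => F q.1 q.2)^\+%E).
      exact: measurable_funepos.
    by apply/funext => q; rewrite !funeposE.
  exact: funepos_ge0.
- apply: (measurable_fun_integral (fun x => (F x)^\-%E)) => [|x y].
    rewrite (_ : (fun q => _) = (fun q : T1 * T2 => F q.1 q.2)^\-%E).
      exact: measurable_funeneg.
    by apply/funext => q; rewrite !funenegE.
  exact: funeneg_ge0.
Qed.

Lemma ae_lty_integral {d : measure_display} {T : measurableType d} {R : realType}
    (m : {measure set T -> \bar R}) (F : T -> \bar R) :
  measurable_fun setT F -> (forall x, (0 <= F x)%E) ->
  (\int[m]_x F x < +oo)%E -> {ae m, forall x, (F x < +oo)%E}.
Proof.
move=> mF F0 Foo; have iF : m.-integrable setT F.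
  apply/integrableP; split => //.
  by under eq_integral do rewrite gee0_abs//.
have := integrable_ae measurableT iF.
by apply: filterS => x /(_ Logic.I); rewrite ge0_fin_numE.
Qed.

Section kernel_operator.
Context {d : measure_display} {R : realType} {X : borelMetricType d R}.
Variables (m : {sigma_finite_measure set X -> \bar R}).
Notation mu := (@lebesgue_measure R).
Variables (kappa : R -> R) (s : X -> X -> R -> R).
Hypothesis kappa_ge0 : forall t, 0 <= kappa t.
Hypothesis kappa_le0 : forall t, t <= 0 -> kappa t = 0.
Hypothesis mkappa : measurable_fun setT kappa.
Hypothesis int_kappa : (\int[mu]_t (kappa t)%:E <= 2%:E)%E.
Hypothesis s_ge0 : forall x y t, 0 <= s x y t.
Hypothesis s_sym : forall x y t, s x y t = s y x t.
Hypothesis ms : measurable_fun setT (fun q : X * X * R => s q.1.1 q.1.2 q.2).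
Hypothesis int_s : forall x t, 0 < t -> (\int[m]_y (s x y t)%:E = 1)%E.

Let measurable_s {d' : measure_display} {T : measurableType d'} (u v : T -> X)
    (w : T -> R) :
  measurable_fun setT u -> measurable_fun setT v -> measurable_fun setT w ->
  measurable_fun setT (fun q => s (u q) (v q) (w q)).
Proof.
move=> mu' mv mw.
apply: (measurable_fun_compT (u := fun q => ((u q, v q), w q)) ms).
by apply: measurable_fun_pair => //; exact: measurable_fun_pair.
Qed.

Definition kernel_int x y : \bar R := (\int[mu]_t (kappa t * s x y t)%:E)%E.
Local Notation k := kernel_int.

Lemma kernel_int_ge0 x y : (0 <= k x y)%E.
Proof. by apply: integral_ge0 => t _; rewrite lee_fin mulr_ge0. Qed.

Lemma kernel_int_sym x y : k x y = k y x.
Proof. by apply: eq_integral => t _; rewrite s_sym. Qed.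

Lemma measurable_kernel_int {d' : measure_display} {T : measurableType d'}
    (u v : T -> X) : measurable_fun setT u -> measurable_fun setT v ->
  measurable_fun setT (fun q => k (u q) (v q)).
Proof.
move=> mu' mv.
apply: (measurable_fun_integral_lebesgue
  (F := fun q t => (kappa t * s (u q) (v q) t)%:E)) => [|q t].
  apply: measurable_fun_EFin; apply: measurable_funM.
    exact: measurable_fun_compT.
  by apply: measurable_s; meas.
by rewrite lee_fin mulr_ge0.
Qed.

Ltac nneg_hook ::= first [exact: kernel_int_ge0 | exact: s_ge0 | exact: kappa_ge0].
Ltac meas_hook ::= first
  [ meas_integral
  | match goal with
    | |- measurable_fun _ (fun q => s (@?u q) (@?v q) (@?w q)) => apply: measurable_s
    | |- measurable_fun _ (fun q => kernel_int (@?u q) (@?v q)) =>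
      apply: measurable_kernel_int
    | |- measurable_fun _ (s ?x ?y) =>
      apply: (measurable_s (u := fun=> x) (v := fun=> y) (w := fun t => t))
    | |- measurable_fun _ (kernel_int ?x) =>
      apply: (measurable_kernel_int (u := fun=> x) (v := fun z => z))
    end ].

Lemma integral_kernel_int x :
  (\int[m]_y k x y = \int[mu]_t (kappa t)%:E)%E.
Proof.
rewrite /kernel_int (@tonelli_lebesgue _ _ _ m (fun y t => (kappa t * s x y t)%:E)).
- apply: eq_integral => t _; have [t0|t0] := leP t 0.
    by rewrite kappa_le0// integral0_eq// => y _; rewrite mul0r.
  under eq_integral do rewrite EFinM.
  rewrite ge0_integralZl//; side.
  by rewrite int_s// mule1.
- by meas.
- by move=> y t; rewrite lee_fin mulr_ge0.
Qed.

Lemma integrable_kernel_int x : m.-integrable setT (k x).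
Proof.
apply/integrableP; split.
  by meas.
under eq_integral do rewrite gee0_abs ?kernel_int_ge0//.
by rewrite integral_kernel_int (le_lt_trans int_kappa)// ltry.
Qed.

Definition kernel_convergent (g : X -> R) x : Prop :=
  m.-integrable setT (fun z => (g z)%:E * k x z)%E.

Definition kernel_op (g : X -> R) x : R :=
  fine (\int[m]_z ((g z)%:E * k x z))%E.
Local Notation J := kernel_op.

Lemma measurable_kernel_op (g : X -> R) :
  measurable_fun setT g -> measurable_fun setT (J g).
Proof.
move=> mg; apply: (measurable_fun_compT (g := fine)) => //.
apply: (measurable_fun_integral_signed m (F := fun x z => (g z)%:E * k x z)%E).
by meas.
Qed.

Lemma integral_kernel_op_abs (u : X -> R) :
  measurable_fun setT u -> (forall z, 0 <= u z) ->
  (\int[m]_x \int[m]_z ((u z)%:E * k x z) =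
   (\int[mu]_t (kappa t)%:E) * \int[m]_z (u z)%:E)%E.
Proof.
move=> mu' u0; rewrite (tonelli_swap (fun x z => (u z)%:E * k x z)%E); last 2 first.
- by meas.
- by move=> x z; rewrite mule_ge0 ?lee_fin ?kernel_int_ge0.
rewrite -ge0_integralZl//; side.
apply: eq_integral => z _; rewrite ge0_integralZl//; side.
under eq_integral do rewrite kernel_int_sym.
by rewrite integral_kernel_int muleC.
Qed.

(** From |g| <= 1 + |g|^p. The kernel has finite mass in z, and by symmetry and Tonelli's theorem
    the kernel integral of |g|^p is an integrable function of x, hence finite almost everywhere. *)
Lemma kernel_convergent_ae (p : R) (g : X -> R) : 1 <= p ->
  measurable_fun setT g -> (\int[m]_z (`|g z| `^ p)%:E < +oo)%E ->
  {ae m, forall x, kernel_convergent g x}.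
Proof.
move=> p1 mg gp; have p0 : 0 < p by exact: lt_le_trans p1.
have mgp : measurable_fun setT (fun z => `|g z| `^ p) by meas.
pose Phi x := (\int[m]_z ((`|g z| `^ p)%:E * k x z))%E.
have k0 := kernel_int_ge0.
have : {ae m, forall x, (Phi x < +oo)%E}.
  apply: ae_lty_integral.
  - by rewrite /Phi; meas => *; rewrite mule_ge0 ?lee_fin ?powR_ge0.
  - by move=> x; apply: integral_ge0 => z _; rewrite mule_ge0 ?lee_fin ?powR_ge0.
  rewrite /Phi integral_kernel_op_abs//; side.
  apply: (@le_lt_trans _ _ (2%:E * \int[m]_z (`|g z| `^ p)%:E)%E).
    by rewrite lee_wpmul2r// integral_ge0// => z _; rewrite lee_fin powR_ge0.
  by rewrite lte_mul_pinfty ?lee_fin.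
apply: filterS => x Phix; apply/integrableP; split; first by meas.
apply: (@le_lt_trans _ _ (\int[m]_z k x z + Phi x)%E); last first.
  rewrite lte_add_pinfty// integral_kernel_int.
  by rewrite (le_lt_trans int_kappa)// ltry.
rewrite -ge0_integralD//; side.
apply: le_integral_ge0 => z _; first exact: abse_ge0.
rewrite abseM (gee0_abs (k0 x z)) -[X in (_ <= X + _)%E]mul1e.
rewrite -ge0_muleDl ?lee_fin ?powR_ge0// lee_wpmul2r//.
rewrite -EFinD lee_fin; have [g1|/ltW g1] := leP `|g z| 1.
  by rewrite (le_trans g1)// lerDl powR_ge0.
by rewrite (le_trans (le1r_powR g1 p1))// lerDr.
Qed.

Lemma kernel_op_abs_le (g : X -> R) x : measurable_fun setT g ->
  (`|J g x|%:E <= \int[m]_z \int[mu]_t (kappa t * s x z t * `|g z|)%:E)%E.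
Proof.
move=> mg; apply: (@le_trans _ _ (\int[m]_z ((`|g z|)%:E * k x z))%E).
  apply: (@le_trans _ _ `|\int[m]_z ((g z)%:E * k x z)|%E).
    (* When the integral is infinite, [fine] returns 0 and the bound is trivial, so the inequality
       holds at every x, convergent or not. *)
    rewrite /kernel_op; case: (\int[m]_z ((g z)%:E * k x z))%E => [r| |] //=.
      by rewrite normr0 leey.
    by rewrite normr0 leey.
  apply: le_trans (le_abse_integral _ measurableT _) _; first by meas.
  apply: le_integral_ge0 => z _; first exact: abse_ge0.
  by rewrite abseM (gee0_abs (kernel_int_ge0 x z)).
apply: le_integral_ge0 => z _; first by rewrite mule_ge0 ?lee_fin ?kernel_int_ge0.
rewrite -ge0_integralZl//; side.
apply: le_integral_ge0 => t _; first by rewrite -EFinM lee_fin !mulr_ge0.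
by rewrite -EFinM mulrC.
Qed.

(** Jensen's inequality for the measure kappa(t) s(x, z, t) dt dm(z), of mass at most 2, costs 2^(p
    - 1). Integrating in x brings the mass of the symmetric kernel once more, hence 2^p. *)
Lemma kernel_op_Lp (p : R) (g : X -> R) : 1 <= p -> measurable_fun setT g ->
  (\int[m]_x (`|J g x| `^ p)%:E <= (2 `^ p)%:E * \int[m]_z (`|g z| `^ p)%:E)%E.
Proof.
move=> p1 mg; have p0 : 0 < p by exact: lt_le_trans p1.
have mgp : measurable_fun setT (fun z => `|g z| `^ p) by meas.
have k0 := kernel_int_ge0.
apply: (@le_trans _ _ ((2 `^ (p - 1))%:E *
    \int[m]_x \int[m]_z ((`|g z| `^ p)%:E * k x z))%E).
  apply: ge0_integralZl_le => //; side.
  move=> x _; rewrite -poweR_EFin.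
  have h := kernel_op_abs_le x mg.
  apply: (le_trans (le_poweR (ltW p0) _ h)); first by rewrite lee_fin.
  apply: le_trans (jensen_powR_lebesgue (M := 2) p1 _ _ _ _ _ _) _ => //.
  - by meas.
  - by meas.
  - by move=> z t; rewrite mulr_ge0.
  - by rewrite integral_kernel_int.
  rewrite lee_wpmul2l ?lee_fin ?powR_ge0//.
  apply: le_integral_ge0 => z _.
    by apply: integral_ge0 => t _; rewrite lee_fin !mulr_ge0 ?powR_ge0.
  rewrite -ge0_integralZl//; side.
  apply: le_integral_ge0 => t _; first by rewrite lee_fin !mulr_ge0 ?powR_ge0.
  by rewrite -EFinM mulrC.
rewrite integral_kernel_op_abs//; side.
rewrite -(mulr_powRB1 (ltW (ltr0Sn _ 1)) p0) (mulrC 2) EFinM -muleA.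
rewrite lee_wpmul2l ?lee_fin ?powR_ge0// lee_wpmul2r//.
by apply: integral_ge0 => z _; rewrite lee_fin powR_ge0.
Qed.

(** Real-valued version of the kernel, equal to it for almost every z by integrability. It permits
    subtracting kernels at two points without meeting oo - oo. *)
Let kr x z : R := fine (k x z).

Let mkr x : measurable_fun setT (kr x).
Proof. by apply: (measurable_fun_compT (g := fine)) => //; meas. Qed.

Let kr_ae x : {ae m, forall z, k x z = (kr x z)%:E}.
Proof.
have := integrable_ae measurableT (integrable_kernel_int x).
by apply: filterS => z /(_ Logic.I) kz; rewrite /kr fineK.
Qed.

Let kr_integrable x (g : X -> R) : measurable_fun setT g ->
  kernel_convergent g x ->
  m.-integrable setT (fun z => (g z * kr x z)%:E) /\
  (\int[m]_z ((g z)%:E * k x z) = \int[m]_z (g z * kr x z)%:E)%E.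
Proof.
move=> mg /integrableP[mgk gkoo].
have mgkr : measurable_fun setT (fun z => (g z * kr x z)%:E).
  by apply: measurable_fun_EFin; apply: measurable_funM.
have ae1 : {ae m, forall z, ((g z)%:E * k x z = (g z * kr x z)%:E)%E}.
  by have := kr_ae x; apply: filterS => z ->; rewrite EFinM.
split; last first.
  by apply: ae_eq_integral => //; have := ae1; apply: filterS => z ->.
apply/integrableP; split => //.
have -> : (\int[m]_z `|(g z * kr x z)%:E| = \int[m]_z `|(g z)%:E * k x z|)%E.
  apply: ae_eq_integral => //; [exact: measurableT_comp|exact: measurableT_comp|].
  by have := ae1; apply: filterS => z ->.
by [].
Qed.

Lemma kernel_op_diff (g : X -> R) x y : measurable_fun setT g ->
  kernel_convergent g x -> kernel_convergent g y ->
  (`|J g x - J g y|%:E <= \int[m]_z \int[mu]_t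
     (`|g x - g z| * (kappa t * `|s x z t - s y z t|))%:E)%E.
Proof.
move=> mg cx cy.
have [ix ex] := kr_integrable mg cx.
have [iy ey] := kr_integrable mg cy.
have m1 : measurable_fun [set: X] (fun=> 1 : R) by [].
have c1 u : kernel_convergent (fun=> 1) u.
  rewrite /kernel_convergent; under eq_fun do rewrite mul1e.
  exact: integrable_kernel_int.
have [ix1 ex1] := kr_integrable m1 (c1 x).
have [iy1 ey1] := kr_integrable m1 (c1 y).
pose F z := (g z - g x) * (kr x z - kr y z).
have mF : measurable_fun setT F.
  by rewrite /F; apply: measurable_funM; apply: measurable_funB.
(* Four separately integrable terms. The factor 1 presents those with g(x) as the operator applied
   to the constant function 1; they cancel because the kernels at x and y have equal mass. *)
have eF z : F z = (g z * kr x z - g x * (1 * kr x z)) -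
    (g z * kr y z - g x * (1 * kr y z)) by rewrite /F; ring.
have iZ u : m.-integrable setT (fun z => (1 * kr u z)%:E) ->
    m.-integrable setT (fun z => (g x * (1 * kr u z))%:E).
  by move=> iu; exact: (integrableZl measurableT (g x) iu).
have iB u : m.-integrable setT (fun z => (g z * kr u z)%:E) ->
    m.-integrable setT (fun z => (1 * kr u z)%:E) ->
    m.-integrable setT (fun z => (g z * kr u z - g x * (1 * kr u z))%:E).
  by move=> iu /iZ iu1; exact: (integrableB measurableT iu iu1).
have JE : J g x - J g y = \int[m]_z F z.
  have JR u : (\int[m]_z ((g z)%:E * k u z) = \int[m]_z (g z * kr u z)%:E)%E ->
      J g u = \int[m]_z (g z * kr u z) by rewrite /J => ->.
  rewrite (JR x ex) (JR y ey); under [RHS]eq_Rintegral do rewrite eF.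
  rewrite RintegralB//; [|exact: iB|exact: iB].
  rewrite !RintegralB//; [|exact: iZ|exact: iZ].
  have r1 u : m.-integrable setT (fun z => (1 * kr u z)%:E) ->
      \int[m]_z (g x * (1 * kr u z)) = g x * \int[m]_z (1 * kr u z).
    by move=> iu; exact: RintegralZl.
  have I1 : \int[m]_z (1 * kr x z) = \int[m]_z (1 * kr y z).
    rewrite /Rintegral -ex1 -ey1; congr fine.
    under eq_integral do rewrite mul1e.
    under [RHS]eq_integral do rewrite mul1e.
    by rewrite !integral_kernel_int.
  by rewrite (r1 x ix1) (r1 y iy1) I1 opprB addrA subrK.
have iF : m.-integrable setT (EFin \o F).
  apply: (eq_integrable _ (fun z => ((g z * kr x z - g x * (1 * kr x z)) -
    (g z * kr y z - g x * (1 * kr y z)))%:E)) => //.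
    by move=> z _; rewrite /= eF.
  exact: (integrableB measurableT (iB x ix ix1) (iB y iy iy1)).
rewrite JE; apply: (@le_trans _ _ (\int[m]_z `|F z|%:E)%E).
  rewrite -(fineK (integrable_fin_num measurableT (integrable_abse iF))) lee_fin.
  exact: le_normr_Rintegral.
apply: ae_ge0_le_integral => //.
- by apply: measurable_fun_EFin; apply: (measurableT_comp (@normr_measurable _ setT)).
- by move=> z _; apply: integral_ge0 => t _; rewrite lee_fin !mulr_ge0.
- by meas => *; rewrite lee_fin !mulr_ge0.
(* Outside a null set of z both kernels are finite, so both integrands in t are integrable and the
   difference of the t-integrals is the integral of the difference. *)
have ix' := integrable_ae measurableT (integrable_kernel_int x).
have iy' := integrable_ae measurableT (integrable_kernel_int y).
apply: filterS2 ix' iy' => z /(_ Logic.I) fx /(_ Logic.I) fy _.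
have int_t u : k u z \is a fin_num ->
    mu.-integrable setT (EFin \o (fun t => kappa t * s u z t)).
  move=> fu; apply/integrableP; split; first by apply: measurable_fun_EFin; meas.
  under eq_integral do rewrite gee0_abs ?lee_fin ?mulr_ge0//.
  by rewrite -ge0_fin_numE// kernel_int_ge0.
have i3 := int_t _ fx; have i4 := int_t _ fy.
rewrite normrM distrC EFinM.
have m3 : measurable_fun setT (fun t => (kappa t * `|s x z t - s y z t|)%:E) by meas.
under eq_integral do rewrite EFinM.
rewrite ge0_integralZl//; side.
rewrite lee_wpmul2l ?lee_fin//.
have -> : kr x z - kr y z = \int[mu]_t (kappa t * s x z t - kappa t * s y z t).
  by rewrite RintegralB.
have i5 : mu.-integrable setT
    (EFin \o (fun t => kappa t * s x z t - kappa t * s y z t)).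
  exact: (integrableB measurableT i3 i4).
apply: (@le_trans _ _ (\int[mu]_t `|kappa t * s x z t - kappa t * s y z t|%:E)%E).
  rewrite -(fineK (integrable_fin_num measurableT (integrable_abse i5))) lee_fin.
  exact: le_normr_Rintegral.
apply: le_integral_ge0 => t _; first by rewrite lee_fin.
by rewrite lee_fin -mulrBr normrM (ger0_norm (kappa_ge0 t)).
Qed.

Lemma kernel_op_linear (q : R) (g1 g2 : X -> R) x :
  measurable_fun setT g1 -> measurable_fun setT g2 ->
  kernel_convergent g1 x -> kernel_convergent g2 x ->
  J (fun z => q * g1 z + g2 z) x = q * J g1 x + J g2 x.
Proof.
move=> mg1 mg2 c1 c2.
have mg : measurable_fun setT (fun z => q * g1 z + g2 z) by meas.
have k0 := kernel_int_ge0 x.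
have c12 : kernel_convergent (fun z => q * g1 z + g2 z) x.
  have i1 := integrable_abse (integrableZl measurableT q c1).
  have i2 := integrable_abse c2.
  apply: (le_integrable measurableT _ _ (integrableD measurableT i1 i2)).
    by meas.
  move=> z _ /=; rewrite !abseM (gee0_abs (k0 z)) [leRHS]gee0_abs; last first.
    by rewrite adde_ge0// ?mule_ge0// abse_ge0.
  rewrite muleA -ge0_muleDl ?mule_ge0// lee_wpmul2r//.
  by rewrite -EFinM -EFinD lee_fin -normrM ler_normD.
have [i1 e1] := kr_integrable mg1 c1.
have [i2 e2] := kr_integrable mg2 c2.
have [i12 e12] := kr_integrable mg c12.
rewrite /J e1 e2 e12 -/(Rintegral _ _ _) -/(Rintegral _ _ _) -/(Rintegral _ _ _).
rewrite -RintegralZl// -RintegralD//; last first.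
  exact: (integrableZl measurableT q i1).
by apply: eq_Rintegral => z _; rewrite mulrDl mulrA.
Qed.

Lemma kernel_op_ae_eq (g1 g2 : X -> R) x :
  measurable_fun setT g1 -> measurable_fun setT g2 ->
  ae_eq m setT g1 g2 -> J g1 x = J g2 x.
Proof.
move=> mg1 mg2 g12; rewrite /J; congr fine; apply: ae_eq_integral => //.
- by meas.
- by meas.
- by apply: filterS g12 => z /(_ Logic.I) ->.
Qed.

End kernel_operator.

(** * The smoothing inequality *)

Section iterated_linearity.
Context {d : measure_display} {T : measurableType d} {R : realType}.
Variables (m : {sigma_finite_measure set T -> \bar R}).
Notation mu := (@lebesgue_measure R).
Variables (F G : T -> R -> R).
Hypothesis mF : measurable_fun setT (fun q : T * R => F q.1 q.2).
Hypothesis mG : measurable_fun setT (fun q : T * R => G q.1 q.2).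
Hypothesis F0 : forall z t, 0 <= F z t.
Hypothesis G0 : forall z t, 0 <= G z t.

Let mF1 z : measurable_fun setT (fun t => (F z t)%:E).
Proof.
apply: measurable_fun_EFin.
by apply: (measurable_fun_compT (u := fun t => (z, t)) mF); exact: measurable_fun_pair.
Qed.

Let mG1 z : measurable_fun setT (fun t => (G z t)%:E).
Proof.
apply: measurable_fun_EFin.
by apply: (measurable_fun_compT (u := fun t => (z, t)) mG); exact: measurable_fun_pair.
Qed.

Lemma iterated_integralZl (k : R) : 0 <= k ->
  (\int[m]_z \int[mu]_t (k * F z t)%:E = k%:E * \int[m]_z \int[mu]_t (F z t)%:E)%E.
Proof.
move=> k0; rewrite -ge0_integralZl//.
- apply: eq_integral => z _; under eq_integral do rewrite EFinM.
  by rewrite ge0_integralZl//; [exact: mF1|move=> t _; rewrite lee_fin].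
- apply: (measurable_fun_integral_lebesgue (F := fun z t => (F z t)%:E)) => //.
  exact: measurable_fun_EFin.
- by move=> z _; apply: integral_ge0 => t _; rewrite lee_fin.
Qed.

Lemma iterated_integralD :
  (\int[m]_z \int[mu]_t (F z t + G z t)%:E =
   \int[m]_z \int[mu]_t (F z t)%:E + \int[m]_z \int[mu]_t (G z t)%:E)%E.
Proof.
rewrite -ge0_integralD//.
- apply: eq_integral => z _; under eq_integral do rewrite EFinD.
  by rewrite ge0_integralD//; do ?[exact: mF1|exact: mG1|move=> t _; rewrite lee_fin].
- by move=> z _; apply: integral_ge0 => t _; rewrite lee_fin.
- apply: (measurable_fun_integral_lebesgue (F := fun z t => (F z t)%:E)) => //.
  exact: measurable_fun_EFin.
- by move=> z _; apply: integral_ge0 => t _; rewrite lee_fin.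
- apply: (measurable_fun_integral_lebesgue (F := fun z t => (G z t)%:E)) => //.
  exact: measurable_fun_EFin.
Qed.

End iterated_linearity.

Section iterated_linearity_ereal.
Context {d1 d2 : measure_display} {T1 : measurableType d1} {T2 : measurableType d2}.
Context {R : realType}.
Variables (m1 : {measure set T1 -> \bar R}).
Variables (m2 : {sigma_finite_measure set T2 -> \bar R}).
Variables (F G : T1 -> T2 -> \bar R).
Hypothesis mF : measurable_fun setT (fun q : T1 * T2 => F q.1 q.2).
Hypothesis mG : measurable_fun setT (fun q : T1 * T2 => G q.1 q.2).
Hypothesis F0 : forall x y, (0 <= F x y)%E.
Hypothesis G0 : forall x y, (0 <= G x y)%E.

Let mF1 x : measurable_fun setT (F x).
Proof.
apply: (measurable_fun_compT (u := fun t => (x, t)) mF).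
exact: measurable_fun_pair.
Qed.

Let mG1 x : measurable_fun setT (G x).
Proof.
apply: (measurable_fun_compT (u := fun t => (x, t)) mG).
exact: measurable_fun_pair.
Qed.

Lemma iterated_integralDe :
  (\int[m1]_x \int[m2]_y (F x y + G x y) =
   \int[m1]_x \int[m2]_y F x y + \int[m1]_x \int[m2]_y G x y)%E.
Proof.
rewrite -ge0_integralD//.
- by apply: eq_integral => x _; rewrite ge0_integralD.
- by move=> x _; exact: integral_ge0.
- exact: measurable_fun_integral.
- by move=> x _; exact: integral_ge0.
- exact: measurable_fun_integral.
Qed.

End iterated_linearity_ereal.

Section iterated_on_square.
Context {d : measure_display} {T : measurableType d} {R : realType}.
Variables (m : {sigma_finite_measure set T -> \bar R}).

Lemma iterated_sum4_le (F G H : T -> T -> \bar R) (q : \bar R) (k1 k2 k3 : R) :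
  measurable_fun setT (fun w : T * T => F w.1 w.2) ->
  measurable_fun setT (fun w : T * T => F w.2 w.1) ->
  measurable_fun setT (fun w : T * T => G w.1 w.2) ->
  measurable_fun setT (fun w : T * T => H w.1 w.2) ->
  (forall x y, (0 <= F x y)%E) -> (forall x y, (0 <= G x y)%E) ->
  (forall x y, (0 <= H x y)%E) ->
  (0 <= q)%E -> 0 <= k1 -> 0 <= k2 -> 0 <= k3 ->
  (\int[m]_x \int[m]_y F x y <= k1%:E * q)%E ->
  (\int[m]_x \int[m]_y G x y <= k2%:E * q)%E ->
  (\int[m]_x \int[m]_y H x y <= k3%:E * q)%E ->
  (\int[m]_x \int[m]_y ((F x y + F y x) + (G x y + H x y)) <=
    (k1 + k1 + (k2 + k3))%:E * q)%E.
Proof.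
move=> mF mF' mG mH F0 G0 H0 q0 k10 k20 k30 Fq Gq Hq.
rewrite (@iterated_integralDe _ _ _ _ _ m m (fun x y => F x y + F y x)%E
  (fun x y => G x y + H x y)%E); last 4 first.
- exact: (emeasurable_funD mF mF').
- exact: (emeasurable_funD mG mH).
- by move=> x y; exact: adde_ge0.
- by move=> x y; exact: adde_ge0.
rewrite (@iterated_integralDe _ _ _ _ _ m m F (fun x y => F y x) mF mF')//.
rewrite (@iterated_integralDe _ _ _ _ _ m m G H mG mH)//.
rewrite -[X in (_ + X + _)%E](tonelli_swap F)//.
rewrite !EFinD !ge0_muleDl ?adde_ge0 ?lee_fin//.
by apply: leeD; apply: leeD.
Qed.

(** The exceptional set is discarded one variable at a time, first in x and then in y for each good
    x, so no null set of the product has to be built. *)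
Lemma ae_iterated_le (good : T -> Prop) (F S : T -> T -> \bar R) (k : R) :
  {ae m, forall x, good x} -> 0 <= k ->
  measurable_fun setT (fun w : T * T => F w.1 w.2) ->
  measurable_fun setT (fun w : T * T => S w.1 w.2) ->
  (forall x y, (0 <= F x y)%E) -> (forall x y, (0 <= S x y)%E) ->
  (forall x y, good x -> good y -> (F x y <= k%:E * S x y)%E) ->
  (\int[m]_x \int[m]_y F x y <= k%:E * \int[m]_x \int[m]_y S x y)%E.
Proof.
move=> gd k0 mF mS F0 S0 FS.
have mslice (G : T -> T -> \bar R) x : measurable_fun setT (fun w : T * T => G w.1 w.2) ->
    measurable_fun setT (G x).
  move=> mG; apply: (measurable_fun_compT (u := fun t => (x, t)) mG).
  exact: measurable_fun_pair.
have mIS : measurable_fun setT (fun x => \int[m]_y S x y)%E.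
  exact: measurable_fun_integral.
have IS0 x : (0 <= \int[m]_y S x y)%E by exact: integral_ge0.
rewrite -ge0_integralZl//.
apply: ae_ge0_le_integral => //.
- by move=> x _; exact: integral_ge0.
- exact: measurable_fun_integral.
- by move=> x _; rewrite mule_ge0.
- exact: measurable_funeM.
have gd' := gd; apply: filterS gd => x gx _.
rewrite -ge0_integralZl//; last exact: mslice.
apply: ae_ge0_le_integral => //.
- exact: mslice.
- by move=> y _; rewrite mule_ge0.
- by apply: measurable_funeM; exact: mslice.
by apply: filterS gd' => y gy _; exact: FS.
Qed.

End iterated_on_square.

Lemma poweRD_le {R : realType} (p : R) (x y : \bar R) : 0 <= p ->
  (0 <= x)%E -> (0 <= y)%E ->
  ((x + y) `^ p <= (2 `^ p)%:E * (x `^ p + y `^ p))%E.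
Proof.
move=> p0; wlog xy : x y / (x <= y)%E => [hw x0 y0|x0 y0].
  have [xy|/ltW yx] := leP x y; first exact: hw.
  by rewrite addeC [X in (_ <= _ * X)%E]addeC; exact: hw.
apply: (@le_trans _ _ ((2%:E * y) `^ p)%E).
  apply: le_poweR => //; first exact: adde_ge0.
  by rewrite (_ : 2%:E = 1 + 1)%E// ge0_muleDl// mul1e leeD2r.
rewrite poweRM ?lee_fin// poweR_EFin lee_wpmul2l ?lee_fin ?powR_ge0//.
by rewrite leeDr// poweR_ge0.
Qed.

Lemma poweRD4_le {R : realType} (p B e : R) (x y z w : \bar R) :
  0 <= p -> 0 <= B -> 0 <= e ->
  (0 <= x)%E -> (0 <= y)%E -> (0 <= z)%E -> (0 <= w)%E ->
  (e%:E * (B%:E * ((x + y) + (z + w))) `^ p <= (B `^ p * 4 `^ p)%:E *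
    ((e%:E * x `^ p + e%:E * y `^ p) + (e%:E * z `^ p + e%:E * w `^ p)))%E.
Proof.
move=> p0 B0 e0 x0 y0 z0 w0.
have xy0 := adde_ge0 x0 y0; have zw0 := adde_ge0 z0 w0.
have B0' : (0 <= B%:E)%E by [].
rewrite (poweRM p B0' (adde_ge0 xy0 zw0)) poweR_EFin muleCA EFinM -muleA.
rewrite lee_wpmul2l ?lee_fin ?powR_ge0//.
have px := poweR_ge0 x p; have py := poweR_ge0 y p.
have pz := poweR_ge0 z p; have pw := poweR_ge0 w p.
rewrite -(ge0_muleDr _ px py) -(ge0_muleDr _ pz pw).
rewrite -(ge0_muleDr _ (adde_ge0 px py) (adde_ge0 pz pw)) [leRHS]muleCA.
rewrite lee_wpmul2l ?lee_fin//.
apply: le_trans (poweRD_le p0 xy0 zw0) _.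
have -> : 4 `^ p = 2 `^ p * 2 `^ p :> R by rewrite -powRM// -natrM.
rewrite EFinM -muleA lee_wpmul2l ?lee_fin ?powR_ge0//.
rewrite (ge0_muleDr _ (adde_ge0 px py) (adde_ge0 pz pw)).
by rewrite leeD// poweRD_le.
Qed.

Lemma leeD4_mule {R : realType} (M : \bar R) (x y z w x' y' z' w' : \bar R) :
  (0 <= x)%E -> (0 <= y)%E -> (0 <= z)%E -> (0 <= w)%E ->
  (x' <= M * x)%E -> (y' <= M * y)%E -> (z' <= M * z)%E -> (w' <= M * w)%E ->
  ((x' + y') + (z' + w') <= M * ((x + y) + (z + w)))%E.
Proof.
move=> x0 y0 z0 w0 xx yy zz ww.
rewrite (ge0_muleDr _ (adde_ge0 x0 y0) (adde_ge0 z0 w0)).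
rewrite (ge0_muleDr _ x0 y0) (ge0_muleDr _ z0 w0).
by apply: leeD; apply: leeD.
Qed.

(** Shows that the term r^alpha |g(x) - g(y)|, raised to the power p and divided by r^(N + (alpha +
    beta) p), is a multiple of the integrand of order beta. *)
Lemma powR_mid_term {R : realType} (r u M p a e : R) : 0 < r -> 0 <= u -> 0 < M ->
  r `^ (- (e + a * p)) * (u * (M * r `^ a)) `^ p = M `^ p * (u `^ p / r `^ e).
Proof.
move=> r0 u0 M0; have M0' := ltW M0; have ra := powR_ge0 r a.
rewrite (powRM _ u0 (mulr_ge0 M0' ra)) (powRM _ M0' ra) -powRrM -powRN.
have -> : r `^ (- e) = r `^ (- (e + a * p)) * r `^ (a * p).
  by rewrite (powRDpos _ _ r0); congr (_ `^ _); ring.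
ring.
Qed.

Section besov_smoothing.
Context {d : measure_display} {R : realType} {X : borelMetricType d R}.
Variables (m : {sigma_finite_measure set X -> \bar R}) (N c p a b : R).
Hypothesis m_regular : ahlfors_regular m N.
Hypothesis c_gt0 : 0 < c.
Hypothesis N_gt0 : 0 < N.
Hypothesis m_ball : forall (x : X) (r : R), 0 < r ->
  ((c^-1 * r `^ N)%:E <= m (ball x r) <= (c * r `^ N)%:E)%E.
Hypothesis p_ge1 : 1 <= p.
Hypothesis a_gt0 : 0 < a.
Hypothesis b_gt0 : 0 < b.
Hypothesis ab_lt1 : a + b < 1.
Notation mu := (@lebesgue_measure R).
Variables (kappa : R -> R) (s : X -> X -> R -> R) (K L : R).
Hypothesis K_ge0 : 0 <= K.
Hypothesis L_ge0 : 0 <= L.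
Hypothesis kappa_ge0 : forall t, 0 <= kappa t.
Hypothesis kappa_le : forall t, kappa t <= (0 < t)%R%:R * (a * t `^ (a - 1)).
Hypothesis mkappa : measurable_fun setT kappa.
Hypothesis int_kappa : (\int[mu]_t (kappa t)%:E <= 2%:E)%E.
Hypothesis s_ge0 : forall x y t, 0 <= s x y t.
Hypothesis ms : measurable_fun setT (fun q : X * X * R => s q.1.1 q.1.2 q.2).
Hypothesis int_s : forall x t, 0 < t -> (\int[m]_y (s x y t)%:E = 1)%E.
Hypothesis s_le : forall x y t, 0 < t ->
  s x y t <= K * t `^ (- N) * (mdist x y < 4 * t)%R%:R.
Hypothesis s_lip : forall x y z t, 0 < t -> mdist x y <= t ->
  `|s x z t - s y z t| <= L * t `^ (- N) * (mdist x y / t) * (mdist x z < 5 * t)%R%:R.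

Let p_gt0 : 0 < p. Proof. exact: lt_le_trans p_ge1. Qed.
Let delta := 1 - a - b.
Let delta_gt0 : 0 < delta. Proof. rewrite /delta; have := ab_lt1; lra. Qed.
Let E := N + b * p.
Let E' := N + (a + b) * p.

Ltac meas_hook ::= meas_integral.

Let kappa_le0 t : t <= 0 -> kappa t = 0.
Proof.
move=> t0; apply/eqP; rewrite eq_le kappa_ge0 andbT.
by have := kappa_le t; rewrite ltNge t0/= mul0r.
Qed.

(* Weights for t < r and for t >= r. In the second range the Lipschitz bound
   leaves t^(a - 2 - N), split as t^(- delta - 1 - N) t^(- b) so that the first
   factor, taken as weight in Jensen's inequality, is integrable at infinity. *)
Let w1 (r t : R) : R := (0 < t)%R%:R * (t < r)%R%:R * t `^ (a - 1 - N).
Let w2 (r t : R) : R := (0 < t)%R%:R * (r <= t)%R%:R * t `^ (- delta - 1 - N).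

Let w1_ge0 r t : 0 <= w1 r t.
Proof. by rewrite !mulr_ge0 ?powR_ge0. Qed.

Let w2_ge0 r t : 0 <= w2 r t.
Proof. by rewrite !mulr_ge0 ?powR_ge0. Qed.

Let chi (x z : X) (t : R) : R := (mdist x z < 5 * t)%R%:R.

Let chi_ge0 x z t : 0 <= chi x z t.
Proof. exact: ler0n. Qed.

Ltac nneg_hook ::= first [exact: chi_ge0 | exact: w1_ge0 | exact: w2_ge0].
Ltac meas_hook ::= first [meas_integral | progress rewrite /chi
  | progress rewrite /w1 | progress rewrite /w2].

Let int_chi (x : X) t : 0 < t ->
  (\int[m]_z (chi x z t)%:E <= (c * 5 `^ N * t `^ N)%:E)%E.
Proof.
move=> t0; have t50 : 0 < 5 * t by lra.
rewrite -mulrA -powRM ?(ltW t0)// -[c]mul1r.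
by apply: (integral_le_ball m_regular m_ball (x := x)) => // z; rewrite mul1r.
Qed.

Let mass1 (x : X) r : 0 < r ->
  (\int[m]_z \int[mu]_t (w1 r t * chi x z t)%:E <= (c * 5 `^ N / a * r `^ a)%:E)%E.
Proof.
move=> r0; rewrite (tonelli_lebesgue m (F := fun z t => (w1 r t * chi x z t)%:E)); last 2 first.
- by rewrite /w1 /chi; meas.
- by move=> z t; rewrite lee_fin mulr_ge0.
apply: (@le_trans _ _ ((c * 5 `^ N)%:E *
    \int[mu]_t ((0 < t)%R%:R * (t <= r)%R%:R * t `^ (a - 1))%:E)%E).
  have k0 : 0 <= c * 5 `^ N by rewrite mulr_ge0 ?powR_ge0// ltW.
  apply: ge0_integralZl_le => //; side.
  move=> t _; rewrite /w1; have [t0|t0] := ltP 0 t; last first.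
    by rewrite !mul0r mule0 integral0_eq// => z _; rewrite !mul0r.
  rewrite !mul1r; under eq_integral do rewrite EFinM.
  rewrite ge0_integralZl//; side.
  apply: le_trans (lee_wpmul2l _ (int_chi x t0)) _; first by nneg.
  rewrite -!EFinM lee_fin mulrCA ler_wpM2l// -mulrA powRDpos// subrK.
  rewrite ler_wpM2r ?powR_ge0// ler_nat.
  by case: ltP => // /ltW ->.
apply: le_trans (lee_wpmul2l _ (integral_indicator_head r0 a_gt0)) _.
  by rewrite lee_fin mulr_ge0 ?powR_ge0// ltW.
by rewrite -EFinM lee_fin mulrA mulrAC.
Qed.

Let mass2 (x : X) r : 0 < r ->
  (\int[m]_z \int[mu]_t (w2 r t * chi x z t)%:E <=
    (c * 5 `^ N * 2 `^ delta / delta * r `^ (- delta))%:E)%E.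
Proof.
move=> r0; rewrite (tonelli_lebesgue m (F := fun z t => (w2 r t * chi x z t)%:E)); last 2 first.
- by rewrite /w2 /chi; meas.
- by move=> z t; rewrite lee_fin mulr_ge0.
(* The tail formula has a strict inequality: r <= t is relaxed to r / 2 < t, at the price of the
   factor 2^delta. *)
have r20 : 0 < r / 2 by lra.
apply: (@le_trans _ _ ((c * 5 `^ N)%:E *
    \int[mu]_t ((r / 2 < t)%R%:R * t `^ (- delta - 1))%:E)%E).
  have k0 : 0 <= c * 5 `^ N by rewrite mulr_ge0 ?powR_ge0// ltW.
  apply: ge0_integralZl_le => //; side.
  move=> t _; rewrite /w2; have [t0|t0] := ltP 0 t; last first.
    rewrite integral0_eq; first by nneg.
    by move=> z _; rewrite !mul0r.
  rewrite !mul1r; under eq_integral do rewrite EFinM.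
  rewrite ge0_integralZl//; side.
  apply: le_trans (lee_wpmul2l _ (int_chi x t0)) _; first by nneg.
  rewrite -!EFinM lee_fin mulrCA ler_wpM2l// -mulrA powRDpos// subrK.
  rewrite ler_wpM2r ?powR_ge0// ler_nat.
  by case: (leP r t) => // rt; rewrite (_ : r / 2 < t)//; lra.
rewrite integral_indicator_tail// -EFinM lee_fin.
rewrite powRM ?(ltW r0)// ?invr_ge0//.
have -> : 2^-1 `^ (- delta) = 2 `^ delta :> R.
  by rewrite -[in LHS]powR_inv1// -powRrM mulN1r opprK.
by rewrite le_eqVlt; apply/orP; left; apply/eqP; ring.
Qed.

Section one_function.
Variables (g : X -> R).
Hypothesis mg : measurable_fun setT g.
Let U x z := `|g x - g z|.
Let U_ge0 x z : 0 <= U x z. Proof. exact: normr_ge0. Qed.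

Let near x r := (\int[m]_z \int[mu]_t (w1 r t * chi x z t * U x z)%:E)%E.
Let far x r := (\int[m]_z \int[mu]_t (w2 r t * chi x z t * (t `^ (- b) * U x z))%:E)%E.

Let pointwise x y z t : 0 < mdist x y ->
  U x z * (kappa t * `|s x z t - s y z t|) <=
  a * (K + L) * ((w1 (mdist x y) t * chi x z t * U x z +
     w1 (mdist x y) t * chi y z t * U y z) +
    (U x y * (w1 (mdist x y) t * chi y z t) +
     mdist x y * (w2 (mdist x y) t * chi x z t * (t `^ (- b) * U x z)))).
Proof.
move=> r0; set r := mdist x y in r0 *.
have aK : 0 <= a * (K + L) by rewrite mulr_ge0 ?addr_ge0// ltW.
have rhs0 : 0 <= a * (K + L) * ((w1 r t * chi x z t * U x z +
     w1 r t * chi y z t * U y z) + (U x y * (w1 r t * chi y z t) +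
     r * (w2 r t * chi x z t * (t `^ (- b) * U x z)))).
  by rewrite mulr_ge0// !addr_ge0// !mulr_ge0 ?powR_ge0// ltW.
have kt := kappa_le t; have [t0|t0] := ltP 0 t; last first.
  rewrite ltNge t0/= mul0r in kt.
  have -> : kappa t = 0 by apply/eqP; rewrite eq_le kt kappa_ge0.
  by rewrite mul0r mulr0.
rewrite t0 mul1r in kt.
apply: (@le_trans _ _ (U x z * (a * t `^ (a - 1) * `|s x z t - s y z t|))).
  by rewrite ler_wpM2l// ler_wpM2r.
have [tr|rt] := ltP t r.
  have w1E : w1 r t = t `^ (a - 1) * t `^ (- N) by rewrite /w1 t0 tr !mul1r powRDpos.
  have w2E : w2 r t = 0 by rewrite /w2 leNgt tr/= mulr0 mul0r.
  have s4 u v : s u v t <= K * t `^ (- N) * chi u v t.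
    apply: le_trans (s_le u v t0) _; rewrite ler_wpM2l ?mulr_ge0 ?powR_ge0//.
    rewrite /chi ler_nat; case: ltP => // uv.
    by rewrite (_ : mdist u v < 5 * t)//; lra.
  have ds : `|s x z t - s y z t| <= K * t `^ (- N) * (chi x z t + chi y z t).
    rewrite mulrDr; apply: le_trans (ler_normB _ _) _.
    by rewrite !ger0_norm// lerD.
  (* On the support of s(y, z, t) the point z is close to y, so |g(x) - g(z)| must be recentred at
     y. This creates the term with |g(x) - g(y)|. *)
  have Utri : U x z <= U y z + U x y.
    by rewrite addrC; exact: ler_distD.
  rewrite w2E !mul0r mulr0 addr0 w1E.
  apply: (@le_trans _ _ (U x z * (a * t `^ (a - 1) * (K * t `^ (- N) * (chi x z t + chi y z t))))).
    by rewrite ler_wpM2l// ler_wpM2l// mulr_ge0 ?powR_ge0// ltW.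
  pose k := t `^ (a - 1) * t `^ (- N).
  have k0 : 0 <= k by rewrite mulr_ge0 ?powR_ge0.
  apply: (@le_trans _ _ (a * K * (k * (chi x z t * U x z + chi y z t * (U y z + U x y))))).
    have -> : U x z * (a * t `^ (a - 1) * (K * t `^ (- N) * (chi x z t + chi y z t))) =
       a * K * (k * (chi x z t * U x z + chi y z t * U x z)) by rewrite /k; ring.
    rewrite ler_wpM2l ?mulr_ge0 ?(ltW a_gt0)// ler_wpM2l// lerD2l.
    by rewrite ler_wpM2l.
  rewrite -/k.
  have -> : k * chi x z t * U x z + k * chi y z t * U y z + U x y * (k * chi y z t) =
    k * (chi x z t * U x z + chi y z t * (U y z + U x y)) by ring.
  apply: ler_wpM2r; last by apply: ler_wpM2l; [exact: ltW|rewrite lerDl].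
  by rewrite mulr_ge0// addr_ge0// mulr_ge0// addr_ge0.
have w1E : w1 r t = 0 by rewrite /w1 (ltNge t r) rt/= mulr0 mul0r.
have w2E : w2 r t = t `^ (- delta - 1 - N) by rewrite /w2 t0 rt !mul1r.
rewrite w1E !mul0r mulr0 !add0r w2E.
apply: (@le_trans _ _ (U x z * (a * t `^ (a - 1) * (L * t `^ (- N) * (r / t) * chi x z t)))).
  by rewrite ler_wpM2l// ler_wpM2l ?mulr_ge0 ?powR_ge0 ?(ltW a_gt0)// s_lip.
have -> : U x z * (a * t `^ (a - 1) * (L * t `^ (- N) * (r / t) * chi x z t)) =
   a * L * (r * (t `^ (a - 1) * t `^ (- N) * t^-1 * chi x z t * U x z)) by ring.
have -> : r * (t `^ (- delta - 1 - N) * chi x z t * (t `^ (- b) * U x z)) =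
   r * (t `^ (- delta - 1 - N) * t `^ (- b) * chi x z t * U x z) by ring.
have -> : t^-1 = t `^ (- 1) by rewrite powR_inv1// ltW.
rewrite !powRDpos//.
have -> : a - 1 + - N - 1 = - delta - 1 - N + - b by rewrite /delta; ring.
apply: ler_wpM2r; last by apply: ler_wpM2l; [exact: ltW|rewrite lerDr].
by rewrite mulr_ge0 ?(ltW r0)// !mulr_ge0 ?powR_ge0.
Qed.

Lemma kernel_op_diff_le x y : 0 < mdist x y ->
  (\int[m]_z \int[mu]_t (U x z * (kappa t * `|s x z t - s y z t|))%:E <=
   (a * (K + L))%:E * ((near x (mdist x y) + near y (mdist x y)) +
     ((U x y * (c * 5 `^ N / a * mdist x y `^ a))%:E +
      (mdist x y)%:E * far x (mdist x y))))%E.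
Proof.
move=> r0; set r := mdist x y in r0 *.
have aK : 0 <= a * (K + L) by rewrite mulr_ge0 ?addr_ge0// ltW.
apply: (@le_trans _ _ (\int[m]_z \int[mu]_t (a * (K + L) *
   ((w1 r t * chi x z t * U x z + w1 r t * chi y z t * U y z) +
    (U x y * (w1 r t * chi y z t) +
     r * (w2 r t * chi x z t * (t `^ (- b) * U x z)))))%:E)%E).
  apply: le_integral_ge0 => z _.
    by apply: integral_ge0 => t _; rewrite lee_fin !mulr_ge0.
  apply: le_integral_ge0 => t _; first by rewrite lee_fin !mulr_ge0.
  by rewrite lee_fin; exact: pointwise.
have m1 u v : measurable_fun setT (fun q : X * R => w1 r q.2 * chi u q.1 q.2 * U v q.1).
  by rewrite /w1 /chi /U; meas.
have m2 : measurable_fun setT (fun q : X * R => U x y * (w1 r q.2 * chi y q.1 q.2)).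
  by rewrite /w1 /chi /U; meas.
have m3 : measurable_fun setT (fun q : X * R => w1 r q.2 * chi y q.1 q.2).
  by rewrite /w1 /chi /U; meas.
have m4 : measurable_fun setT
    (fun q : X * R => w2 r q.2 * chi x q.1 q.2 * (q.2 `^ (- b) * U x q.1)).
  by rewrite /w2 /chi /U; meas.
have r0' := ltW r0.
rewrite (@iterated_integralZl _ _ _ m (fun z t =>
   ((w1 r t * chi x z t * U x z + w1 r t * chi y z t * U y z) +
    (U x y * (w1 r t * chi y z t) +
     r * (w2 r t * chi x z t * (t `^ (- b) * U x z))))))//; last 2 first.
- do ![apply: measurable_funD | exact: m1 | exact: m2 ].
  by apply: measurable_funM => //; exact: m4.
- by nneg.
rewrite lee_wpmul2l ?lee_fin//.
rewrite (@iterated_integralD _ _ _ m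
  (fun z t => w1 r t * chi x z t * U x z + w1 r t * chi y z t * U y z)
  (fun z t => U x y * (w1 r t * chi y z t) +
     r * (w2 r t * chi x z t * (t `^ (- b) * U x z)))); last 4 first.
- by apply: measurable_funD; exact: m1.
- apply: measurable_funD; first exact: m2.
  by apply: measurable_funM => //; exact: m4.
- by nneg.
- by nneg.
rewrite leeD//.
  rewrite (@iterated_integralD _ _ _ m (fun z t => w1 r t * chi x z t * U x z)
    (fun z t => w1 r t * chi y z t * U y z)); try solve [exact: m1 | nneg].
  exact: lexx.
rewrite (@iterated_integralD _ _ _ m (fun z t => U x y * (w1 r t * chi y z t))
    (fun z t => r * (w2 r t * chi x z t * (t `^ (- b) * U x z)))); last 4 first.
- exact: m2.
- by apply: measurable_funM => //; exact: m4.
- by nneg.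
- by nneg.
rewrite leeD//.
  rewrite (@iterated_integralZl _ _ _ m (fun z t => w1 r t * chi y z t))//; last first.
    by move=> z t; rewrite mulr_ge0.
  by rewrite EFinM lee_wpmul2l ?lee_fin// mass1.
rewrite (@iterated_integralZl _ _ _ m
  (fun z t => w2 r t * chi x z t * (t `^ (- b) * U x z))); try solve [exact: m4 | nneg].
exact: lexx.
Qed.

Let M1 := c * 5 `^ N / a.
Let M2 := c * 5 `^ N * 2 `^ delta / delta.
Let M1_gt0 : 0 < M1.
Proof. by rewrite divr_gt0// mulr_gt0// powR_gt0. Qed.
Let M2_gt0 : 0 < M2.
Proof. by rewrite divr_gt0// !mulr_gt0// powR_gt0. Qed.

(* [w1 r t] and [w2 r t] times the powers of [r] produced by Jensen's inequality
   and by the denominator [r `^ E']. *)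
Let W1 (r t : R) : R :=
  (0 < t)%R%:R * (t < r)%R%:R * t `^ (a - 1 - N) * r `^ (- N - (b * p + a)).
Let W2 (r t : R) : R :=
  (0 < r)%R%:R * (0 < t)%R%:R * (r <= t)%R%:R * t `^ (- delta - 1 - N - b * p) *
  r `^ (- N + delta).

Let P1r x r := (\int[m]_z \int[mu]_t
  (W1 r t * (chi x z t * U x z `^ p))%:E)%E.
Let P4r x r := (\int[m]_z \int[mu]_t
  (W2 r t * (chi x z t * U x z `^ p))%:E)%E.

(** The mass bound M1 r^a enters Jensen's inequality with power p - 1, and - E' + a (p - 1) = - N -
    (b p + a) is the exponent of r in [W1]. *)
Let near_pow x r : 0 < r ->
  ((r `^ (- E'))%:E * near x r `^ p <= (M1 `^ (p - 1))%:E * P1r x r)%E.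
Proof.
move=> r0; have ra0 : 0 < M1 * r `^ a by rewrite mulr_gt0// powR_gt0.
have jn := @jensen_powR_lebesgue _ _ _ m p _ (fun z t => w1 r t * chi x z t)
  (fun z _ => U x z) p_ge1 ra0.
apply: (@le_trans _ _ ((r `^ (- E'))%:E * (((M1 * r `^ a) `^ (p - 1))%:E *
    \int[m]_z \int[mu]_t (w1 r t * chi x z t * U x z `^ p)%:E))%E).
  rewrite lee_wpmul2l ?lee_fin ?powR_ge0//; apply: jn => //.
  - by meas.
  - by rewrite /U; meas.
  - by nneg.
  - exact: mass1.
have mw : measurable_fun setT
    (fun q : X * R => w1 r q.2 * chi x q.1 q.2 * U x q.1 `^ p).
  by rewrite /U; meas.
have w0 z t : 0 <= w1 r t * chi x z t * U x z `^ p by nneg.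
rewrite muleA -EFinM.
have -> : r `^ (- E') * (M1 * r `^ a) `^ (p - 1) =
    M1 `^ (p - 1) * r `^ (- N - (b * p + a)).
  rewrite powRM ?powR_ge0 ?(ltW M1_gt0)// -powRrM mulrCA powRDpos//.
  by congr (_ * _ `^ _); rewrite /E'; ring.
rewrite EFinM -muleA lee_wpmul2l ?lee_fin ?powR_ge0//.
rewrite -(iterated_integralZl m mw w0 (powR_ge0 _ _)).
apply: le_integral_ge0 => z _.
  by apply: integral_ge0 => t _; rewrite lee_fin mulr_ge0 ?powR_ge0.
apply: le_integral_ge0 => t _; first by rewrite lee_fin mulr_ge0 ?powR_ge0.
rewrite lee_fin /W1 /w1 le_eqVlt; apply/orP; left; apply/eqP; ring.
Qed.

(** The Lipschitz gain r, raised to the power p, outweighs the losses: - E' + p - delta (p - 1) = -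
    N + delta, the exponent of r in [W2]. *)
Let far_pow x r : 0 < r ->
  ((r `^ (- E'))%:E * (r%:E * far x r) `^ p <= (M2 `^ (p - 1))%:E * P4r x r)%E.
Proof.
move=> r0; have ra0 : 0 < M2 * r `^ (- delta) by rewrite mulr_gt0// powR_gt0.
have far0 : (0 <= far x r)%E.
  by apply: integral_ge0 => z _; apply: integral_ge0 => t _; nneg.
have jn := @jensen_powR_lebesgue _ _ _ m p _ (fun z t => w2 r t * chi x z t)
  (fun z t => t `^ (- b) * U x z) p_ge1 ra0.
rewrite poweRM ?lee_fin ?(ltW r0)// poweR_EFin muleA -EFinM.
apply: (@le_trans _ _ ((r `^ (- E') * r `^ p)%:E * (((M2 * r `^ (- delta)) `^ (p - 1))%:E *
    \int[m]_z \int[mu]_t (w2 r t * chi x z t * (t `^ (- b) * U x z) `^ p)%:E))%E).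
  rewrite lee_wpmul2l ?lee_fin ?mulr_ge0 ?powR_ge0//; apply: jn => //.
  - by meas.
  - by rewrite /U; meas.
  - by nneg.
  - by nneg.
  - exact: mass2.
have mw : measurable_fun setT
    (fun q : X * R => w2 r q.2 * chi x q.1 q.2 * (q.2 `^ (- b) * U x q.1) `^ p).
  by rewrite /U; meas.
have w0 z t : 0 <= w2 r t * chi x z t * (t `^ (- b) * U x z) `^ p by nneg.
rewrite muleA -EFinM.
have -> : r `^ (- E') * r `^ p * (M2 * r `^ (- delta)) `^ (p - 1) =
    M2 `^ (p - 1) * r `^ (- N + delta).
  rewrite powRM ?powR_ge0 ?(ltW M2_gt0)// -powRrM powRDpos// mulrCA powRDpos//.
  by congr (_ * _ `^ _); rewrite /E' /delta; ring.
rewrite EFinM -muleA; apply: lee_wpmul2l; first by rewrite lee_fin powR_ge0.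
rewrite -(iterated_integralZl m mw w0 (powR_ge0 _ _)).
apply: le_integral_ge0 => z _.
  by apply: integral_ge0 => t _; rewrite lee_fin mulr_ge0 ?powR_ge0.
apply: le_integral_ge0 => t _; first by rewrite lee_fin mulr_ge0 ?powR_ge0.
rewrite lee_fin /W2 /w2 r0 mul1r.
have [t0|t0] := ltP 0 t; last by rewrite !mul0r mulr0.
rewrite powRM ?powR_ge0// -powRrM -(powRDpos _ (- (b * p)) t0).
by rewrite mulNr le_eqVlt; apply/orP; left; apply/eqP; ring.
Qed.

Let P1 x y := P1r x (mdist x y).
Let P4 x y := P4r x (mdist x y).
Let P3 x y := (U x y `^ p / mdist x y `^ E)%:E.

Let W1_ge0 r t : 0 <= W1 r t. Proof. by rewrite /W1; nneg. Qed.
Let W2_ge0 r t : 0 <= W2 r t. Proof. by rewrite /W2; nneg. Qed.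
Ltac nneg_hook ::= first [exact: chi_ge0 | exact: w1_ge0 | exact: w2_ge0 |
  exact: W1_ge0 | exact: W2_ge0].
Let P1r_ge0 x r : (0 <= P1r x r)%E. Proof. by rewrite /P1r; nneg. Qed.
Let P1_ge0 x y : (0 <= P1 x y)%E. Proof. exact: P1r_ge0. Qed.
Let P4_ge0 x y : (0 <= P4 x y)%E. Proof. by rewrite /P4 /P4r; nneg. Qed.
Let P3_ge0 x y : (0 <= P3 x y)%E.
Proof. by rewrite /P3 lee_fin divr_ge0 ?powR_ge0. Qed.

Let C0 : R := (a * (K + L)) `^ p * (4 `^ p * (M1 `^ (p - 1) + M2 `^ (p - 1) + M1 `^ p)).

Let diff_pow x y : 0 < mdist x y ->
  ((mdist x y `^ (- E'))%:E *
    (\int[m]_z \int[mu]_t (U x z * (kappa t * `|s x z t - s y z t|))%:E) `^ p <=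
    C0%:E * ((P1 x y + P1 y x) + (P3 x y + P4 x y)))%E.
Proof.
move=> r0; have D := kernel_op_diff_le r0; set r := mdist x y in r0 D *.
have aK : 0 <= a * (K + L) by rewrite mulr_ge0 ?addr_ge0// ltW.
have near0 u : (0 <= near u r)%E.
  by apply: integral_ge0 => z _; apply: integral_ge0 => t _; nneg.
have far0 : (0 <= r%:E * far x r)%E.
  apply: mule_ge0; first by rewrite lee_fin ltW.
  by apply: integral_ge0 => z _; apply: integral_ge0 => t _; nneg.
have q0 : (0 <= (U x y * (M1 * r `^ a))%:E)%E.
  by rewrite lee_fin mulr_ge0 ?U_ge0// mulr_ge0 ?powR_ge0 ?(ltW M1_gt0).
have D0 : (0 <= \int[m]_z \int[mu]_t (U x z * (kappa t * `|s x z t - s y z t|))%:E)%E.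
  by apply: integral_ge0 => z _; apply: integral_ge0 => t _; nneg.
have {}D := le_poweR (ltW p_gt0) D0 D.
have rE0 : 0 <= r `^ (- E') by exact: powR_ge0.
apply: (le_trans (lee_wpmul2l _ D)); first by rewrite lee_fin.
apply: (le_trans (poweRD4_le (ltW p_gt0) aK rE0 (near0 x) (near0 y) q0 far0)).
rewrite /C0 mulrA [in leRHS]EFinM -[leRHS]muleA.
rewrite lee_wpmul2l ?lee_fin ?mulr_ge0 ?powR_ge0//.
set M := M1 `^ (p - 1) + M2 `^ (p - 1) + M1 `^ p.
have MM1 : ((M1 `^ (p - 1))%:E <= M%:E)%E by rewrite lee_fin /M -addrA lerDl addr_ge0 ?powR_ge0.
have MM2 : ((M2 `^ (p - 1))%:E <= M%:E)%E by rewrite lee_fin /M addrAC lerDr addr_ge0 ?powR_ge0.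
have MM3 : M1 `^ p <= M by rewrite /M lerDr addr_ge0 ?powR_ge0.
have U0 : 0 <= U x y `^ p / r `^ E.
  exact: (divr_ge0 (powR_ge0 _ _) (powR_ge0 _ _)).
have yxr : P1 y x = P1r y r by rewrite /P1 metric_sym.
have hx := near_pow x r0; have hy := near_pow y r0; have hf := far_pow x r0.
apply: (leeD4_mule (P1_ge0 x y) (P1_ge0 y x) (P3_ge0 x y) (P4_ge0 x y)).
- exact: (le_trans hx (lee_wpmul2r (P1_ge0 x y) MM1)).
- rewrite yxr; exact: (le_trans hy (lee_wpmul2r (P1r_ge0 y r) MM1)).
- have -> : E' = E + a * p by rewrite /E' /E; ring.
  rewrite poweR_EFin -!EFinM lee_fin (powR_mid_term _ _ _ r0 (U_ge0 x y) M1_gt0).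
  exact: (ler_wpM2r U0 MM3).
- exact: (le_trans hf (lee_wpmul2r (P4_ge0 x y) MM2)).
Qed.

(** The integral over d(x, y) > t gives t^(- (b p + a)), so the powers of t with exponent a cancel
    and - E - 1 remains, as [weighted_average_le] requires. *)
Let int_W1 (x : X) t : 0 < t ->
  (\int[m]_y (W1 (mdist x y) t)%:E <=
   ((N + (b * p + a)) * c / (b * p + a) * t `^ (- E - 1))%:E)%E.
Proof.
move=> t0; have q0 : 0 < b * p + a by rewrite addr_gt0// mulr_gt0.
apply: (@le_trans _ _ ((t `^ (a - 1 - N))%:E *
    \int[m]_y ((t < mdist x y)%R%:R * mdist x y `^ (- N - (b * p + a)))%:E)%E).
  apply: ge0_integralZl_le => //; side.
  by move=> y _; rewrite -EFinM lee_fin /W1 t0 mul1r mulrAC mulrC.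
apply: le_trans (lee_wpmul2l _ (integral_mdist_tail m_regular c_gt0 N_gt0 m_ball x t0 q0)) _.
  by rewrite lee_fin powR_ge0.
rewrite -EFinM lee_fin mulrCA powRDpos//.
by rewrite (_ : a - 1 - N + - (b * p + a) = - E - 1)// /E; ring.
Qed.

(** Positivity of delta makes d^(- N + delta) integrable over d(x, y) <= t; the resulting t^delta
    cancels the delta in the exponent of t. *)
Let int_W2 (x : X) t : 0 < t ->
  (\int[m]_y (W2 (mdist x y) t)%:E <=
   ((N * c / delta + c * 2 `^ N) * t `^ (- E - 1))%:E)%E.
Proof.
move=> t0.
apply: (@le_trans _ _ ((t `^ (- delta - 1 - N - b * p))%:E *
    \int[m]_y ((0 < mdist x y)%R%:R * (mdist x y <= t)%R%:R * mdist x y `^ (- N + delta))%:E)%E).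
  apply: ge0_integralZl_le => //; side.
  move=> y _; rewrite -EFinM lee_fin /W2 t0 mulr1 le_eqVlt; apply/orP; left; apply/eqP.
  by ring.
apply: le_trans (lee_wpmul2l _ (integral_mdist_head m_regular c_gt0 N_gt0 m_ball x t0 delta_gt0)) _.
  by rewrite lee_fin powR_ge0.
rewrite -EFinM lee_fin mulrCA powRDpos//.
by rewrite (_ : - delta - 1 - N - b * p + delta = - E - 1)// /E; ring.
Qed.

Let K1 : R := (N + (b * p + a)) * c / (b * p + a) * 5 `^ E / E.
Let K4 : R := (N * c / delta + c * 2 `^ N) * 5 `^ E / E.

Let bp0 : 0 < b * p. Proof. by rewrite mulr_gt0. Qed.
Let C1_ge0 : 0 <= (N + (b * p + a)) * c / (b * p + a).
Proof. by rewrite ltW// divr_gt0 ?mulr_gt0 ?addr_gt0. Qed.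
Let C4_ge0 : 0 <= N * c / delta + c * 2 `^ N.
Proof. by rewrite addr_ge0// ?divr_ge0 ?mulr_ge0 ?powR_ge0// ltW. Qed.
Let E_gt0 : 0 < E. Proof. by rewrite addr_gt0. Qed.
Let K1_ge0 : 0 <= K1.
Proof. by rewrite /K1 divr_ge0 ?(ltW E_gt0)// mulr_ge0 ?powR_ge0. Qed.
Let K4_ge0 : 0 <= K4.
Proof. by rewrite /K4 divr_ge0 ?(ltW E_gt0)// mulr_ge0 ?powR_ge0. Qed.

Let mW1 : measurable_fun setT (fun q : R * R => W1 q.1 q.2).
Proof. by rewrite /W1; meas. Qed.
Let mW2 : measurable_fun setT (fun q : R * R => W2 q.1 q.2).
Proof. by rewrite /W2; meas. Qed.

Let sum_P1 : (\int[m]_x \int[m]_y P1 x y <= K1%:E * gagliardo m N b p g)%E.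
Proof.
apply: (weighted_average_le m_regular N_gt0 p_ge1 b_gt0 mg C1_ge0 mW1) => //.
Qed.

Let sum_P4 : (\int[m]_x \int[m]_y P4 x y <= K4%:E * gagliardo m N b p g)%E.
Proof.
apply: (weighted_average_le m_regular N_gt0 p_ge1 b_gt0 mg C4_ge0 mW2) => //.
Qed.

Let mP1 : measurable_fun setT (fun q : X * X => P1 q.1 q.2).
Proof. by rewrite /P1 /P1r /W1 /U; meas; nneg. Qed.
Let mP1' : measurable_fun setT (fun q : X * X => P1 q.2 q.1).
Proof. by rewrite /P1 /P1r /W1 /U; meas; nneg. Qed.
Let mP4 : measurable_fun setT (fun q : X * X => P4 q.1 q.2).
Proof. by rewrite /P4 /P4r /W2 /U; meas; nneg. Qed.
Let mP3 : measurable_fun setT (fun q : X * X => P3 q.1 q.2).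
Proof. by rewrite /P3 /U; meas. Qed.

Let S x y : \bar R := ((P1 x y + P1 y x) + (P3 x y + P4 x y))%E.
Let S_ge0 x y : (0 <= S x y)%E.
Proof.
exact: (adde_ge0 (adde_ge0 (P1_ge0 x y) (P1_ge0 y x))
  (adde_ge0 (P3_ge0 x y) (P4_ge0 x y))).
Qed.
Let mS : measurable_fun setT (fun q : X * X => S q.1 q.2).
Proof. exact: (emeasurable_funD (emeasurable_funD mP1 mP1') (emeasurable_funD mP3 mP4)). Qed.

Let C0_ge0 : 0 <= C0.
Proof. by rewrite /C0 mulr_ge0 ?powR_ge0// mulr_ge0 ?powR_ge0// !addr_ge0 ?powR_ge0. Qed.

Let sum_S : (\int[m]_x \int[m]_y S x y <=
  (K1 + K1 + (1 + K4))%:E * gagliardo m N b p g)%E.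
Proof.
have Q0 : (0 <= gagliardo m N b p g)%E.
  by apply: integral_ge0 => x _; apply: integral_ge0 => y _; exact: P3_ge0.
have sum_P3 : (\int[m]_x \int[m]_y P3 x y <= 1%:E * gagliardo m N b p g)%E.
  by rewrite mul1e.
exact: (iterated_sum4_le mP1 mP1' mP3 mP4 P1_ge0 P3_ge0 P4_ge0 Q0 K1_ge0 ler01
  K4_ge0 sum_P1 sum_P3 sum_P4).
Qed.

Lemma besov_smoothing_bound (f : X -> R) : measurable_fun setT f ->
  {ae m, forall x, kernel_convergent m kappa s g x} ->
  ae_eq m setT f (kernel_op m kappa s g) ->
  (gagliardo m N (a + b) p f <=
    (C0 * (K1 + K1 + (1 + K4)))%:E * gagliardo m N b p g)%E.
Proof.
move=> mf cv fJ.
have good : {ae m, forall x, kernel_convergent m kappa s g x /\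
    f x = kernel_op m kappa s g x}.
  by apply: filterS2 cv fJ => x cx /(_ Logic.I).
rewrite EFinM -muleA.
have C0E : (0 <= C0%:E)%E by rewrite lee_fin.
apply: (le_trans _ (lee_wpmul2l C0E sum_S)).
pose F x y := (`|f x - f y| `^ p / mdist x y `^ (N + (a + b) * p))%:E.
have F0 x y : (0 <= F x y)%E by rewrite lee_fin divr_ge0 ?powR_ge0.
have mF : measurable_fun setT (fun q : X * X => F q.1 q.2) by rewrite /F; meas.
apply: (ae_iterated_le good C0_ge0 mF mS F0 S_ge0) => x y [cx fx] [cy fy].
have [xy|xy] := eqVneq x y.
  have -> : F x y = 0%E by rewrite /F xy subrr normr0 powR0 ?gt_eqF// mul0r.
  exact: (mule_ge0 C0E (S_ge0 x y)).
have d0 : 0 < mdist x y by rewrite mdist_gt0.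
apply: le_trans (diff_pow d0).
rewrite /F mulrC -powRN EFinM lee_wpmul2l ?lee_fin ?powR_ge0// -poweR_EFin.
apply: le_poweR; [exact: ltW|by rewrite lee_fin|].
rewrite fx fy.
apply: (kernel_op_diff (m := m)) => //.
Qed.

End one_function.

Lemma besov_smoothing : exists2 C, 0 < C & forall f g : X -> R,
  measurable_fun setT f -> measurable_fun setT g ->
  {ae m, forall x, kernel_convergent m kappa s g x} ->
  ae_eq m setT f (kernel_op m kappa s g) ->
  (gagliardo m N (a + b) p f <= C%:E * gagliardo m N b p g)%E.
Proof.
(* The constant C0 (K1 + K1 + (1 + K4)) written out, since it must be chosen before [g], which was
   fixed where those names were introduced. The absolute value and the added 1 ensure positivity. *)
pose C := `|(a * (K + L)) `^ p * (4 `^ p * ((c * 5 `^ N / a) `^ (p - 1) +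
  (c * 5 `^ N * 2 `^ delta / delta) `^ (p - 1) + (c * 5 `^ N / a) `^ p)) *
  ((N + (b * p + a)) * c / (b * p + a) * 5 `^ E / E +
   (N + (b * p + a)) * c / (b * p + a) * 5 `^ E / E +
  (1 + (N * c / delta + c * 2 `^ N) * 5 `^ E / E))|.
exists (C + 1); first exact: (ltr_wpDl (normr_ge0 _) ltr01).
move=> f g mf mg cv fJ; apply: le_trans (besov_smoothing_bound mg mf cv fJ) _.
rewrite lee_wpmul2r ?lee_fin//.
  apply: integral_ge0 => x _; apply: integral_ge0 => y _.
  by rewrite lee_fin divr_ge0 ?powR_ge0.
by rewrite ler_wpDr// ler_norm.
Qed.

End besov_smoothing.

(** * Besov norms *)

Section besov_seminorms.
Context {d : measure_display} {R : realType} {X : borelMetricType d R}.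
Variables (m : {sigma_finite_measure set X -> \bar R}) (N c p a : R).
Hypothesis m_regular : ahlfors_regular m N.
Hypothesis c_gt0 : 0 < c.
Hypothesis N_gt0 : 0 < N.
Hypothesis m_ball : forall (x : X) (r : R), 0 < r ->
  ((c^-1 * r `^ N)%:E <= m (ball x r) <= (c * r `^ N)%:E)%E.
Hypothesis p_ge1 : 1 <= p.
Hypothesis a_gt0 : 0 < a.
Variable f : X -> R.
Hypothesis mf : measurable_fun setT f.
Notation mu := (@lebesgue_measure R).

Let p_gt0 : 0 < p. Proof. exact: lt_le_trans p_ge1. Qed.
Let E := N + a * p.
Let E_gt0 : 0 < E. Proof. by rewrite addr_gt0// mulr_gt0. Qed.

(** Kept without the outer root, so that it compares linearly with [gagliardo]. *)
Definition besov_seminorm_pow : \bar R :=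
  (\int[mu]_(t in `]0%R, +oo[)
      ((t `^ (- (a * p)) / t)%:E * besov_modulus m p f t `^ p))%E.

Ltac nneg_hook ::= fail.
Ltac meas_hook ::= meas_integral.

Let F x y := `|f x - f y| `^ p.
Let F0 x y : 0 <= F x y. Proof. exact: powR_ge0. Qed.
Let I t x := (\int[m]_y ((mdist x y < t)%R%:R * F x y)%:E)%E.
Let B t := (\int[m]_x I t x)%E.
Let I0 t x : (0 <= I t x)%E. Proof. by rewrite /I; nneg. Qed.
Let B0 t : (0 <= B t)%E. Proof. by apply: integral_ge0 => x _; exact: I0. Qed.

Let ball_inv (x : X) t : 0 < t ->
  ((c^-1 * t `^ (- N))%:E <= (m (ball x t))^-1 <= (c * t `^ (- N))%:E)%E.
Proof.
move=> t0; have tN : 0 < t `^ N by rewrite powR_gt0.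
have /andP[] := m_ball x t0.
case: (m (ball x t)) => [r| |]; last by rewrite leeNy_eq.
- rewrite !lee_fin => lo hi.
  have r0 : 0 < r by apply: lt_le_trans lo; rewrite mulr_gt0// invr_gt0.
  rewrite inver gt_eqF// !lee_fin powRN; apply/andP; split.
    by rewrite -invfM lef_pV2 ?posrE// mulr_gt0.
  rewrite -[c]invrK -invfM lef_pV2 ?posrE// mulr_gt0// invr_gt0//.
- by rewrite leye_eq.
Qed.

Let modulus_pow t : (besov_modulus m p f t `^ p =
  \int[m]_x ((m (ball x t))^-1 * I t x))%E.
Proof.
rewrite /besov_modulus -poweRrM mulVf ?gt_eqF// poweRe1; last first.
  apply: integral_ge0 => x _; rewrite mule_ge0 ?inve_ge0//.
  by apply: integral_ge0 => y _; rewrite lee_fin powR_ge0.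
apply: eq_integral => x _; congr (_ * _)%E.
rewrite integral_mkcond; apply: eq_integral => y _.
rewrite patchE ballEmdist /F.
have -> : (y \in [set z | mdist x z < t]) = (mdist x y < t).
  by apply/idP/idP; rewrite inE.
by case: (mdist x y < t); rewrite ?mul1r ?mul0r.
Qed.

Let mI t : measurable_fun setT (I t).
Proof. by rewrite /I /F; meas; nneg. Qed.

Let modulus_bounds t : 0 < t ->
  ((c^-1 * t `^ (- N))%:E * B t <= besov_modulus m p f t `^ p)%E /\
  (besov_modulus m p f t `^ p <= (c * t `^ (- N))%:E * B t)%E.
Proof.
move=> t0; rewrite modulus_pow.
have mi0 (x : X) : (0 <= (m (ball x t))^-1)%E by rewrite inve_ge0.
split.
  rewrite -ge0_integralZl//; last first.
    by rewrite lee_fin mulr_ge0 ?invr_ge0 ?powR_ge0// ltW.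
  apply: le_integral_ge0 => x _.
    by rewrite mule_ge0 ?I0// lee_fin mulr_ge0 ?invr_ge0 ?powR_ge0// ltW.
  by rewrite lee_wpmul2r//; have /andP[] := ball_inv x t0.
apply: ge0_integralZl_le => //.
- by rewrite mulr_ge0 ?powR_ge0// ltW.
- by move=> x _; rewrite mule_ge0.
by move=> x _; rewrite lee_wpmul2r//; have /andP[] := ball_inv x t0.
Qed.

Let G t x y : \bar R :=
  ((0 < t)%R%:R * t `^ (- E - 1) * ((mdist x y < t)%R%:R * F x y))%:E.
Let G0 t x y : (0 <= G t x y)%E. Proof. by rewrite /G; nneg. Qed.

(** Layer-cake formula: a pair (x, y) counts in B(t) exactly for t > d(x, y), and the integral of
    t^(- E - 1) over these t is d(x, y)^(- E) / E. By regularity the p-th power of the modulus is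
    comparable to t^(- N) B(t). *)
Let layer : (\int[mu]_t (((0 < t)%R%:R * t `^ (- E - 1))%:E * B t) =
  (E^-1)%:E * gagliardo m N a p f)%E.
Proof.
transitivity (\int[mu]_t \int[m]_x \int[m]_y G t x y)%E.
  apply: eq_integral => t _.
  have w0 : (0 <= ((0 < t)%R%:R * t `^ (- E - 1))%:E)%E.
    by rewrite lee_fin mulr_ge0 ?powR_ge0.
  rewrite -ge0_integralZl//; try by rewrite /I /F; meas; nneg.
  apply: eq_integral => x _.
  rewrite -ge0_integralZl//; try by rewrite /I /F; meas; nneg.
rewrite -(tonelli_lebesgue m (F := fun x t => \int[m]_y G t x y)%E); last 2 first.
- by rewrite /G /F; meas; nneg.
- by move=> x t; apply: integral_ge0 => y _; exact: G0.
rewrite /gagliardo -ge0_integralZl//; last 3 first.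
- by meas => x y; rewrite lee_fin divr_ge0 ?powR_ge0.
- by move=> x _; apply: integral_ge0 => y _; rewrite lee_fin divr_ge0 ?powR_ge0.
- by rewrite lee_fin invr_ge0 ltW.
apply: eq_integral => x _.
rewrite -(tonelli_lebesgue m (F := fun y t => G t x y)); last 2 first.
- by rewrite /G /F; meas.
- by move=> y t; exact: G0.
rewrite -ge0_integralZl//; last 3 first.
- by meas.
- by move=> y _; rewrite lee_fin divr_ge0 ?powR_ge0.
- by rewrite lee_fin invr_ge0 ltW.
apply: eq_integral => y _.
have [xy|xy] := eqVneq x y.
  have Fxy : F x y = 0 by rewrite /F xy subrr normr0 powR0 ?gt_eqF.
  rewrite -/(F x y) Fxy mul0r mule0 integral0_eq// => t _.
  by rewrite /G Fxy !mulr0.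
have d0 : 0 < mdist x y by rewrite mdist_gt0.
transitivity ((F x y)%:E * \int[mu]_t ((mdist x y < t)%R%:R * t `^ (- E - 1))%:E)%E.
  rewrite -ge0_integralZl; last 4 first.
  - exact: measurableT.
  - by meas.
  - by nneg.
  - by rewrite lee_fin.
  apply: eq_integral => t _; rewrite -EFinM /G; congr EFin.
  have [dt|dt] := ltP (mdist x y) t; last by rewrite !mul0r !mulr0.
  by rewrite (lt_trans d0 dt) !mul1r mulrC.
rewrite integral_indicator_tail// -!EFinM powRN; congr EFin.
by rewrite /F /E; ring.
Qed.

Let weight t : 0 < t -> t `^ (- (a * p)) / t * t `^ (- N) = t `^ (- E - 1).
Proof.
move=> t0; have -> : t^-1 = t `^ (- 1) by rewrite powR_inv1// ltW.
by rewrite !powRDpos//; congr (_ `^ _); rewrite /E; ring.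
Qed.

Let mlayer : measurable_fun [set: R]
  (fun t : R => ((0 < t)%R%:R * t `^ (- E - 1))%:E * B t)%E.
Proof. by rewrite /B /I /F; meas; nneg. Qed.

Lemma besov_seminorm_pow_le :
  (besov_seminorm_pow <= (c / E)%:E * gagliardo m N a p f)%E.
Proof.
rewrite /besov_seminorm_pow integral_mkcond EFinM -muleA -layer.
apply: ge0_integralZl_le => //.
- exact: ltW.
- move=> t _; rewrite patchE mem_setE in_itv/= andbT; case: ltP => // t0.
  by rewrite mule_ge0 ?poweR_ge0// lee_fin mulr_ge0 ?invr_ge0 ?powR_ge0// ltW.
- by move=> t _; rewrite mule_ge0// lee_fin mulr_ge0 ?powR_ge0.
move=> t _; rewrite patchE mem_setE in_itv/= andbT.
have [t0|t0] := ltP 0 t; last by rewrite mul0r mul0e mule0.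
have [_ hi] := modulus_bounds t0.
have w0 : 0 <= t `^ (- (a * p)) / t by rewrite mulr_ge0 ?powR_ge0// invr_ge0 ltW.
have w0' : (0 <= (t `^ (- (a * p)) / t)%:E)%E by [].
apply: (le_trans (lee_wpmul2l w0' hi)).
by rewrite mul1r -weight// muleA muleA -!EFinM mulrCA mulrA.
Qed.

Lemma gagliardo_le :
  (gagliardo m N a p f <= (E * c)%:E * besov_seminorm_pow)%E.
Proof.
have -> : gagliardo m N a p f =
    (E%:E * \int[mu]_t (((0 < t)%R%:R * t `^ (- E - 1))%:E * B t))%E.
  by rewrite layer muleA -EFinM divff ?gt_eqF// mul1e.
rewrite EFinM -muleA lee_wpmul2l ?lee_fin ?(ltW E_gt0)//.
have -> : (\int[mu]_t (((0 < t)%R%:R * t `^ (- E - 1))%:E * B t) = c%:E *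
    (c^-1%:E * \int[mu]_t (((0 < t)%R%:R * t `^ (- E - 1))%:E * B t)))%E.
  by rewrite muleA -EFinM divff ?gt_eqF// mul1e.
rewrite lee_wpmul2l ?lee_fin ?(ltW c_gt0)//.
have w0 t : (0 <= ((0 < t)%R%:R * t `^ (- E - 1))%:E * B t)%E.
  by rewrite mule_ge0// lee_fin mulr_ge0 ?powR_ge0.
rewrite -ge0_integralZl//; last by rewrite lee_fin invr_ge0 ltW.
rewrite /besov_seminorm_pow [leRHS]integral_mkcond.
apply: le_integral_ge0 => t _; first by rewrite mule_ge0// lee_fin invr_ge0 ltW.
rewrite patchE mem_setE in_itv/= andbT.
have [t0|t0] := ltP 0 t; last by rewrite mul0r mul0e mule0.
have [lo _] := modulus_bounds t0.
have v0 : 0 <= t `^ (- (a * p)) / t by rewrite mulr_ge0 ?powR_ge0// invr_ge0 ltW.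
have v0' : (0 <= (t `^ (- (a * p)) / t)%:E)%E by [].
apply: le_trans (lee_wpmul2l v0' lo).
by rewrite mul1r -weight// muleA muleA -!EFinM mulrCA mulrA.
Qed.

Lemma besov_seminorm_pow_ge0 : (0 <= besov_seminorm_pow)%E.
Proof.
apply: integral_ge0 => t; rewrite /= in_itv/= andbT => t0.
by rewrite mule_ge0 ?poweR_ge0// lee_fin mulr_ge0 ?powR_ge0// invr_ge0 ltW.
Qed.

Lemma besov_normE : besov_norm m a p f =
  ((\int[m]_x (`|f x| `^ p)%:E) `^ p^-1 + besov_seminorm_pow `^ p^-1)%E.
Proof. by rewrite /besov_norm unlock. Qed.

Lemma besov_norm_lty : (besov_norm m a p f < +oo)%E ->
  (\int[m]_x (`|f x| `^ p)%:E < +oo)%E /\ (besov_seminorm_pow < +oo)%E.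
Proof.
have ip : p^-1 != 0 by rewrite invr_eq0 gt_eqF.
rewrite besov_normE => h; split; apply: (@lty_poweRy _ _ p^-1) => //.
  by apply: le_lt_trans h; rewrite leeDl// poweR_ge0.
by apply: le_lt_trans h; rewrite leeDr// poweR_ge0.
Qed.

End besov_seminorms.

(** * The Bessel potential *)

Ltac nneg_hook ::= fail.
Ltac meas_hook ::= meas_integral.

Section bessel_weight.
Context {R : realType}.
Variable a : R.
Hypothesis a_gt0 : 0 < a.
Notation mu := (@lebesgue_measure R).

(** For t > 0 this is the derivative of t^a / (1 + t^a). The factors a and 1 / t are absorbed and
    the weight vanishes for t <= 0, which makes the Bessel kernel a [kernel_int]. *)
Definition bessel_weight (t : R) : R :=
  (0 < t)%R%:R * (a * (t `^ a / (1 + t `^ a) ^+ 2) / t).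

Lemma bessel_weight_ge0 t : 0 <= bessel_weight t.
Proof.
rewrite /bessel_weight; case: ltP => t0; last by rewrite mul0r.
by rewrite mul1r divr_ge0 ?(ltW t0)// mulr_ge0 ?(ltW a_gt0)// divr_ge0 ?powR_ge0// sqr_ge0.
Qed.

Lemma measurable_bessel_weight : measurable_fun setT bessel_weight.
Proof.
rewrite /bessel_weight; under eq_fun do rewrite expr2.
meas.
by apply: (measurable_fun_inv (f := fun t => t)).
Qed.

Let ratio_le (u : R) : 0 < u -> u / (1 + u) ^+ 2 <= u /\ u / (1 + u) ^+ 2 <= u^-1.
Proof.
move=> u0; have u1 : 0 < (1 + u) ^+ 2 by rewrite exprn_gt0// addr_gt0.
split; rewrite ler_pdivrMr//.
  by rewrite ler_peMr ?(ltW u0)// expr2; nra.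
by rewrite mulrC ler_pdivlMr//; nra.
Qed.

Let powR_div_var (e t : R) : 0 < t -> t `^ e / t = t `^ (e - 1).
Proof.
move=> t0; have -> : t^-1 = t `^ (- 1) by rewrite powR_inv1// ltW.
by rewrite powRDpos.
Qed.

Lemma bessel_weight_le t : bessel_weight t <= (0 < t)%R%:R * (a * t `^ (a - 1)).
Proof.
rewrite /bessel_weight; have [t0|t0] := ltP 0 t; last by rewrite !mul0r.
rewrite !mul1r -mulrA ler_wpM2l ?(ltW a_gt0)// -powR_div_var//.
rewrite ler_wpM2r ?invr_ge0 ?(ltW t0)//.
by have [] := ratio_le (powR_gt0 a t0).
Qed.

Let bessel_weight_le_inv t : 0 < t -> bessel_weight t <= a * t `^ (- a - 1).
Proof.
move=> t0; rewrite /bessel_weight t0 mul1r -mulrA ler_wpM2l ?(ltW a_gt0)//.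
rewrite -powR_div_var// ler_wpM2r ?invr_ge0 ?(ltW t0)// powRN.
by have [] := ratio_le (powR_gt0 a t0).
Qed.

(** With u = t^a, u / (1 + u)^2 is at most u and at most 1 / u. The first bound on t <= 1 and the
    second on t > 1 each contribute 1. *)
Lemma integral_bessel_weight : (\int[mu]_t (bessel_weight t)%:E <= 2%:E)%E.
Proof.
pose H1 t := ((0 < t)%R%:R * (t <= 1)%R%:R * t `^ (a - 1))%:E.
pose H2 t := ((1 < t)%R%:R * t `^ (- a - 1))%:E.
have H10 t : (0 <= H1 t)%E by rewrite /H1; nneg.
have H20 t : (0 <= H2 t)%E by rewrite /H2; nneg.
have mH1 : measurable_fun setT H1 by rewrite /H1; meas.
have mH2 : measurable_fun setT H2 by rewrite /H2; meas.
have a0' : (0 <= a%:E)%E by rewrite lee_fin ltW.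
apply: (@le_trans _ _ (a%:E * (\int[mu]_t H1 t + \int[mu]_t H2 t))%E).
  rewrite -ge0_integralD//.
  have mH : measurable_fun setT (fun t => H1 t + H2 t)%E by exact: emeasurable_funD.
  apply: ge0_integralZl_le; [by []|exact: mH|exact: ltW| | |].
  - by move=> t _; rewrite lee_fin bessel_weight_ge0.
  - by move=> t _; rewrite adde_ge0.
  move=> t _; rewrite /H1 /H2 -EFinD -EFinM lee_fin.
  have [t0|t0] := ltP 0 t; last first.
    by rewrite /bessel_weight ltNge t0/= !mul0r add0r mulr_ge0 ?mulr_ge0 ?powR_ge0// ltW.
  rewrite mul1r; have [t1|t1] := leP t 1.
    rewrite mul1r mul0r addr0; have := bessel_weight_le t.
    by rewrite t0 mul1r.
  by rewrite mul0r mul1r add0r bessel_weight_le_inv.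
apply: (@le_trans _ _ (a%:E * ((1 `^ a / a)%:E + (1 `^ (- a) / a)%:E))%E).
  rewrite lee_wpmul2l// leeD// ?integral_indicator_head//.
  by rewrite integral_indicator_tail.
rewrite -EFinD -EFinM lee_fin !powR1 le_eqVlt; apply/orP; left; apply/eqP; field.
by rewrite gt_eqF.
Qed.

End bessel_weight.

Section bessel_operator.
Context {d : measure_display} {R : realType} {X : borelMetricType d R}.
Variables (m : {sigma_finite_measure set X -> \bar R}) (N : R) (h : R -> R).
Hypothesis m_regular : ahlfors_regular m N.
Hypothesis h_cutoff : cutoff h.
Variable a : R.
Hypothesis a_gt0 : 0 < a.
Notation mu := (@lebesgue_measure R).
Let s := approx_kernel m N (cutoff_ext h).

Lemma measurable_approx_kernel_ext :
  measurable_fun setT (fun q : X * X * R => s q.1.1 q.1.2 q.2).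
Proof.
by apply: measurable_approx_kernel => //; try solve [meas];
  [exact: cutoff_ext_ge0|exact: cutoff_ext_ni].
Qed.

Lemma bessel_kernel_int x y :
  bessel_kernel m N h a x y = kernel_int (bessel_weight a) s x y.
Proof.
have s0 u v t : 0 <= s u v t by apply: approx_kernel_ge0 => ?; exact: cutoff_ext_ge0.
rewrite -bessel_kernel_ext /bessel_kernel /kernel_int integral_mkcond.
rewrite -ge0_integralZl//; last 3 first.
- apply/(measurable_restrictT _ _).1 => //; apply: measurable_funTS.
  have ms := measurable_approx_kernel_ext.
  apply: measurable_fun_EFin; apply: measurable_funM; last first.
    exact: (measurable_fun_inv (f := fun t => t)).
  apply: measurable_funM; last first.
    apply: (measurable_fun_compT (u := fun t => ((x, y), t)) ms).
    by apply: measurable_fun_pair.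
  under eq_fun do rewrite expr2.
  by meas.
- move=> t _; rewrite patchE mem_setE in_itv/= andbT; case: ltP => // t0.
  rewrite lee_fin divr_ge0 ?(ltW t0)// mulr_ge0 ?s0//.
  by rewrite divr_ge0 ?powR_ge0// sqr_ge0.
- by rewrite lee_fin ltW.
apply: eq_integral => t _; rewrite patchE mem_setE in_itv/= andbT /bessel_weight.
case: ltP => t0; last by rewrite !mul0r mule0.
by rewrite mul1r -EFinM /s; congr EFin; ring.
Qed.

Lemma bessel_convergentE g x :
  bessel_convergent m N h a g x = kernel_convergent m (bessel_weight a) s g x.
Proof.
rewrite /bessel_convergent /kernel_convergent.
by under eq_fun do rewrite bessel_kernel_int.
Qed.

Lemma bessel_potentialE g :
  bessel_potential m N h a g = kernel_op m (bessel_weight a) s g.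
Proof.
apply/funext => x; rewrite /bessel_potential /kernel_op.
by under eq_integral do rewrite bessel_kernel_int.
Qed.

End bessel_operator.

(** On a set of finite measure, |f| <= 1 + |f|^p suffices. This supplies the local integrability
    that membership in [besov] demands. *)
Lemma integrable_ball_Lp {d : measure_display} {R : realType} {X : borelMetricType d R}
    (m : {measure set X -> \bar R}) (p r : R) (f : X -> R) (x : X) : 1 <= p ->
  measurable_fun setT f -> (\int[m]_x (`|f x| `^ p)%:E < +oo)%E ->
  (m (ball x r) < +oo)%E -> m.-integrable (ball x r) (EFin \o f).
Proof.
move=> p1 mf fp Boo; have mB := measurable_ball_borel x r.
have mfp : measurable_fun setT (fun y => `|f y| `^ p) by meas.
apply/integrableP; split.
  by apply: measurable_funTS; exact: measurable_fun_EFin.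
apply: (@le_lt_trans _ _ (\int[m]_(y in ball x r) (1%:E + (`|f y| `^ p)%:E))%E).
  apply: le_integral_ge0 => y _; first exact: abse_ge0.
  rewrite /= -EFinD lee_fin; have [f1|/ltW f1] := leP `|f y| 1.
    by rewrite (le_trans f1)// lerDl powR_ge0.
  by rewrite (le_trans (le1r_powR f1 p1))// lerDr.
rewrite ge0_integralD//; try solve
  [ by move=> y _; rewrite lee_fin ?powR_ge0
  | by apply: measurable_funTS; exact: measurable_fun_EFin ].
rewrite lte_add_pinfty//.
  by rewrite integral_cst// mul1e.
apply: le_lt_trans fp; apply: ge0_subset_integral => //.
exact: measurable_fun_EFin.
Qed.

(** * The theorem for a sigma-finite measure *)

Section sigma_finite_case.
Context {d : measure_display} {R : realType} {X : borelMetricType d R}.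
Variables (m : {sigma_finite_measure set X -> \bar R}) (N : R) (h : R -> R).
Variables (p alpha beta : R).
Hypothesis N_gt0 : 0 < N.
Hypothesis m_regular : ahlfors_regular m N.
Hypothesis h_cutoff : cutoff h.
Hypothesis p_ge1 : 1 <= p.
Hypothesis alpha_gt0 : 0 < alpha.
Hypothesis beta_gt0 : 0 < beta.
Hypothesis alpha_beta : alpha + beta < 1.

Let p_gt0 : 0 < p. Proof. exact: lt_le_trans p_ge1. Qed.
Let ab_gt0 : 0 < alpha + beta. Proof. by rewrite addr_gt0. Qed.
Let s := approx_kernel m N (cutoff_ext h).
Let kappa := bessel_weight alpha.
Local Notation J := (kernel_op m kappa s).
Local Notation conv := (kernel_convergent m kappa s).

Let h0 := cutoff_ext_ge0 h_cutoff.
Let hni := cutoff_ext_ni h_cutoff.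
Let hone := cutoff_ext_one h_cutoff.
Let hzero := cutoff_ext_zero h_cutoff.

Let kappa0 t : 0 <= kappa t. Proof. exact: bessel_weight_ge0. Qed.
Let kappa_le0 t : t <= 0 -> kappa t = 0.
Proof. by move=> t0; rewrite /kappa /bessel_weight ltNge t0/= mul0r. Qed.
Let mkappa : measurable_fun setT kappa. Proof. exact: measurable_bessel_weight. Qed.
Let int_kappa := integral_bessel_weight alpha_gt0.
Let s0 x y t : 0 <= s x y t. Proof. exact: approx_kernel_ge0. Qed.
Let sC x y t : s x y t = s y x t. Proof. exact: approx_kernelC. Qed.
Let ms : measurable_fun setT (fun q : X * X * R => s q.1.1 q.1.2 q.2).
Proof. exact: measurable_approx_kernel_ext. Qed.
Let int_s x t : 0 < t -> (\int[m]_y (s x y t)%:E = 1)%E.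
Proof.
have [c c0 hc] := m_regular; have [L hL] := cutoff_ext_lipschitz h_cutoff.
exact: (integral_approx_kernel m_regular c0 hc h0 hni hone hzero).
Qed.

Let smoothing : exists2 C, 0 < C & forall f g : X -> R,
  measurable_fun setT f -> measurable_fun setT g ->
  {ae m, forall x, conv g x} -> ae_eq m setT f (J g) ->
  (gagliardo m N (alpha + beta) p f <= C%:E * gagliardo m N beta p g)%E.
Proof.
have [c c0 hc] := m_regular; have [L hL] := cutoff_ext_lipschitz h_cutoff.
have [K K0 sK] : exists2 K, 0 <= K & forall x y t, 0 < t ->
    s x y t <= K * t `^ (- N) * (mdist x y < 4 * t)%R%:R.
  exists ((c * 2 `^ N) ^+ 5); first by rewrite exprn_ge0// mulr_ge0 ?powR_ge0// ltW.
  by move=> x y t t0; exact: (approx_kernel_le m_regular c0 hc h0 hni hone hzero).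
have [K' K'0 sL] := approx_kernel_lip m_regular c0 hc h0 hni hone hzero hL.
apply: (besov_smoothing m_regular c0 N_gt0 hc p_ge1 alpha_gt0 beta_gt0 alpha_beta
  K0 K'0 kappa0 _ mkappa int_kappa s0 ms int_s sK sL).
exact: bessel_weight_le.
Qed.

Let conv_ae (g : X -> R) : measurable_fun setT g ->
  (\int[m]_x (`|g x| `^ p)%:E < +oo)%E -> {ae m, forall x, conv g x}.
Proof. exact: (kernel_convergent_ae kappa0 kappa_le0 mkappa int_kappa s0 sC ms int_s p_ge1). Qed.

Let mJ (g : X -> R) : measurable_fun setT g -> measurable_fun setT (J g).
Proof. exact: measurable_kernel_op. Qed.

(** Stated for any f equal to J g almost everywhere because linearity of J is only available almost
    everywhere: continuity at g0 applies the bound to J g - J g0 and g - g0. *)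
Let bounded : exists2 C, 0 < C & forall f g : X -> R,
  measurable_fun setT f -> measurable_fun setT g ->
  {ae m, forall x, conv g x} -> ae_eq m setT f (J g) ->
  (besov_norm m (alpha + beta) p f <= C%:E * besov_norm m beta p g)%E.
Proof.
have [C C0 HC] := smoothing.
have [c c0 hc] := m_regular.
pose E1 := N + beta * p; pose E2 := N + (alpha + beta) * p.
have E10 : 0 < E1 by rewrite addr_gt0// mulr_gt0.
have E20 : 0 < E2 by rewrite addr_gt0// mulr_gt0.
(* The smoothing constant C between the two passages from modulus to double integral: c / E2 for f
   at order alpha + beta, E1 c for g at order beta. The 2 in [D] below is the p-th root of the
   constant of [kernel_op_Lp]. *)
pose K := c / E2 * (C * (E1 * c)).
have K0 : 0 < K by apply: mulr_gt0; [exact: divr_gt0|apply: mulr_gt0 => //; exact: mulr_gt0].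
have ip0 : 0 < p^-1 by rewrite invr_gt0.
pose D := 2 + K `^ p^-1.
have D0 : 0 < D by rewrite addr_gt0// powR_gt0.
exists D => // f g mf mg cv fJ.
rewrite !besov_normE.
set G := (\int[m]_x (`|g x| `^ p)%:E)%E.
have G0 : (0 <= G)%E by apply: integral_ge0 => x _; rewrite lee_fin powR_ge0.
have T0 := besov_seminorm_pow_ge0 m p beta g.
set Tg := besov_seminorm_pow m p beta g in T0 *.
have h1 : ((\int[m]_x (`|f x| `^ p)%:E) `^ p^-1 <= 2%:E * G `^ p^-1)%E.
  have fE : (\int[m]_x (`|f x| `^ p)%:E = \int[m]_x (`|J g x| `^ p)%:E)%E.
    have mJg := mJ mg.
    apply: ge0_ae_eq_integral => //;
      try solve [ by meas | by move=> x _; rewrite lee_fin powR_ge0 ].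
    by apply: filterS fJ => x /(_ Logic.I) ->.
  have hJ := kernel_op_Lp kappa0 kappa_le0 mkappa int_kappa s0 sC ms int_s p_ge1 mg.
  have -> : (2%:E * G `^ p^-1 = ((2 `^ p)%:E * G) `^ p^-1)%E.
    have tp0 : (0 <= (2 `^ p)%:E :> \bar R)%E by rewrite lee_fin powR_ge0.
    by rewrite (poweRM _ tp0 G0) poweR_EFin -powRrM divff ?gt_eqF// powRr1.
  rewrite fE; apply: le_poweR; [exact: ltW| |exact: hJ].
  by apply: integral_ge0 => x _; rewrite lee_fin powR_ge0.
have h2 : (besov_seminorm_pow m p (alpha + beta) f `^ p^-1 <=
    (K `^ p^-1)%:E * Tg `^ p^-1)%E.
  have -> : ((K `^ p^-1)%:E * Tg `^ p^-1 = (K%:E * Tg) `^ p^-1)%E.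
    by rewrite poweRM ?lee_fin ?(ltW K0)// poweR_EFin.
  apply: le_poweR; [exact: ltW|exact: besov_seminorm_pow_ge0|].
  apply: (le_trans (besov_seminorm_pow_le m_regular c0 N_gt0 hc p_ge1 ab_gt0 mf)).
  have HC' := HC f g mf mg cv fJ.
  have Hg := gagliardo_le m_regular c0 N_gt0 hc p_ge1 beta_gt0 mg.
  have w1 : (0 <= (c / E2)%:E)%E by rewrite lee_fin divr_ge0// ltW.
  have w2 : (0 <= C%:E)%E by rewrite lee_fin ltW.
  apply: (le_trans (lee_wpmul2l w1 (le_trans HC' (lee_wpmul2l w2 Hg)))).
  by rewrite /K !EFinM !muleA.
have w3 : (2%:E <= D%:E)%E by rewrite lee_fin lerDl powR_ge0.
have w4 : ((K `^ p^-1)%:E <= D%:E)%E by rewrite lee_fin lerDr.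
have p1 := poweR_ge0 G p^-1; have p2 := poweR_ge0 Tg p^-1.
rewrite (ge0_muleDr _ p1 p2); apply: leeD.
- exact: (le_trans h1 (lee_wpmul2r p1 w3)).
- exact: (le_trans h2 (lee_wpmul2r p2 w4)).
Qed.

Let besov_Lp (a : R) (g : X -> R) : besov m a p g ->
  measurable_fun setT g /\ (\int[m]_x (`|g x| `^ p)%:E < +oo)%E.
Proof. by move=> [[mg _] /(besov_norm_lty p_ge1)[]]. Qed.

Let besov_map (g : X -> R) : besov m beta p g -> besov m (alpha + beta) p (J g).
Proof.
move=> gB; have [mg gp] := besov_Lp gB.
have [C C0 HC] := bounded; have cv := conv_ae mg gp.
have Jn : (besov_norm m (alpha + beta) p (J g) < +oo)%E.
  apply: (le_lt_trans (HC _ _ (mJ mg) mg cv _)); first by apply: filterE => x.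
  by case: gB => _ gn; rewrite lte_mul_pinfty ?lee_fin ?(ltW C0).
split => //; split; first exact: mJ.
move=> x r r0; have [Jp _] := besov_norm_lty p_ge1 Jn.
apply: (integrable_ball_Lp p_ge1 (mJ mg) Jp).
have [c c0 hc] := m_regular; have /andP[_ /le_lt_trans] := hc x r r0.
by apply; rewrite ltry.
Qed.

Lemma besov_smoothing_sigma_finite :
  (exists2 C : R, 0 < C & forall f g : X -> R,
     measurable_fun [set: X] f -> measurable_fun [set: X] g ->
     {ae m, forall x, bessel_convergent m N h alpha g x} ->
     ae_eq m [set: X] f (bessel_potential m N h alpha g) ->
     (gagliardo m N (alpha + beta) p f <= C%:E * gagliardo m N beta p g)%E) /\
  (forall g : X -> R, besov m beta p g ->
     {ae m, forall x, bessel_convergent m N h alpha g x}) /\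
  continuous_linear_operator m
    (besov m beta p) (besov m (alpha + beta) p)
    (besov_norm m beta p) (besov_norm m (alpha + beta) p)
    (bessel_potential m N h alpha).
Proof.
have cE g : bessel_convergent m N h alpha g = conv g.
  by apply/funext => x; exact: bessel_convergentE.
have JE : bessel_potential m N h alpha = kernel_op m kappa s.
  by apply/funext => g; exact: bessel_potentialE.
split; [|split].
- have [C C0 HC] := smoothing; exists C => // f g mf mg cv.
  by rewrite JE; apply: HC => //; rewrite -cE.
- by move=> g /besov_Lp[mg gp]; rewrite cE; exact: conv_ae.
rewrite JE; split.
- exact: besov_map.
- move=> g1 g2 /besov_Lp[mg1 _] /besov_Lp[mg2 _] g12.
  by apply: filterE => x _; exact: kernel_op_ae_eq.
- move=> k g1 g2 /besov_Lp[mg1 gp1] /besov_Lp[mg2 gp2].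
  apply: filterS2 (conv_ae mg1 gp1) (conv_ae mg2 gp2) => x c1 c2 _.
  by apply: kernel_op_linear.
move=> g0 g0B e e0; have [C C0 HC] := bounded.
have [mg0 gp0] := besov_Lp g0B.
exists (e / C); first by rewrite divr_gt0.
move=> g gB ge; have [mg gp] := besov_Lp gB.
have mgg : measurable_fun setT (g \- g0) by exact: measurable_funB.
have [ggp _] := besov_norm_lty p_ge1 (lt_trans ge (ltry _)).
have cgg := conv_ae mgg ggp.
have lin : ae_eq m setT (J g \- J g0) (J (g \- g0)).
  apply: filterS2 (conv_ae mg gp) (conv_ae mg0 gp0) => x c1 c2 _.
  have : J (fun z => -1 * g0 z + g z) x = -1 * J g0 x + J g x.
    by apply: kernel_op_linear.
  have -> : (fun z => -1 * g0 z + g z) = g \- g0.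
    by apply/funext => z /=; rewrite mulN1r addrC.
  by move=> -> /=; rewrite mulN1r addrC.
apply: (le_lt_trans (HC _ _ _ mgg cgg lin)).
  by apply: measurable_funB; exact: mJ.
have -> : e%:E = (C%:E * (e / C)%:E)%E.
  by rewrite -EFinM mulrCA divff ?gt_eqF// mulr1.
by rewrite lte_pmul2l.
Qed.

End sigma_finite_case.

Theorem proposition3p4 (R : realType) (d : measure_display)
    (X : borelMetricType d R) (m : {measure set X -> \bar R}) (N : R)
    (h : R -> R) (p alpha beta : R)
    (N_gt0 : 0 < N) (m_infty : m [set: X] = +oo%E)
    (m_regular : ahlfors_regular m N) (h_cutoff : cutoff h)
    (p_ge1 : 1 <= p) (alpha_gt0 : 0 < alpha) (beta_gt0 : 0 < beta)
    (alpha_beta : alpha + beta < 1) :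
  (exists2 C : R, 0 < C & forall f g : X -> R,
     measurable_fun [set: X] f -> measurable_fun [set: X] g ->
     {ae m, forall x, bessel_convergent m N h alpha g x} ->
     ae_eq m [set: X] f (bessel_potential m N h alpha g) ->
     (\int[m]_x \int[m]_y
        (`|f x - f y| `^ p / mdist x y `^ (N + (alpha + beta) * p))%:E
      <= C%:E * \int[m]_x \int[m]_z
        (`|g x - g z| `^ p / mdist x z `^ (N + beta * p))%:E)%E) /\
  (forall g : X -> R, besov m beta p g ->
     {ae m, forall x, bessel_convergent m N h alpha g x}) /\
  continuous_linear_operator m
    (besov m beta p) (besov m (alpha + beta) p)
    (besov_norm m beta p) (besov_norm m (alpha + beta) p)
    (bessel_potential m N h alpha).
Proof.
(* Tonelli's theorem is available for the structure of sigma-finite measures, whereas here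
   sigma-finiteness is a consequence of regularity. So [m] is repackaged as [m'], which is equal to
   it, and the result is transported back. *)
have sf := ahlfors_sigma_finite m_regular.
pose F := sfinite_measure_sigma_finite sf.
pose M1 := isSFinite.Build _ _ _ (Measure.sort m) F.
pose M2 := isSigmaFinite.Build _ _ _ (Measure.sort m) sf.
pose m' := HB.pack_for (SigmaFiniteMeasure.type X R) (Measure.sort m) M1 M2.
have mE : m = m' by exact: eq_measure.
have := @besov_smoothing_sigma_finite d R X m' N h p alpha beta N_gt0.
rewrite -mE => main; exact: main.
Qed.
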